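(* In Zermelo–Fraenkel set theory (without choice), the following statements are equivalent: (1) the Axiom of Choice holds; (2) every commutative semiring with $1\neq 0$ has a maximal ideal; (3) every commutative ring with $1\neq 0$ has a maximal ideal; (4) every unique factorization domain has a maximal ideal.
   Context: A commutative semiring is a set $S$ with operations $+,\cdot$ and elements $0\neq 1$ such that $(S,+,0)$ and $(S,\cdot,1)$ are commutative monoids, multiplication distributes over addition, and $a\cdot 0=0$ for all $a\in S$ (subtraction need not be possible). An ideal of $S$ is a nonempty subset $I$ with $a+b\in I$ for all $a,b\in I$ and $sa\in I$ for all $s\in S$, $a\in I$. A proper ideal $\mathfrak m\neq S$ is maximal if $\mathfrak m\subseteq I\subseteq S$ for an ideal $I$ implies $I=\mathfrak m$ or $I=S$. *)

(* Defs.v *)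
(** "In ZF, ..." is read as "in every model of first-order ZF, ...".  A model
    is a type with a binary relation, and equality is interpreted as Leibniz
    equality.  The Separation and Replacement schemas range over first-order
    formulas with parameters, not over arbitrary Rocq predicates: a model of
    the second-order schemas would inherit choice from the metatheory.

    All the set-theoretic notions below (functions, semirings, ideals, finite
    sequences, ...) are internal to the model: they quantify over its elements
    only.  A set-theoretic operation such as the ordered pair is expressed by
    its defining relation, since the language has no function symbol. *)

Record set_structure := SetStructure {
  carrier :> Type;
  mem : carrier -> carrier -> Prop
}.

Arguments mem {s} _ _.

Notation "x ∈ y" := (mem x y) (at level 70, no associativity).

(** De Bruijn indices: [FAll] and [FEx] bind index 0. *)
Inductive formula : Type :=
| FMem (i j : nat)
| FEq (i j : nat)
| FBot
| FImp (phi psi : formula)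
| FAnd (phi psi : formula)
| FOr (phi psi : formula)
| FAll (phi : formula)
| FEx (phi : formula).

Definition scons {T : Type} (x : T) (rho : nat -> T) (n : nat) : T :=
  match n with
  | O => x
  | S n => rho n
  end.

Fixpoint sat {M : set_structure} (rho : nat -> M) (phi : formula) : Prop :=
  match phi with
  | FMem i j => rho i ∈ rho j
  | FEq i j => rho i = rho j
  | FBot => False
  | FImp phi psi => sat rho phi -> sat rho psi
  | FAnd phi psi => sat rho phi /\ sat rho psi
  | FOr phi psi => sat rho phi \/ sat rho psi
  | FAll phi => forall x : M, sat (scons x rho) phi
  | FEx phi => exists x : M, sat (scons x rho) phi
  end.

Definition subset {M : set_structure} (a b : M) : Prop :=
  forall x, x ∈ a -> x ∈ b.

Definition is_empty {M : set_structure} (e : M) : Prop :=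
  forall x, ~ x ∈ e.

Definition is_upair {M : set_structure} (c a b : M) : Prop :=
  forall x, x ∈ c <-> x = a \/ x = b.

Definition is_union {M : set_structure} (u a : M) : Prop :=
  forall x, x ∈ u <-> exists y, y ∈ a /\ x ∈ y.

Definition is_powerset {M : set_structure} (p a : M) : Prop :=
  forall x, x ∈ p <-> subset x a.

Definition is_succ {M : set_structure} (s n : M) : Prop :=
  forall x, x ∈ s <-> x ∈ n \/ x = n.

Definition inductive_set {M : set_structure} (w : M) : Prop :=
  (exists e, is_empty e /\ e ∈ w) /\
  (forall n, n ∈ w -> exists s, is_succ s n /\ s ∈ w).

Record ZF (M : set_structure) : Prop := {
  zf_extensionality :
    forall a b : M, (forall x, x ∈ a <-> x ∈ b) -> a = b;
  zf_foundation :
    forall a : M, (exists x, x ∈ a) ->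
      exists x, x ∈ a /\ forall y, y ∈ x -> ~ y ∈ a;
  zf_pairing : forall a b : M, exists c, is_upair c a b;
  zf_union : forall a : M, exists u, is_union u a;
  zf_powerset : forall a : M, exists p, is_powerset p a;
  zf_infinity : exists w : M, inductive_set w;
  zf_separation :
    forall (phi : formula) (rho : nat -> M) (a : M),
      exists b, forall x, x ∈ b <-> x ∈ a /\ sat (scons x rho) phi;
  zf_replacement :
    forall (phi : formula) (rho : nat -> M) (a : M),
      (forall x y y', x ∈ a ->
         sat (scons x (scons y rho)) phi ->
         sat (scons x (scons y' rho)) phi -> y = y') ->
      exists b, forall y,
        y ∈ b <-> exists x, x ∈ a /\ sat (scons x (scons y rho)) phi
}.

(** Kuratowski pair: [p] is [{{a}, {a, b}}]. *)
Definition is_opair {M : set_structure} (p a b : M) : Prop :=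
  forall x, x ∈ p <-> is_upair x a a \/ is_upair x a b.

Definition is_product {M : set_structure} (P A B : M) : Prop :=
  forall p, p ∈ P <-> exists a b, a ∈ A /\ b ∈ B /\ is_opair p a b.

(** [maps f x y] means [f(x) = y]. *)
Definition maps {M : set_structure} (f x y : M) : Prop :=
  exists p, is_opair p x y /\ p ∈ f.

Definition is_function {M : set_structure} (f A B : M) : Prop :=
  (forall p, p ∈ f -> exists x y, x ∈ A /\ y ∈ B /\ is_opair p x y) /\
  (forall x, x ∈ A -> exists! y, maps f x y).

Definition is_bijection {M : set_structure} (f A B : M) : Prop :=
  is_function f A B /\ (forall y, y ∈ B -> exists! x, maps f x y).

Definition axiom_of_choice (M : set_structure) : Prop :=
  forall X : M, (forall x, x ∈ X -> exists y, y ∈ x) ->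
    exists U f : M,
      is_union U X /\ is_function f X U /\
      (forall x y, x ∈ X -> maps f x y -> y ∈ x).

Definition is_binop {M : set_structure} (f A : M) : Prop :=
  exists P, is_product P A A /\ is_function f P A.

(** [op f x y z] means [f(x, y) = z]. *)
Definition op {M : set_structure} (f x y z : M) : Prop :=
  exists p, is_opair p x y /\ maps f p z.

(** Equations between compound terms name every intermediate value: [ab], [bc],
    ... below.  As the operations are total and single-valued on the carrier,
    these are the usual equations. *)
Definition is_comm_monoid {M : set_structure} (A f e : M) : Prop :=
  is_binop f A /\ e ∈ A /\
  (forall a b c ab bc d, a ∈ A -> b ∈ A -> c ∈ A ->
     op f a b ab -> op f b c bc -> op f ab c d -> op f a bc d) /\
  (forall a b c, a ∈ A -> b ∈ A -> op f a b c -> op f b a c) /\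
  (forall a, a ∈ A -> op f e a a).

Record srdata (M : set_structure) := SRData {
  sr_set : M;
  sr_add : M;
  sr_mul : M;
  sr_zero : M;
  sr_one : M
}.

Arguments SRData {M} _ _ _ _ _.
Arguments sr_set {M} _.
Arguments sr_add {M} _.
Arguments sr_mul {M} _.
Arguments sr_zero {M} _.
Arguments sr_one {M} _.

Record is_comm_semiring {M : set_structure} (S : srdata M) : Prop := {
  sr_add_monoid : is_comm_monoid (sr_set S) (sr_add S) (sr_zero S);
  sr_mul_monoid : is_comm_monoid (sr_set S) (sr_mul S) (sr_one S);
  sr_distr :
    forall a b c bc ab ac d,
      a ∈ sr_set S -> b ∈ sr_set S -> c ∈ sr_set S ->
      op (sr_add S) b c bc -> op (sr_mul S) a b ab -> op (sr_mul S) a c ac ->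
      op (sr_mul S) a bc d -> op (sr_add S) ab ac d;
  sr_mul_zero :
    forall a, a ∈ sr_set S -> op (sr_mul S) a (sr_zero S) (sr_zero S);
  sr_nontrivial : sr_zero S <> sr_one S
}.

(** The clause [a * 0 = 0] of semirings is redundant for rings. *)
Definition is_comm_ring {M : set_structure} (R : srdata M) : Prop :=
  is_comm_semiring R /\
  (forall a, a ∈ sr_set R ->
     exists b, b ∈ sr_set R /\ op (sr_add R) a b (sr_zero R)).

Definition is_ideal {M : set_structure} (S : srdata M) (I : M) : Prop :=
  subset I (sr_set S) /\
  (exists a, a ∈ I) /\
  (forall a b c, a ∈ I -> b ∈ I -> op (sr_add S) a b c -> c ∈ I) /\
  (forall s a c, s ∈ sr_set S -> a ∈ I -> op (sr_mul S) s a c -> c ∈ I).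

Definition is_maximal_ideal {M : set_structure} (S : srdata M) (m : M) : Prop :=
  is_ideal S m /\ m <> sr_set S /\
  (forall I, is_ideal S I -> subset m I -> I = m \/ I = sr_set S).

Definition has_maximal_ideal {M : set_structure} (S : srdata M) : Prop :=
  exists m, is_maximal_ideal S m.

Definition is_domain {M : set_structure} (R : srdata M) : Prop :=
  is_comm_ring R /\
  (forall a b, a ∈ sr_set R -> b ∈ sr_set R ->
     op (sr_mul R) a b (sr_zero R) -> a = sr_zero R \/ b = sr_zero R).

Definition is_unit {M : set_structure} (R : srdata M) (u : M) : Prop :=
  u ∈ sr_set R /\ exists v, v ∈ sr_set R /\ op (sr_mul R) u v (sr_one R).

Definition is_irreducible {M : set_structure} (R : srdata M) (p : M) : Prop :=
  p ∈ sr_set R /\ p <> sr_zero R /\ ~ is_unit R p /\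
  (forall a b, a ∈ sr_set R -> b ∈ sr_set R -> op (sr_mul R) a b p ->
     is_unit R a \/ is_unit R b).

Definition associated {M : set_structure} (R : srdata M) (a b : M) : Prop :=
  exists u, is_unit R u /\ op (sr_mul R) u a b.

(** Natural numbers are the von Neumann naturals of the model, which may be
    nonstandard; hence finite products are also defined inside the model. *)
Definition is_nat {M : set_structure} (n : M) : Prop :=
  forall w, inductive_set w -> n ∈ w.

(** [a] is the product of the sequence [x(0), ..., x(n-1)]: [q(i)] is the
    product of the first [i] terms. *)
Definition seq_product {M : set_structure} (R : srdata M) (x n a : M) : Prop :=
  exists n' q,
    is_succ n' n /\ is_function q n' (sr_set R) /\
    (forall e, is_empty e -> maps q e (sr_one R)) /\
    (forall i i' u v w, i ∈ n -> is_succ i' i ->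
       maps q i u -> maps x i v -> op (sr_mul R) u v w -> maps q i' w) /\
    maps q n a.

Definition factorization {M : set_structure} (R : srdata M) (x n a : M) : Prop :=
  is_nat n /\ is_function x n (sr_set R) /\
  (forall i p, i ∈ n -> maps x i p -> is_irreducible R p) /\
  seq_product R x n a.

Record is_UFD {M : set_structure} (R : srdata M) : Prop := {
  ufd_domain : is_domain R;
  ufd_existence :
    forall a, a ∈ sr_set R -> a <> sr_zero R -> ~ is_unit R a ->
      exists x n, factorization R x n a;
  ufd_uniqueness :
    forall a x n y m, a ∈ sr_set R -> a <> sr_zero R -> ~ is_unit R a ->
      factorization R x n a -> factorization R y m a ->
      n = m /\
      exists s, is_bijection s n m /\
        (forall i j p q, i ∈ n -> maps s i j -> maps x i p -> maps y j q ->
           associated R p q)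
}.

(* Main.v *)
(** Only the implication from (4) to (1) is hard.  Following Hodges and Banaschewski, let
    [E] be a relation between [I] and [U] with [E i] nonempty for every [i], and let [A] be a
    polynomial ring over [Q] with a variable [x(i,u)] for each pair and countably many
    auxiliary variables.  For a partial choice function [P] (a set of pairs) let [(P)] be the
    prime ideal generated by the variables in [P], and let [S] be the complement of the union
    of all [(P)].  The localization of [A] at [S] is a UFD.  A maximal ideal of it contracts to
    an ideal [J] of [A] contained in the union of the [(P)], and maximal as such.  Two elements
    [f], [g] of [J] lie in a common [(P)], as one sees on [f + t g] for a fresh auxiliary
    variable [t]; hence [J] contains at most one [x(i,u)] for each [i].  If it contained none,
    there would be for each [u] an element of [J] all of whose [(P)] choose at [i] something
    else than [u]; combining finitely many of these gives a contradiction, since some element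
    only involves finitely many variables.  So [J] defines a choice function.

    Polynomials are polynomial functions on [V -> Q], so that the ring laws hold pointwise.
    Their unique factorization is Gauss's lemma, by induction on finite sets of variables. *)
Require Import Defs.
From Stdlib Require Import Classical ClassicalEpsilon FunctionalExtensionality PropExtensionality Ring.

(* The metatheory has choice and the model need not, so an object picked outside may be used inside
   only once it is shown to be internal. Picks are confined to objects that are determined uniquely,
   or to representatives on which the result does not depend. The naturals of the model may be
   nonstandard; hence induction and finiteness are internal too, and minimal elements and closed
   sets take the place of lists and chains of divisors.

   The field [Q] is built without choice and is infinite; over a finite field, distinct polynomials
   could be equal as functions. Unique factorization is proved in finitely many variables, where
   minimal counterexamples are available. A prime found there stays prime in all variables, and
   after localization it stays prime or becomes a unit.

   Localization is what makes a maximal ideal informative. The ring [A] itself always has maximal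
   ideals, such as the kernel of the evaluation at zero, and these say nothing about choice. Once
   the elements outside every [(P)] are units, a proper ideal can only contract to elements that lie
   in some [(P)]. *)
Existing Class ZF.

(** * Predicates definable by first-order formulas *)

Section Definability.
Context {M : set_structure}.

(** Predicates are written directly in Rocq and only the existence of a formula is proved, so that
    no formula has to be written with de Bruijn indices. Parameters are entries of the
    environment. *)
Definition dfn (P : (nat -> M) -> Prop) : Prop :=
  exists phi, forall e, sat e phi <-> P e.

Lemma dfn_mem (i j : nat) : dfn (fun e => e i ∈ e j).
Proof. exists (FMem i j); firstorder. Qed.

Lemma dfn_eq (i j : nat) : dfn (fun e => e i = e j).
Proof. exists (FEq i j); firstorder. Qed.

Lemma dfn_imp P Q : dfn P -> dfn Q -> dfn (fun e => P e -> Q e).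
Proof. intros [p Hp] [q Hq]; exists (FImp p q); intros e; simpl; rewrite Hp, Hq; tauto. Qed.

Lemma dfn_and P Q : dfn P -> dfn Q -> dfn (fun e => P e /\ Q e).
Proof. intros [p Hp] [q Hq]; exists (FAnd p q); intros e; simpl; rewrite Hp, Hq; tauto. Qed.

Lemma dfn_or P Q : dfn P -> dfn Q -> dfn (fun e => P e \/ Q e).
Proof. intros [p Hp] [q Hq]; exists (FOr p q); intros e; simpl; rewrite Hp, Hq; tauto. Qed.

Lemma dfn_iff P Q : dfn P -> dfn Q -> dfn (fun e => P e <-> Q e).
Proof. intros HP HQ; apply dfn_and; apply dfn_imp; assumption. Qed.

Lemma dfn_false : dfn (fun _ => False).
Proof. exists FBot; firstorder. Qed.

Lemma dfn_not P : dfn P -> dfn (fun e => ~ P e).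
Proof. intros HP; apply dfn_imp; [exact HP | exact dfn_false]. Qed.

(** Since [P] takes the environment and the bound value separately, the shift of indices under the
    quantifier is done by conversion: [e i] becomes [e (S i)]. *)
Lemma dfn_ex (P : (nat -> M) -> M -> Prop) :
  dfn (fun e => P (fun n => e (S n)) (e 0)) -> dfn (fun e => exists x, P e x).
Proof.
  intros [p Hp]; exists (FEx p); intros e; simpl.
  split; intros [x Hx]; exists x; apply (Hp (scons x e)); exact Hx.
Qed.

Lemma dfn_all (P : (nat -> M) -> M -> Prop) :
  dfn (fun e => P (fun n => e (S n)) (e 0)) -> dfn (fun e => forall x, P e x).
Proof.
  intros [p Hp]; exists (FAll p); intros e; simpl.
  split; intros H x; apply (Hp (scons x e)); apply H.
Qed.

End Definability.

Ltac dfn_tac :=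
  repeat first
    [ apply dfn_mem | apply dfn_eq | apply dfn_iff | apply dfn_and | apply dfn_or
    | apply dfn_not | apply dfn_imp | apply dfn_all | apply dfn_ex ].

Ltac is_pair_dfn := unfold is_opair, is_upair; dfn_tac.

(** * Basic sets of a model *)

Section Sets.
Context {M : set_structure} {HM : ZF M}.

Lemma separation (P : (nat -> M) -> Prop) (rho : nat -> M) (a : M) :
  dfn P -> exists b, forall x, x ∈ b <-> x ∈ a /\ P (scons x rho).
Proof.
  intros [phi Hphi].
  destruct (zf_separation M HM phi rho a) as [b Hb].
  exists b; intros x; rewrite Hb, Hphi; tauto.
Qed.

Lemma set_ext (a b : M) : (forall x, x ∈ a <-> x ∈ b) -> a = b.
Proof. apply (zf_extensionality M HM). Qed.

(** The pick is harmless: by extensionality there is only one such set. The same holds for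
    [product], [powerset] and [omega]. *)
Definition upair (a b : M) : M :=
  proj1_sig (constructive_indefinite_description _ (zf_pairing M HM a b)).

Lemma upairP a b : is_upair (upair a b) a b.
Proof. unfold upair; destruct constructive_indefinite_description; assumption. Qed.

Lemma upair_eq c a b : is_upair c a b -> c = upair a b.
Proof. intros H; apply set_ext; intros x; rewrite (H x), (upairP a b x); tauto. Qed.

Definition opair (a b : M) : M := upair (upair a a) (upair a b).

Lemma is_opairE p a b : is_opair p a b <-> p = opair a b.
Proof.
  assert (E : forall x, is_upair x a a \/ is_upair x a b <-> x = upair a a \/ x = upair a b).
  { intros x; split; (intros [H|H]; [left|right]);
      first [apply upair_eq; exact H | subst x; apply upairP]. }
  split; intros H.
  - apply upair_eq; intros x; rewrite (H x); apply E.
  - subst p; intros x; rewrite E; apply upairP.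
Qed.

Lemma upair_inj a b c d : upair a b = upair c d -> a = c /\ b = d \/ a = d /\ b = c.
Proof.
  intros H.
  assert (E : forall x, x = a \/ x = b <-> x = c \/ x = d).
  { intros x; rewrite <- (upairP a b x), H; apply upairP. }
  destruct (proj1 (E a)); auto; destruct (proj1 (E b)); auto;
    destruct (proj2 (E c)); auto; destruct (proj2 (E d)); auto; subst; auto.
Qed.

Lemma opair_inj a b c d : opair a b = opair c d -> a = c /\ b = d.
Proof.
  intros H; apply upair_inj in H as [[H1 H2]|[H1 H2]];
    apply upair_inj in H1; apply upair_inj in H2; intuition congruence.
Qed.

Lemma product_exists (A B : M) : exists P, is_product P A B.
Proof.
  destruct (zf_union M HM (upair A B)) as [u Hu].
  destruct (zf_powerset M HM u) as [p Hp].
  destruct (zf_powerset M HM p) as [q Hq].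
  destruct (separation
    (fun e => exists a b, a ∈ e 1 /\ b ∈ e 2 /\ is_opair (e 0) a b)
    (scons A (scons B (fun _ => A))) q) as [P HP].
  { unfold is_opair, is_upair; dfn_tac. }
  exists P; intros x; rewrite HP; simpl; split; [tauto|].
  intros H; split; [|exact H].
  destruct H as (a & b & Ha & Hb & Hx).
  apply is_opairE in Hx; subst x.
  assert (U : forall y, y ∈ A \/ y ∈ B -> y ∈ u).
  { intros y Hy; apply Hu; destruct Hy; [exists A|exists B];
      (split; [apply upairP; auto|assumption]). }
  apply Hq; intros y Hy; apply Hp; intros z Hz.
  apply upairP in Hy as [-> | ->]; apply upairP in Hz as [-> | ->]; auto.
Qed.

Definition product (A B : M) : M :=
  proj1_sig (constructive_indefinite_description _ (product_exists A B)).

Lemma productP A B p : p ∈ product A B <-> exists a b, a ∈ A /\ b ∈ B /\ p = opair a b.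
Proof.
  unfold product; destruct constructive_indefinite_description as [P HP]; simpl.
  rewrite (HP p); split; intros (a & b & Ha & Hb & H);
    exists a, b; apply is_opairE in H || apply is_opairE; auto.
Qed.

Definition powerset (A : M) : M :=
  proj1_sig (constructive_indefinite_description _ (zf_powerset M HM A)).

Lemma powersetP A x : x ∈ powerset A <-> subset x A.
Proof. unfold powerset; destruct constructive_indefinite_description as [P HP]; apply HP. Qed.

Lemma omega_exists : exists w : M, forall n, n ∈ w <-> is_nat n.
Proof.
  destruct (zf_infinity M HM) as [w Hw].
  destruct (separation
    (fun e => forall w', inductive_set w' -> e 0 ∈ w') (fun _ => w) w) as [b Hb].
  { unfold inductive_set, is_empty, is_succ; dfn_tac. }
  exists b; intros n; rewrite Hb; simpl; split; [intros [_ H]; exact H|].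
  intros H; split; [apply H; exact Hw | exact H].
Qed.

Definition omega : M := proj1_sig (constructive_indefinite_description _ omega_exists).

Lemma omegaP n : n ∈ omega <-> is_nat n.
Proof. unfold omega; destruct constructive_indefinite_description as [P HP]; apply HP. Qed.

Lemma succ_exists (n : M) : exists s, is_succ s n.
Proof.
  destruct (zf_union M HM (upair n (upair n n))) as [u Hu].
  exists u; intros x; rewrite (Hu x); split.
  - intros (y & Hy & Hx); apply upairP in Hy as [-> | ->]; [auto|].
    apply upairP in Hx; tauto.
  - intros [H | ->]; [exists n | exists (upair n n)];
      (split; [apply upairP; auto|]); [assumption|apply upairP; auto].
Qed.

Lemma succ_unique (n s t : M) : is_succ s n -> is_succ t n -> s = t.
Proof. intros H1 H2; apply set_ext; intros x; rewrite (H1 x), (H2 x); tauto. Qed.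

End Sets.

(** * Types and predicates internal to a model *)

(** A type whose elements are coded by the elements of a set of the model.  Predicates and
    functions on such types are internal ([intp], [intf] below) when their extension is a set
    of the model.  As the itypes include products, power types and function types, whose
    elements are the internal subsets and functions, mathematics inside the model becomes
    ordinary mathematics on itypes in which every set, function and induction predicate used
    has to be internal. *)
Record itype (M : set_structure) := IType {
  car :> Type;
  code : car -> M;
  cset : M;
  code_inj : forall x y, code x = code y -> x = y;
  csetP : forall c, c ∈ cset <-> exists x, code x = c
}.
Arguments car {M} _.
Arguments code {M _} _.
Arguments cset {M} _.
Arguments code_inj {M _} _ _ _.
Arguments csetP {M} _ _.

Section Internal.
Context {M : set_structure} {HM : ZF M}.
Local Notation IT := (itype M).

Lemma code_in (T : IT) (x : T) : code x ∈ cset T.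
Proof. apply csetP; exists x; reflexivity. Qed.

Lemma code_eq (T : IT) (x y : T) : code x = code y <-> x = y.
Proof. split; [apply code_inj|congruence]. Qed.

(** The set [s] may have elements that are not codes; [sub_code] below trims it to a canonical
    one. *)
Definition intp {T : IT} (P : T -> Prop) : Prop := exists s : M, forall t, P t <-> code t ∈ s.

Lemma intp_ext (T : IT) (P Q : T -> Prop) : (forall t, P t <-> Q t) -> intp Q -> intp P.
Proof. intros H [s Hs]; exists s; intros t; rewrite H; apply Hs. Qed.

(** The bridge from first-order Separation. It serves to prove the basic closure properties, after
    which internality follows the syntax of a predicate without any formula. *)
Lemma intp_dfn (T : IT) (P : T -> Prop) (D : (nat -> M) -> Prop) (rho : nat -> M) :
  dfn D -> (forall t, P t <-> D (scons (code t) rho)) -> intp P.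
Proof.
  intros HD H; destruct (separation D rho (cset T) HD) as [b Hb].
  exists b; intros t; rewrite Hb, H; split; [|tauto].
  intros Ht; split; [apply code_in|exact Ht].
Qed.

Lemma prod_code_inj (T U : IT) (x y : T * U) :
  opair (code (fst x)) (code (snd x)) = opair (code (fst y)) (code (snd y)) -> x = y.
Proof.
  destruct x, y; simpl; intros H; apply opair_inj in H as [H1 H2].
  apply code_inj in H1; apply code_inj in H2; congruence.
Qed.

Lemma prod_csetP (T U : IT) c :
  c ∈ product (cset T) (cset U) <->
  exists x : T * U, opair (code (fst x)) (code (snd x)) = c.
Proof.
  rewrite productP; split.
  - intros (a & b & Ha & Hb & ->).
    apply csetP in Ha as [t <-]; apply csetP in Hb as [u <-].
    exists (t, u); reflexivity.
  - intros [[t u] <-]; exists (code t), (code u); repeat split; apply code_in.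
Qed.

Canonical prodI (T U : IT) : IT :=
  IType M (car T * car U) _ _ (prod_code_inj T U) (prod_csetP T U).

Definition intf {T U : IT} (f : T -> U) : Prop := intp (fun p : T * U => snd p = f (fst p)).

Lemma intp_not (T : IT) (P : T -> Prop) : intp P -> intp (fun t => ~ P t).
Proof.
  intros [s Hs]; apply (intp_dfn _ _ (fun e => ~ e 0 ∈ e 1) (fun _ => s)); [dfn_tac|].
  intros t; rewrite Hs; simpl; tauto.
Qed.

Lemma intp_and (T : IT) (P Q : T -> Prop) : intp P -> intp Q -> intp (fun t => P t /\ Q t).
Proof.
  intros [s Hs] [s' Hs'].
  apply (intp_dfn _ _ (fun e => e 0 ∈ e 1 /\ e 0 ∈ e 2) (scons s (fun _ => s'))); [dfn_tac|].
  intros t; rewrite Hs, Hs'; simpl; tauto.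
Qed.

Lemma intp_or (T : IT) (P Q : T -> Prop) : intp P -> intp Q -> intp (fun t => P t \/ Q t).
Proof.
  intros HP HQ; apply (intp_ext _ _ (fun t => ~ (~ P t /\ ~ Q t))); [intros t; tauto|].
  apply intp_not, intp_and; apply intp_not; assumption.
Qed.

Lemma intp_imp (T : IT) (P Q : T -> Prop) : intp P -> intp Q -> intp (fun t => P t -> Q t).
Proof.
  intros HP HQ; apply (intp_ext _ _ (fun t => ~ P t \/ Q t)); [intros t; tauto|].
  apply intp_or; [apply intp_not|]; assumption.
Qed.

Lemma intp_iff (T : IT) (P Q : T -> Prop) : intp P -> intp Q -> intp (fun t => P t <-> Q t).
Proof. intros HP HQ; apply intp_and; apply intp_imp; assumption. Qed.

Lemma intp_const (T : IT) (P : Prop) : intp (fun _ : T => P).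
Proof.
  destruct (classic P) as [H|H].
  - exists (cset T); intros t; split; [intros _; apply code_in|tauto].
  - apply (intp_dfn _ _ (fun _ => False) (fun _ => cset T)); [apply dfn_false|tauto].
Qed.

Lemma intp_ex (T U : IT) (P : T -> U -> Prop) :
  intp (fun p : T * U => P (fst p) (snd p)) -> intp (fun t => exists u, P t u).
Proof.
  intros [s Hs].
  apply (intp_dfn _ _ (fun e => exists u p, u ∈ e 2 /\ p ∈ e 1 /\ is_opair p (e 0) u)
    (scons s (fun _ => cset U))); [unfold is_opair, is_upair; dfn_tac|].
  intros t; simpl; split.
  - intros [u Hu]; exists (code u), (opair (code t) (code u)).
    repeat split; [apply code_in|apply (proj1 (Hs (t, u))); exact Hu|apply is_opairE; reflexivity..].
  - intros (c & p & Hc & Hp & E); apply csetP in Hc as [u <-]; apply is_opairE in E; subst p.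
    exists u; apply (proj2 (Hs (t, u))); exact Hp.
Qed.

Lemma intp_all (T U : IT) (P : T -> U -> Prop) :
  intp (fun p : T * U => P (fst p) (snd p)) -> intp (fun t => forall u, P t u).
Proof.
  intros H; apply (intp_ext _ _ (fun t => ~ exists u, ~ P t u)).
  { intros t; split; [intros A [u Hu]; auto|]; intros A u; apply NNPP; intros B; apply A; eauto. }
  apply intp_not, intp_ex, intp_not; exact H.
Qed.

Lemma intp_comp (T U : IT) (Q : U -> Prop) (f : T -> U) :
  intp Q -> intf f -> intp (fun t => Q (f t)).
Proof.
  intros [s Hs] [g Hg].
  apply (intp_dfn _ _ (fun e => exists u p, u ∈ e 1 /\ p ∈ e 2 /\ u ∈ e 3 /\ is_opair p (e 0) u)
    (scons s (scons g (fun _ => cset U)))); [unfold is_opair, is_upair; dfn_tac|].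
  intros t; simpl; split.
  - intros Hu; exists (code (f t)), (opair (code t) (code (f t))).
    split; [apply Hs; exact Hu|]; split; [apply (Hg (t, f t)); reflexivity|].
    split; [apply code_in|apply is_opairE; reflexivity].
  - intros (c & p & Hc & Hp & Hu & E); apply is_opairE in E; subst p.
    apply csetP in Hu as [u <-].
    apply (proj2 (Hg (t, u))) in Hp; simpl in Hp; subst u; apply Hs; exact Hc.
Qed.

Lemma intf_comp (T U W : IT) (g : U -> W) (f : T -> U) :
  intf g -> intf f -> intf (fun t => g (f t)).
Proof.
  intros [sg Hg] [sf Hf].
  apply (intp_dfn _ _ (fun e => exists t w u p q, u ∈ e 3 /\ is_opair (e 0) t w /\
    is_opair p t u /\ p ∈ e 1 /\ is_opair q u w /\ q ∈ e 2)
    (scons sf (scons sg (fun _ => cset U)))); [is_pair_dfn|].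
  intros [t w]; simpl; split.
  - intros ->; exists (code t), (code (g (f t))), (code (f t)),
      (opair (code t) (code (f t))), (opair (code (f t)) (code (g (f t)))).
    rewrite !is_opairE; repeat split; [apply code_in|apply (Hf (t, f t))|apply (Hg (f t, g (f t)))];
      reflexivity.
  - intros (tc & wc & uc & p & q & Hu & E & Ep & Hp & Eq & Hq).
    apply is_opairE in E, Ep, Eq; subst p q; apply csetP in Hu as [u <-].
    apply opair_inj in E as [<- <-].
    apply (proj2 (Hf (t, u))) in Hp; apply (proj2 (Hg (u, w))) in Hq; simpl in *; congruence.
Qed.

Lemma intf_id (T : IT) : intf (fun t : T => t).
Proof.
  apply (intp_dfn _ _ (fun e => exists a, is_opair (e 0) a a) (fun _ => cset T)); [is_pair_dfn|].
  intros [t u]; simpl; split.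
  - intros ->; exists (code t); apply is_opairE; reflexivity.
  - intros [a Ha]; apply is_opairE, opair_inj in Ha as [<- H]; apply code_inj in H; exact H.
Qed.

Lemma intf_const (T U : IT) (u : U) : intf (fun _ : T => u).
Proof.
  apply (intp_dfn _ _ (fun e => exists a, is_opair (e 0) a (e 1)) (fun _ => code u)); [is_pair_dfn|].
  intros [t u']; simpl; split.
  - intros ->; exists (code t); apply is_opairE; reflexivity.
  - intros [a Ha]; apply is_opairE, opair_inj in Ha as [_ H]; apply code_inj in H; exact H.
Qed.

Lemma intf_proj1 (T U : IT) : intf (fun p : T * U => fst p).
Proof.
  apply (intp_dfn _ _ (fun e => exists p a b, is_opair (e 0) p a /\ is_opair p a b)
    (fun _ => cset T)); [is_pair_dfn|].
  intros [[t u] t']; simpl; split.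
  - intros ->; exists (opair (code t) (code u)), (code t), (code u).
    rewrite !is_opairE; split; reflexivity.
  - intros (p & a & b & E & E'); apply is_opairE in E, E'; subst p.
    apply opair_inj in E as [E <-]; apply opair_inj in E as [E _]; symmetry; apply code_inj; exact E.
Qed.

Lemma intf_proj2 (T U : IT) : intf (fun p : T * U => snd p).
Proof.
  apply (intp_dfn _ _ (fun e => exists p a b, is_opair (e 0) p b /\ is_opair p a b)
    (fun _ => cset T)); [is_pair_dfn|].
  intros [[t u] t']; simpl; split.
  - intros ->; exists (opair (code t) (code u)), (code t), (code u).
    rewrite !is_opairE; split; reflexivity.
  - intros (p & a & b & E & E'); apply is_opairE in E, E'; subst p.
    apply opair_inj in E as [E <-]; apply opair_inj in E as [_ E]; symmetry; apply code_inj; exact E.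
Qed.

Lemma intf_fst (T U W : IT) (f : T -> prodI U W) : intf f -> intf (fun t => fst (f t)).
Proof. apply (intf_comp T (prodI U W) U (fun p => fst p) f (intf_proj1 U W)). Qed.

Lemma intf_snd (T U W : IT) (f : T -> prodI U W) : intf f -> intf (fun t => snd (f t)).
Proof. apply (intf_comp T (prodI U W) W (fun p => snd p) f (intf_proj2 U W)). Qed.

Lemma intf_pair (T U W : IT) (f : T -> U) (g : T -> W) :
  intf f -> intf g -> intf (fun t => (f t, g t)).
Proof.
  intros Hf Hg.
  assert (Hf' := intf_comp _ _ _ _ _ Hf (intf_proj1 T (prodI U W))).
  assert (Hg' := intf_comp _ _ _ _ _ Hg (intf_proj1 T (prodI U W))).
  assert (H1 := intf_comp _ _ _ _ _ (intf_proj1 U W) (intf_proj2 T (prodI U W))).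
  assert (H2 := intf_comp _ _ _ _ _ (intf_proj2 U W) (intf_proj2 T (prodI U W))).
  (* [intp_eq] will be derived from the present lemma, so internality of an equation is first
     obtained from the two graphs directly. *)
  assert (K : forall (X Y : IT) (h k : X -> Y), intf h -> intf k -> intp (fun x => h x = k x)).
  { intros X Y h k [s Hs] [r Hr].
    apply (intp_dfn _ _ (fun e => exists y p, y ∈ e 3 /\ is_opair p (e 0) y /\ p ∈ e 1 /\ p ∈ e 2)
      (scons s (scons r (fun _ => cset Y)))); [is_pair_dfn|].
    intros x; simpl; split.
    - intros E; exists (code (h x)), (opair (code x) (code (h x))).
      rewrite is_opairE; repeat split; [apply code_in|apply (Hs (x, h x))|apply (Hr (x, h x))];
        [reflexivity|exact E].
    - intros (c & p & Hy & E & H & H'); apply is_opairE in E; subst p; apply csetP in Hy as [y <-].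
      apply (proj2 (Hs (x, y))) in H; apply (proj2 (Hr (x, y))) in H'; simpl in *; congruence. }
  apply (intp_ext _ _ (fun p : T * (U * W) =>
    fst (snd p) = f (fst p) /\ snd (snd p) = g (fst p))).
  { intros [t [u w]]; simpl; split; [intros E; inversion E; auto|intros [-> ->]; auto]. }
  apply intp_and; apply K; assumption.
Qed.

Lemma intp_eq (T U : IT) (f g : T -> U) : intf f -> intf g -> intp (fun t => f t = g t).
Proof.
  intros Hf Hg.
  apply (intp_ext _ _ (fun t => snd (f t, g t) = fst (f t, g t))); [intros t; simpl; split; auto|].
  apply (intp_comp T (prodI U U) (fun p => snd p = fst p) (fun t => (f t, g t)));
    [apply intf_id|apply intf_pair; assumption].
Qed.

Definition intp2 {T U : IT} (R : T -> U -> Prop) : Prop := intp (fun p : T * U => R (fst p) (snd p)).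
Definition intf2 {T U W : IT} (F : T -> U -> W) : Prop := intf (fun p : T * U => F (fst p) (snd p)).

Lemma intp_comp2 (T U W : IT) (R : U -> W -> Prop) (f : T -> U) (g : T -> W) :
  intp2 R -> intf f -> intf g -> intp (fun t => R (f t) (g t)).
Proof.
  intros HR Hf Hg.
  exact (intp_comp T (prodI U W) (fun p => R (fst p) (snd p)) (fun t => (f t, g t)) HR
    (intf_pair _ _ _ _ _ Hf Hg)).
Qed.

Lemma intf_comp2 (T U W X : IT) (R : U -> W -> X) (f : T -> U) (g : T -> W) :
  intf2 R -> intf f -> intf g -> intf (fun t => R (f t) (g t)).
Proof.
  intros HR Hf Hg.
  exact (intf_comp T (prodI U W) X (fun p => R (fst p) (snd p)) (fun t => (f t, g t)) HR
    (intf_pair _ _ _ _ _ Hf Hg)).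
Qed.

(** The way to internalize a function whose Rocq definition uses description or a case distinction:
    only its graph has to be described internally. *)
Lemma intf_graph (T U : IT) (R : T -> U -> Prop) (f : T -> U) :
  (forall t u, u = f t <-> R t u) -> intp2 R -> intf f.
Proof. intros H; apply intp_ext; intros [t u]; apply H. Qed.

(** Uniqueness keeps this within ZF: by [intf_graph], the function is internal as soon as [R] is. *)
Lemma unique_choice (T U : IT) (R : T -> U -> Prop) :
  (forall t, exists! u, R t u) -> {f : T -> U | forall t u, u = f t <-> R t u}.
Proof.
  intros H.
  exists (fun t => proj1_sig (constructive_definite_description _ (H t))).
  intros t u; destruct constructive_definite_description as [v Hv]; simpl.
  split; [intros ->; exact Hv|]; intros Hu.
  destruct (H t) as [w [_ Hw]]; transitivity w; [symmetry|]; auto.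
Qed.

Record sub (T : IT) := Sub { insub :> T -> Prop; insub_int : intp insub }.
Arguments Sub {T} _ _.

Lemma sub_ext (T : IT) (P Q : sub T) : (forall t, P t <-> Q t) -> P = Q.
Proof.
  destruct P as [P HP], Q as [Q HQ]; simpl; intros H.
  assert (E : P = Q) by (apply functional_extensionality; intros t;
    apply propositional_extensionality, H).
  subst Q; f_equal; apply proof_irrelevance.
Qed.

Lemma sub_code_exists (T : IT) (P : sub T) :
  exists s : M, forall c, c ∈ s <-> exists t, P t /\ code t = c.
Proof.
  destruct (insub_int _ P) as [s Hs].
  destruct (separation (fun e => e 0 ∈ e 1) (fun _ => s) (cset T)) as [b Hb]; [dfn_tac|].
  exists b; intros c; rewrite Hb, csetP; simpl; split.
  - intros [[t <-] H]; exists t; split; [apply Hs; exact H|reflexivity].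
  - intros (t & H & <-); split; [exists t; reflexivity|apply Hs; exact H].
Qed.

Definition sub_code (T : IT) (P : sub T) : M :=
  proj1_sig (constructive_indefinite_description _ (sub_code_exists T P)).

Lemma sub_codeP (T : IT) (P : sub T) c : c ∈ sub_code T P <-> exists t, P t /\ code t = c.
Proof. unfold sub_code; destruct constructive_indefinite_description as [s Hs]; apply Hs. Qed.

Lemma sub_code_in (T : IT) (P : sub T) (t : T) : code t ∈ sub_code T P <-> P t.
Proof.
  rewrite sub_codeP; split; [|intros H; exists t; auto].
  intros (t' & H & E); apply code_inj in E; congruence.
Qed.

Lemma sub_code_inj (T : IT) (P Q : sub T) : sub_code T P = sub_code T Q -> P = Q.
Proof. intros E; apply sub_ext; intros t; rewrite <- !sub_code_in, E; tauto. Qed.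

Lemma sub_csetP (T : IT) c : c ∈ powerset (cset T) <-> exists P, sub_code T P = c.
Proof.
  rewrite powersetP; split.
  - intros H.
    assert (HP : intp (fun t : T => code t ∈ c)) by (exists c; tauto).
    exists (Sub _ HP); apply set_ext; intros x; rewrite sub_codeP; simpl; split.
    + intros (t & Ht & <-); exact Ht.
    + intros Hx; destruct (proj1 (csetP T x) (H x Hx)) as [t <-]; exists t; auto.
  - intros [P <-] x Hx; apply sub_codeP in Hx as (t & _ & <-); apply code_in.
Qed.

Canonical subI (T : IT) : IT := IType M (sub T) (sub_code T) _ (sub_code_inj T) (sub_csetP T).

Lemma intp_in (T U : IT) (S : T -> sub U) (u : T -> U) :
  intf S -> intf u -> intp (fun t => (S t) (u t)).
Proof.
  apply (intp_comp2 T (subI U) U (fun P x => insub U P x)).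
  apply (intp_dfn _ _ (fun e => exists a b, is_opair (e 0) a b /\ b ∈ e 1 /\ b ∈ a)
    (fun _ => cset U)); [is_pair_dfn|].
  intros [P x]; simpl; split.
  - intros H; exists (sub_code U P), (code x); split; [apply is_opairE; reflexivity|].
    split; [apply code_in|]; apply sub_code_in; exact H.
  - intros (a & b & E & Hb & H); apply is_opairE, opair_inj in E as [<- <-].
    apply sub_code_in; exact H.
Qed.

Lemma intf_sub (T U : IT) (P : T -> U -> Prop) (H : forall t, intp (P t)) :
  intp2 P -> intf (fun t => Sub (P t) (H t)).
Proof.
  intros HP.
  apply (intf_graph T (subI U) (fun t S => forall u, insub U S u <-> P t u)).
  - intros t S; split; [intros ->; simpl; tauto|].
    intros E; apply sub_ext; exact E.
  - apply intp_all, intp_iff.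
    + apply (intp_in (prodI (prodI T (subI U)) U) U (fun p => snd (fst p)) (fun p => snd p));
        [apply intf_snd, intf_fst, intf_id|apply intf_snd, intf_id].
    + apply (intp_comp2 _ T U P (fun p => fst (fst p)) (fun p => snd p)); [exact HP|..];
        [apply intf_fst, intf_fst, intf_id|apply intf_snd, intf_id].
Qed.

Section Embedding.
Context (X : Type) (T : IT) (j : X -> T) (j_inj : forall x y, j x = j y -> x = y)
  (Hj : intp (fun t => exists x, j x = t)).

Lemma emb_code_inj (x y : X) : code (j x) = code (j y) -> x = y.
Proof. intros H; apply j_inj, code_inj, H. Qed.

Lemma emb_csetP c : c ∈ sub_code T (Sub _ Hj) <-> exists x, code (j x) = c.
Proof.
  rewrite sub_codeP; simpl; split.
  - intros (t & [x <-] & E); eauto.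
  - intros [x E]; exists (j x); eauto.
Qed.

(** Codes are transported along an injection with internal image. Subtypes, function types (through
    their graphs) and disjoint sums all arise in this way. *)
Definition embI : IT := IType M X (fun x => code (j x)) _ emb_code_inj emb_csetP.

Lemma intf_emb (U : IT) (f : U -> embI) : intf (fun u => j (f u)) -> intf f.
Proof.
  intros [s Hs]; exists s; intros [u x].
  rewrite <- (Hs (u, j x)); simpl; split; [congruence|apply j_inj].
Qed.

Lemma intf_emb_inj : intf (U := T) (fun x : embI => j x).
Proof.
  destruct (intf_id T) as [s Hs]; exists s; intros [x t].
  apply (Hs (j x, t)).
Qed.

End Embedding.

Section Subtypes.
Context (T : IT) (P : T -> Prop) (HP : intp P).

Lemma sig_inj (x y : {t : T | P t}) : proj1_sig x = proj1_sig y -> x = y.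
Proof. destruct x, y; simpl; intros; subst; f_equal; apply proof_irrelevance. Qed.

Lemma sig_int : intp (fun t => exists x : {t : T | P t}, proj1_sig x = t).
Proof.
  apply (intp_ext _ _ P); [|exact HP]; intros t; split; [intros [[u Hu] <-]; exact Hu|].
  intros H; exists (exist _ t H); reflexivity.
Qed.

Definition sigI : IT := embI {t : T | P t} T (@proj1_sig _ _) sig_inj sig_int.

Lemma intf_sig (U : IT) (f : U -> sigI) : intf (fun u => proj1_sig (f u)) -> intf f.
Proof. apply intf_emb. Qed.

Lemma intf_proj_sig (U : IT) (f : U -> sigI) : intf f -> intf (fun u => proj1_sig (f u)).
Proof. apply (intf_comp U sigI T (fun x => proj1_sig x) f), intf_emb_inj. Qed.

End Subtypes.

Record fn (T U : IT) := Fn { fapp :> T -> U; fapp_int : intf fapp }.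
Arguments Fn {T U} _ _.

Lemma fn_ext (T U : IT) (f g : fn T U) : (forall t, f t = g t) -> f = g.
Proof.
  destruct f as [f Hf], g as [g Hg]; simpl; intros H.
  apply functional_extensionality in H; subst g; f_equal; apply proof_irrelevance.
Qed.

Definition fn_graph (T U : IT) (f : fn T U) : subI (prodI T U) :=
  Sub (fun p : prodI T U => snd p = f (fst p)) (fapp_int _ _ f).

Lemma fn_graph_inj (T U : IT) (f g : fn T U) : fn_graph T U f = fn_graph T U g -> f = g.
Proof.
  intros E; apply fn_ext; intros t.
  change (insub _ (fn_graph T U g) (t, f t)); rewrite <- E; reflexivity.
Qed.

Lemma fn_graph_int (T U : IT) : intp (fun G => exists f, fn_graph T U f = G).
Proof.
  apply (intp_ext _ _ (fun G : subI (prodI T U) => forall t : T, exists u : U,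
    insub _ G (t, u) /\ forall u' : U, insub _ G (t, u') -> u = u')).
  - intros G; split.
    + intros [f <-] t; exists (f t); split; simpl; auto.
    + intros H; destruct (unique_choice T U (fun t u => insub _ G (t, u))) as [f Hf].
      { intros t; destruct (H t) as [u Hu]; exists u; exact Hu. }
      assert (Hi : intf f).
      { apply (intf_graph _ _ _ _ Hf); apply (intp_ext _ _ (insub _ G)); [|apply insub_int].
        intros [t u]; tauto. }
      exists (Fn f Hi); apply sub_ext; intros [t u]; simpl; apply Hf.
  - apply intp_all, intp_ex, intp_and; [|apply intp_all, intp_imp].
    + apply (intp_in (prodI (prodI (subI (prodI T U)) T) U) (prodI T U) (fun p => fst (fst p))
        (fun p => (snd (fst p), snd p)));
      repeat first [apply intf_pair|apply intf_fst|apply intf_snd|apply intf_id].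
    + apply (intp_in (prodI (prodI (prodI (subI (prodI T U)) T) U) U) (prodI T U)
        (fun p => fst (fst (fst p))) (fun p => (snd (fst (fst p)), snd p)));
      repeat first [apply intf_pair|apply intf_fst|apply intf_snd|apply intf_id].
    + apply intp_eq; repeat first [apply intf_fst|apply intf_snd|apply intf_id].
Qed.

Canonical fnI (T U : IT) : IT :=
  embI (fn T U) (subI (prodI T U)) (fn_graph T U) (fn_graph_inj T U) (fn_graph_int T U).

Lemma intf_app (T U W : IT) (f : T -> fn U W) (u : T -> U) :
  intf f -> intf u -> intf (fun t => (f t) (u t)).
Proof.
  intros Hf Hu.
  apply (intp_ext _ _ (fun p : prodI T W => fn_graph U W (f (fst p)) (u (fst p), snd p))).
  { intros p; reflexivity. }
  apply (intp_in (prodI T W) (prodI U W)).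
  - apply (intf_comp _ (fnI U W) _ (fn_graph U W)); [apply intf_emb_inj|].
    apply (intf_comp _ T); [exact Hf|apply intf_fst, intf_id].
  - apply intf_pair; [apply (intf_comp _ T); [exact Hu|]|]; [apply intf_fst, intf_id|apply intf_snd, intf_id].
Qed.

Lemma intf_lam (T U W : IT) (F : T -> U -> W) (H : forall t, intf (F t)) :
  intf2 F -> intf (fun t => Fn (F t) (H t)).
Proof.
  intros HF; apply intf_emb.
  apply (intf_sub T (prodI U W) (fun t p => snd p = F t (fst p))).
  apply intp_eq; [apply intf_snd, intf_snd, intf_id|].
  apply (intf_comp2 _ T U); [exact HF|apply intf_fst, intf_id|apply intf_fst, intf_snd, intf_id].
Qed.

End Internal.
Arguments Sub {M T} _ _.
Arguments Fn {M HM T U} _ _.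

(* Tactics proving internality *)
Create HintDb internal.

Ltac int_leaf := solve [ eassumption | auto with internal nocore ].

Ltac int_comp :=
  match goal with
  | |- intp (fun t => ?R (@?f t) (@?g t)) => apply (intp_comp2 _ _ _ R f g); [int_leaf|..]
  | |- intp (fun t => ?R (@?f t)) => apply (intp_comp _ _ R f); [int_leaf|..]
  | |- intf (fun t => ?R (@?f t) (@?g t)) => apply (intf_comp2 _ _ _ _ R f g); [int_leaf|..]
  | |- intf (fun t => ?R (@?f t)) => apply (intf_comp _ _ _ R f); [int_leaf|..]
  end.

(** The search follows the syntax of the predicate or function; its leaves are hypotheses and hints.
    To make a local definition a leaf, proofs assert its internality and then hide its body by
    [clearbody]. *)
Ltac int_step :=
  first
  [ int_leaf
  | lazymatch goal with
    | |- intp2 _ => unfold intp2; cbv beta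
    | |- intf2 _ => unfold intf2; cbv beta
    | |- intp (fun t => _ /\ _) => apply intp_and
    | |- intp (fun t => _ \/ _) => apply intp_or
    | |- intp (fun t => ~ _) => apply intp_not
    | |- intp (fun t => _ <-> _) => apply intp_iff
    | |- intp (fun t => exists _, _) => refine (intp_ex _ _ _ _)
    | |- intp (fun t => _ = _) => refine (intp_eq _ _ _ _ _ _)
    | |- intp (fun t => insub _ _ _) => first [int_comp | refine (intp_in _ _ _ _ _ _)]
    | |- intp (fun t => _ -> _) => first [apply intp_imp | apply intp_const | refine (intp_all _ _ _ _)]
    | |- intp (fun t => forall _, _) => first [apply intp_const | refine (intp_all _ _ _ _)]
    | |- intp (fun t => _) => first [apply intp_const | int_comp]
    | |- intp ?P => change (intp (fun t => P t))
    | |- intf (fun t => t) => apply intf_id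
    | |- intf (fun t => fst _) => refine (intf_fst _ _ _ _ _)
    | |- intf (fun t => snd _) => refine (intf_snd _ _ _ _ _)
    | |- intf (fun t => (_, _)) => refine (intf_pair _ _ _ _ _ _ _)
    | |- intf (fun t => fapp _ _ _ _) => first [int_comp | refine (intf_app _ _ _ _ _ _ _)]
    | |- intf (fun t => Fn _ _) => refine (intf_lam _ _ _ _ _ _)
    | |- intf (fun t => Sub _ _) => refine (intf_sub _ _ _ _ _)
    | |- intf (fun t => exist _ _ _) => apply intf_sig; cbn [proj1_sig]
    | |- intf (fun t => proj1_sig _) => first [int_comp | apply intf_proj_sig]
    | |- intf (fun t => _) => first [apply intf_const | int_comp]
    | |- intf ?f => change (intf (fun t => f t))
    | |- forall _, _ => intro
    end ].

Ltac int := repeat int_step.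

(** * Natural numbers and finite sets *)

Section Naturals.
Context {M : set_structure} {HM : ZF M}.
Local Notation IT := (itype M).

Lemma el_inj (A : M) (x y : {x : M | x ∈ A}) : proj1_sig x = proj1_sig y -> x = y.
Proof. destruct x, y; simpl; intros; subst; f_equal; apply proof_irrelevance. Qed.

Lemma el_csetP (A c : M) : c ∈ A <-> exists x : {x : M | x ∈ A}, proj1_sig x = c.
Proof. split; [intros H; exists (exist _ c H); reflexivity|intros [[x H] <-]; exact H]. Qed.

Definition elI (A : M) : IT := IType M {x : M | x ∈ A} (@proj1_sig _ _) A (el_inj A) (el_csetP A).

Lemma intp2_mem (T U : IT) : intp2 (fun (t : T) (u : U) => code t ∈ code u).
Proof.
  apply (intp_dfn _ _ (fun e => exists a b, is_opair (e 0) a b /\ a ∈ b) (fun _ => cset T));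
    [is_pair_dfn|].
  intros [t u]; simpl; split.
  - intros H; exists (code t), (code u); split; [apply is_opairE; reflexivity|exact H].
  - intros (a & b & E & H); apply is_opairE, opair_inj in E as [<- <-]; exact H.
Qed.

Definition natI : IT := elI omega.

Lemma empty_exists : exists e : M, is_empty e /\ e ∈ omega.
Proof.
  destruct (zf_infinity M HM) as [w Hw]; destruct (proj1 Hw) as (e & He & _).
  exists e; split; [exact He|]; apply omegaP; intros w' [(e' & He' & Hin) _].
  replace e with e'; [exact Hin|]; apply set_ext; intros x; split; intros Hx;
    [destruct (He' x Hx)|destruct (He x Hx)].
Qed.

Definition zero : natI :=
  let (e, He) := constructive_indefinite_description _ empty_exists in exist _ e (proj2 He).

Lemma code_zero : is_empty (code zero).
Proof. unfold zero; destruct constructive_indefinite_description as [e [He Hin]]; exact He. Qed.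

Lemma suc_exists (n : natI) : exists m : natI, is_succ (code m) (code n).
Proof.
  destruct n as [n Hn]; destruct (succ_exists n) as [s Hs].
  assert (H : s ∈ omega).
  { apply omegaP; intros w Hw; apply omegaP in Hn.
    destruct (proj2 Hw n (Hn w Hw)) as (s' & Hs' & Hin).
    rewrite (succ_unique _ _ _ Hs Hs'); exact Hin. }
  exists (exist _ s H); exact Hs.
Qed.

Definition suc (n : natI) : natI :=
  proj1_sig (constructive_indefinite_description _ (suc_exists n)).

Lemma code_suc (n : natI) : is_succ (code (suc n)) (code n).
Proof. unfold suc; destruct constructive_indefinite_description as [m Hm]; exact Hm. Qed.

(** For internal [P] the codes of its elements form an inductive set of the model, which contains
    every natural by definition. For external predicates this fails in nonstandard models. *)
Lemma natI_ind (P : natI -> Prop) :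
  intp P -> P zero -> (forall n, P n -> P (suc n)) -> forall n, P n.
Proof.
  intros HP H0 HS n.
  apply (sub_code_in natI (Sub P HP)).
  destruct n as [n Hn]; simpl; apply omegaP in Hn; apply Hn; split.
  - exists (code zero); split; [apply code_zero|apply (sub_code_in natI (Sub P HP)); exact H0].
  - intros k Hk; apply sub_codeP in Hk as (m & Hm & <-); exists (code (suc m)).
    split; [apply code_suc|apply (sub_code_in natI (Sub P HP)); apply HS; exact Hm].
Qed.

(** Transitivity of [omega]: the naturals all of whose elements are naturals form an inductive set.
    It allows membership in a natural to be treated as the order [lt]. *)
Lemma nat_elem (m : natI) (x : M) : x ∈ code m -> exists k : natI, code k = x.
Proof.
  destruct m as [m Hm]; simpl; apply omegaP in Hm.
  destruct (separation (fun e => forall x, x ∈ e 0 -> x ∈ e 1) (fun _ => omega) omega)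
    as [w Hw]; [dfn_tac|].
  assert (Hmw : m ∈ w).
  { apply Hm; split.
    - exists (code zero); split; [apply code_zero|]; apply Hw; simpl.
      split; [apply code_in with (T := natI)|intros y Hy; destruct (code_zero y Hy)].
    - intros k Hk; apply Hw in Hk as [Hk1 Hk2]; simpl in Hk2.
      exists (code (suc (exist _ k Hk1))); split; [apply code_suc|].
      apply Hw; simpl; split; [apply (code_in natI)|].
      intros y Hy; apply code_suc in Hy as [Hy| ->]; [apply Hk2; exact Hy|exact Hk1]. }
  intros Hx; apply Hw in Hmw as [_ Hmw]; apply (csetP natI), Hmw, Hx.
Qed.

Definition lt (m n : natI) : Prop := code m ∈ code n.

Lemma intp2_lt : intp2 lt.
Proof. apply intp2_mem. Qed.

Lemma lt_zero n : ~ lt n zero.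
Proof. intros H; exact (code_zero _ H). Qed.

Lemma lt_suc m n : lt m (suc n) <-> lt m n \/ m = n.
Proof. unfold lt; rewrite (code_suc n (code m)), code_eq; tauto. Qed.

Lemma intf_suc : intf suc.
Proof.
  apply (intf_graph natI natI (fun n m => forall k : natI, lt k m <-> lt k n \/ k = n)).
  - intros n m; split.
    + intros -> k; apply lt_suc.
    + intros H; apply code_inj, set_ext; intros x; split; intros Hx;
        destruct (nat_elem _ _ Hx) as [k <-].
      * apply lt_suc, H; exact Hx.
      * apply H, lt_suc; exact Hx.
  - assert (H := intp2_lt); int.
Qed.

End Naturals.
#[export] Hint Resolve intp2_lt intf_suc : internal.

(** * Order and recursion on the naturals *)

Section Recursion.
Context {M : set_structure} {HM : ZF M}.
Local Notation IT := (itype M).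

Lemma lt_trans (m n k : natI) : lt m n -> lt n k -> lt m k.
Proof.
  revert k; assert (H : forall k m n, lt m n -> lt n k -> lt m k); [|eauto].
  apply (natI_ind (fun k => forall m n, lt m n -> lt n k -> lt m k)); [int|..].
  - intros p q _ H; destruct (lt_zero _ H).
  - intros l IH p q H1 H2; apply lt_suc; left; apply lt_suc in H2 as [H2| ->]; eauto.
Qed.

Lemma lt_irrefl (n : natI) : ~ lt n n.
Proof.
  revert n; apply (natI_ind (fun n => ~ lt n n)); [int|apply lt_zero|].
  intros n IH H; apply IH; assert (L : lt n (suc n)) by (apply lt_suc; auto).
  apply lt_suc in H as [H|H]; [eapply lt_trans; eassumption|rewrite <- H at 2; exact L].
Qed.

Lemma lt_suc_diag (n : natI) : lt n (suc n).
Proof. apply lt_suc; auto. Qed.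

Lemma suc_inj (m n : natI) : suc m = suc n -> m = n.
Proof.
  intros E; assert (H : lt m (suc n)) by (rewrite <- E; apply lt_suc_diag).
  assert (H' : lt n (suc m)) by (rewrite E; apply lt_suc_diag).
  apply lt_suc in H as [H|H]; [|exact H]; apply lt_suc in H' as [H'|H']; [|auto].
  destruct (lt_irrefl m); eapply lt_trans; eassumption.
Qed.

Lemma suc_neq_zero (n : natI) : suc n <> zero.
Proof. intros E; apply (lt_zero n); rewrite <- E; apply lt_suc_diag. Qed.

Lemma zero_or_suc (n : natI) : n = zero \/ exists m, n = suc m.
Proof. revert n; apply natI_ind; [int|auto|eauto]. Qed.

Lemma lt_least (P : natI -> Prop) :
  intp P -> (exists n, P n) -> exists n, P n /\ forall m, lt m n -> ~ P m.
Proof.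
  intros HP [n Hn]; apply NNPP; intros H.
  assert (K : forall n m, lt m n -> ~ P m).
  { apply (natI_ind (fun n => forall m, lt m n -> ~ P m)); [int|intros m Hm; destruct (lt_zero _ Hm)|].
    intros k IH m Hm; apply lt_suc in Hm as [Hm| ->]; [apply IH; exact Hm|].
    intros Hk; apply H; exists k; auto. }
  exact (K _ _ (lt_suc_diag n) Hn).
Qed.

Section Rec.
Context (T : IT) (a : T) (F : natI -> T -> T) (HF : intf2 F).

(** The graph of the recursive function as an intersection of closed internal relations; no finite
    approximations have to be glued together. *)
Let R (n : natI) (t : T) : Prop :=
  forall G : sub (prodI natI T), G (zero, a) ->
    (forall m z, G (m, z) -> G (suc m, F m z)) -> G (n, t).

Lemma rec_rel_int : intp2 R.
Proof. unfold R; int. Qed.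

Lemma rec_rel_step n t : R n t -> R (suc n) (F n t).
Proof. intros H G H0 HS; apply HS, H; assumption. Qed.

(** The right-hand side is itself a closed relation, so it contains the least one. The conjunct
    [R m z] is kept in it to let the induction on [n] continue. *)
Lemma rec_rel_inv n t : R n t ->
  n = zero /\ t = a \/ exists m z, n = suc m /\ t = F m z /\ R m z.
Proof.
  assert (HR := rec_rel_int).
  assert (Hi : intp (fun p : prodI natI T => fst p = zero /\ snd p = a \/
    exists m z, fst p = suc m /\ snd p = F m z /\ R m z)).
  { clearbody R; int. }
  intros H; apply (H (Sub _ Hi)); simpl; [auto|].
  intros m z Hz; right; exists m, z; repeat split.
  destruct Hz as [[-> ->]|(m' & z' & -> & -> & Hz)]; [intros G H0 HS; exact H0|].
  apply rec_rel_step, Hz.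
Qed.

Lemma rec_rel_total : forall n, exists! t, R n t.
Proof.
  assert (HR := rec_rel_int).
  assert (K : forall n, (exists t, R n t) /\ forall t t', R n t -> R n t' -> t = t').
  { apply (natI_ind (fun n => (exists t, R n t) /\ forall t t', R n t -> R n t' -> t = t')).
    - clearbody R; int.
    - split; [exists a; intros G H0 HS; exact H0|].
      intros t t' H H'; apply rec_rel_inv in H, H'.
      destruct H as [[_ ->]|(m & z & E & _)]; [|destruct (suc_neq_zero m); auto].
      destruct H' as [[_ ->]|(m & z & E & _)]; [|destruct (suc_neq_zero m)]; auto.
    - intros n [[t Ht] Hu]; split; [exists (F n t); apply rec_rel_step, Ht|].
      intros s s' H H'; apply rec_rel_inv in H, H'.
      destruct H as [[E _]|(m & z & E & -> & Hz)]; [destruct (suc_neq_zero n); auto|].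
      destruct H' as [[E' _]|(m' & z' & E' & -> & Hz')]; [destruct (suc_neq_zero n); auto|].
      apply suc_inj in E, E'; subst m m'; f_equal; auto. }
  intros n; destruct (K n) as [[t Ht] Hu]; exists t; split; auto.
Qed.

Definition rec : natI -> T := proj1_sig (unique_choice natI T R rec_rel_total).

Lemma rec_relP n t : t = rec n <-> R n t.
Proof. unfold rec; destruct unique_choice as [f Hf]; apply Hf. Qed.

Lemma rec_zero : rec zero = a.
Proof. symmetry; apply rec_relP; intros G H0 HS; exact H0. Qed.

Lemma rec_suc n : rec (suc n) = F n (rec n).
Proof. symmetry; apply rec_relP, rec_rel_step, rec_relP; reflexivity. Qed.

Lemma intf_rec : intf rec.
Proof. apply (intf_graph _ _ R); [exact rec_relP|exact rec_rel_int]. Qed.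

End Rec.

End Recursion.
#[export] Hint Resolve intf_rec : internal.

Ltac nat_ind n :=
  pattern n; match goal with |- ?P n => revert n; refine (natI_ind P _ _ _); [int|cbv beta..] end.

(** * Arithmetic and finite subsets *)

Section Arithmetic.
Context {M : set_structure} {HM : ZF M}.
Local Notation IT := (itype M).

(** The recursion on [n] produces the whole function that adds [n], as an element of a function
    type. With [m] as a fixed parameter, [intf_rec] would give internality in [n] only. *)
Definition add_step (f : fn natI natI) : fn natI natI := Fn (fun m => suc (f m)) ltac:(int).

Lemma add_step_int : intf2 (fun _ : natI => add_step).
Proof. unfold add_step; int. Qed.

Definition add (m n : natI) : natI := rec _ (Fn (fun m => m) (intf_id natI)) _ add_step_int n m.

Lemma add_int : intf2 add.
Proof. unfold add; int. Qed.

Lemma add_zero m : add m zero = m.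
Proof. unfold add; rewrite rec_zero; reflexivity. Qed.

Lemma add_suc m n : add m (suc n) = suc (add m n).
Proof. unfold add; rewrite rec_suc; reflexivity. Qed.

Hint Resolve add_int : internal.

Definition mul_step (f : fn natI natI) : fn natI natI := Fn (fun m => add (f m) m) ltac:(int).

Lemma mul_step_int : intf2 (fun _ : natI => mul_step).
Proof. unfold mul_step; int. Qed.

Definition mul (m n : natI) : natI :=
  rec _ (Fn (fun _ => zero) (intf_const natI natI zero)) _ mul_step_int n m.

Lemma mul_int : intf2 mul.
Proof. unfold mul; int. Qed.

Lemma mul_zero m : mul m zero = zero.
Proof. unfold mul; rewrite rec_zero; reflexivity. Qed.

Lemma mul_suc m n : mul m (suc n) = add (mul m n) m.
Proof. unfold mul; rewrite rec_suc; reflexivity. Qed.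

Hint Resolve mul_int : internal.

Lemma zero_add n : add zero n = n.
Proof. nat_ind n; [apply add_zero|intros n IH; rewrite add_suc, IH; reflexivity]. Qed.

Lemma suc_add m n : add (suc m) n = suc (add m n).
Proof. nat_ind n; [rewrite !add_zero; reflexivity|intros n IH; rewrite !add_suc, IH; reflexivity]. Qed.

Lemma addC m n : add m n = add n m.
Proof.
  nat_ind n; [rewrite add_zero, zero_add; reflexivity|].
  intros n IH; rewrite add_suc, suc_add, IH; reflexivity.
Qed.

Lemma addA m n k : add m (add n k) = add (add m n) k.
Proof. nat_ind k; [rewrite !add_zero; reflexivity|intros k IH; rewrite !add_suc, IH; reflexivity]. Qed.

Lemma mulDr m n k : mul k (add m n) = add (mul k m) (mul k n).
Proof.
  nat_ind n; [rewrite mul_zero, !add_zero; reflexivity|].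
  intros n IH; rewrite add_suc, !mul_suc, IH, addA; reflexivity.
Qed.

Lemma zero_mul n : mul zero n = zero.
Proof. nat_ind n; [apply mul_zero|intros n IH; rewrite mul_suc, IH; apply add_zero]. Qed.

Lemma suc_mul m n : mul (suc m) n = add (mul m n) n.
Proof.
  nat_ind n; [rewrite !mul_zero, add_zero; reflexivity|].
  intros n IH; rewrite !mul_suc, IH, !add_suc, <- !addA, (addC n m); reflexivity.
Qed.

Lemma mulC m n : mul m n = mul n m.
Proof.
  nat_ind n; [rewrite mul_zero, zero_mul; reflexivity|].
  intros n IH; rewrite mul_suc, suc_mul, IH; reflexivity.
Qed.

Lemma mulA m n k : mul m (mul n k) = mul (mul m n) k.
Proof.
  nat_ind k; [rewrite !mul_zero; reflexivity|].
  intros k IH; rewrite !mul_suc, mulDr, IH; reflexivity.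
Qed.

Lemma one_mul n : mul (suc zero) n = n.
Proof. rewrite suc_mul, zero_mul; apply zero_add. Qed.

Lemma nat_semiring : semi_ring_theory zero (suc zero) add mul eq.
Proof.
  split; [apply zero_add|apply addC|apply addA|apply one_mul|apply zero_mul|apply mulC|apply mulA|].
  intros n m k; rewrite mulC, mulDr, (mulC k), (mulC k); reflexivity.
Qed.

Lemma add_cancel m n k : add m k = add n k -> m = n.
Proof.
  nat_ind k; [rewrite !add_zero; auto|].
  intros k IH; rewrite !add_suc; intros E; apply IH, suc_inj, E.
Qed.

Lemma lt_add m n : lt m n <-> exists k, n = add m (suc k).
Proof.
  split.
  - nat_ind n; [intros H; destruct (lt_zero _ H)|].
    intros n IH H; apply lt_suc in H as [H| ->].
    + destruct (IH H) as [k ->]; exists (suc k); rewrite !add_suc; reflexivity.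
    + exists zero; rewrite add_suc, add_zero; reflexivity.
  - intros [k ->]; rewrite add_suc; nat_ind k.
    + rewrite add_zero; apply lt_suc_diag.
    + intros k IH; rewrite add_suc; apply lt_suc; auto.
Qed.

Lemma le_or_lt m n : (exists k, n = add m k) \/ exists k, m = add n (suc k).
Proof.
  nat_ind m; [left; exists n; symmetry; apply zero_add|].
  intros m [[k Hk]|[k Hk]].
  - destruct (zero_or_suc k) as [-> |[j ->]].
    + right; exists zero; rewrite Hk, add_suc, !add_zero; reflexivity.
    + left; exists j; rewrite Hk, add_suc, suc_add; reflexivity.
  - right; exists (suc k); rewrite Hk, !add_suc; reflexivity.
Qed.

Lemma nat_integral m n : mul m n = zero -> m = zero \/ n = zero.
Proof.
  destruct (zero_or_suc m) as [-> |[k ->]]; [auto|].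
  destruct (zero_or_suc n) as [-> |[l ->]]; [auto|].
  rewrite mul_suc, add_suc; intros H; destruct (suc_neq_zero _ H).
Qed.

Lemma mul_cancel s m n : s <> zero -> mul s m = mul s n -> m = n.
Proof.
  intros Hs.
  assert (K : forall m k, mul s m = mul s (add m (suc k)) -> False).
  { intros p k; rewrite mulDr, addC; rewrite <- (zero_add (mul s p)) at 1.
    intros E; apply add_cancel in E; symmetry in E; apply nat_integral in E as [E|E]; [auto|].
    destruct (suc_neq_zero _ E). }
  destruct (le_or_lt m n) as [[k ->]|[k ->]]; intros E.
  - destruct (zero_or_suc k) as [-> |[j ->]]; [symmetry; apply add_zero|destruct (K _ _ E)].
  - destruct (K n k); symmetry; exact E.
Qed.

Definition sempty (T : IT) : sub T := Sub (fun _ => False) (intp_const T False).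

Definition sadd {T : IT} (S : sub T) (x : T) : sub T := Sub (fun t => S t \/ t = x) ltac:(int).

Lemma sadd_int (T : IT) : intf2 (sadd (T := T)).
Proof. unfold sadd; int. Qed.

Hint Resolve sadd_int : internal.

(** Kuratowski finiteness inside the model: membership in every internal family that contains the
    empty set and is closed under adding an element. *)
Definition finite {T : IT} (S : sub T) : Prop :=
  forall Z : sub (subI T), Z (sempty T) -> (forall S x, Z S -> Z (sadd S x)) -> Z S.

Lemma finite_int (T : IT) : intp (finite (T := T)).
Proof. unfold finite; int. Qed.

Lemma finite_empty (T : IT) : finite (sempty T).
Proof. intros Z H _; exact H. Qed.

Lemma finite_add (T : IT) (S : sub T) x : finite S -> finite (sadd S x).
Proof. intros H Z H0 HS; apply HS, H; assumption. Qed.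

Lemma finite_ind (T : IT) (P : sub T -> Prop) :
  intp P -> P (sempty T) -> (forall S x, finite S -> P S -> P (sadd S x)) ->
  forall S, finite S -> P S.
Proof.
  intros HP H0 HS S H.
  assert (Hf := finite_int T).
  assert (Hi : intp (fun S : sub T => finite S /\ P S)) by int.
  apply (H (Sub _ Hi)); simpl; [split; [apply finite_empty|exact H0]|].
  intros S' x [H1 H2]; split; [apply finite_add|apply HS]; assumption.
Qed.

Definition sunion {T : IT} (S S' : sub T) : sub T := Sub (fun t => S t \/ S' t) ltac:(int).

Lemma sunion_int (T : IT) : intf2 (sunion (T := T)).
Proof. unfold sunion; int. Qed.

Hint Resolve sunion_int finite_int : internal.

Lemma sunion_sadd (T : IT) (S S' : sub T) x : sunion S (sadd S' x) = sadd (sunion S S') x.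
Proof. apply sub_ext; intros t; simpl; tauto. Qed.

Lemma sunion_sempty (T : IT) (S : sub T) : sunion S (sempty T) = S.
Proof. apply sub_ext; intros t; simpl; tauto. Qed.

Lemma finite_union (T : IT) (S S' : sub T) : finite S -> finite S' -> finite (sunion S S').
Proof.
  intros HS; revert S'; apply (finite_ind T (fun S' => finite (sunion S S'))); [int|..].
  - rewrite sunion_sempty; exact HS.
  - intros S' x _ IH; rewrite sunion_sadd; apply finite_add, IH.
Qed.

Lemma finite_avoid (T : IT) (i : natI -> T) (S : sub T) :
  intf i -> (forall m n, i m = i n -> m = n) -> finite S -> exists n, ~ S (i n).
Proof.
  intros Hi inj HS.
  (* Strengthened for the induction on [S]: a whole tail of the sequence avoids [S]. By injectivity
     a new element of [S] occurs at most once, and the tail can start just after it. *)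
  cut (exists n, forall k, ~ S (i (add n k))).
  { intros [n Hn]; exists (add n zero); apply Hn. }
  revert S HS; apply (finite_ind T (fun S => exists n, forall k, ~ S (i (add n k)))); [int|..].
  - exists zero; simpl; auto.
  - intros S x _ [n Hn]; destruct (classic (exists k, x = i (add n k))) as [[k ->]|H].
    + exists (add n (suc k)); intros j [Hj|Hj].
      * rewrite <- addA in Hj; exact (Hn _ Hj).
      * apply inj in Hj; rewrite <- addA, !(addC n) in Hj; apply add_cancel in Hj.
        rewrite suc_add in Hj; apply (lt_irrefl k); rewrite <- Hj at 2.
        rewrite <- add_suc; apply lt_add; eauto.
    + exists n; intros k [Hk|Hk]; [exact (Hn _ Hk)|apply H; eauto].
Qed.

End Arithmetic.
#[export] Hint Resolve add_int mul_int sadd_int sunion_int finite_int : internal.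

(** * Rings of fractions *)

Record ring {M : set_structure} {HM : ZF M} := Ring {
  rcar :> itype M;
  r0 : rcar;
  r1 : rcar;
  radd : rcar -> rcar -> rcar;
  rmul : rcar -> rcar -> rcar;
  ropp : rcar -> rcar;
  rth : ring_theory r0 r1 radd rmul (fun x y => radd x (ropp y)) ropp eq;
  radd_int : intf2 radd;
  rmul_int : intf2 rmul;
  ropp_int : intf ropp
}.
Arguments ring M {HM}.
#[export] Hint Resolve radd_int rmul_int ropp_int : internal.

(** [(a - b) / s] with [a], [b] in a cancellative semiring [A] and [s] in a
    multiplicative set [S] of cancellable elements.  Both the field of rationals and
    the localizations of a domain are of this form. *)
Section Fractions.
Context {M : set_structure} {HM : ZF M}.
Local Notation IT := (itype M).
Context (A : IT) (o i : A) (add mul : A -> A -> A).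
Context (SR : semi_ring_theory o i add mul eq) (Hadd : intf2 add) (Hmul : intf2 mul).
Context (add_can : forall a b c, add a c = add b c -> a = b).
Context (S : sub A) (S1 : S i) (SM : forall a b, S a -> S b -> S (mul a b)).
Context (S_can : forall s a b, S s -> mul s a = mul s b -> a = b).
Add Ring A_semiring : SR.
Local Infix "+" := add.
Local Infix "*" := mul.

Local Notation D := (sigI A S (insub_int _ S)).
Local Notation T3 := (prodI (prodI A A) D).

(** The cross-multiplied equation [(a - b) / s = (a' - b') / s'], with negative terms moved to the
    other side. *)
Definition frac_eqv (t u : T3) : Prop :=
  fst (fst t) * proj1_sig (snd u) + snd (fst u) * proj1_sig (snd t) =
  fst (fst u) * proj1_sig (snd t) + snd (fst t) * proj1_sig (snd u).

Lemma frac_eqv_int : intp2 frac_eqv.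
Proof. unfold frac_eqv; int. Qed.

Lemma frac_eqv_trans t u w : frac_eqv t u -> frac_eqv u w -> frac_eqv t w.
Proof.
  destruct t as [[a b] [s Hs]], u as [[a' b'] [s' Hs']], w as [[a'' b''] [s'' Hs'']].
  unfold frac_eqv; simpl; intros E1 E2.
  (* Without subtraction, the middle fraction is eliminated by adding the same term to both sides,
     after multiplying by its denominator [s']. *)
  apply (S_can s' _ _ Hs'), (add_can _ _ (s * (a' * s'' + b' * s''))).
  transitivity (s'' * (a * s' + b' * s) + s * (a' * s'' + b'' * s')); [ring|].
  rewrite E1, E2; ring.
Qed.

Lemma frac_eqv_sym t u : frac_eqv t u -> frac_eqv u t.
Proof. unfold frac_eqv; intros E; symmetry; exact E. Qed.

Definition frac_class (t : T3) : subI T3 := Sub (frac_eqv t) ltac:(assert (H := frac_eqv_int); int).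

Definition frac_carrier : IT :=
  sigI (subI T3) (fun c => exists t, c = frac_class t)
    ltac:(unfold frac_class; assert (H := frac_eqv_int); int).

Definition frac_mk (t : T3) : frac_carrier := exist _ (frac_class t) (ex_intro _ t eq_refl).

Lemma frac_mk_int : intf frac_mk.
Proof. unfold frac_mk, frac_class; assert (H := frac_eqv_int); int. Qed.

Lemma frac_mk_eq t u : frac_mk t = frac_mk u <-> frac_eqv t u.
Proof.
  split.
  - intros E; apply (f_equal (@proj1_sig _ _)) in E; simpl in E.
    change (insub _ (frac_class t) u); rewrite E; simpl; reflexivity.
  - intros E; apply sig_inj, sub_ext; intros w; simpl; split; apply frac_eqv_trans;
      [apply frac_eqv_sym|]; exact E.
Qed.

Lemma frac_mk_surj x : exists t, x = frac_mk t.
Proof. destruct x as [c [t Ht]]; exists t; apply sig_inj; exact Ht. Qed.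

(** Representatives are picked outside the model, and this function need not be internal. The
    operations defined from it do not depend on the picks, and are shown internal through graphs
    that do not mention it. *)
Definition frac_rep (x : frac_carrier) : T3 :=
  proj1_sig (constructive_indefinite_description _ (frac_mk_surj x)).

Lemma frac_repK x : frac_mk (frac_rep x) = x.
Proof. unfold frac_rep; destruct constructive_indefinite_description; auto. Qed.

Definition den_mul (s t : D) : D :=
  exist _ (proj1_sig s * proj1_sig t) (SM _ _ (proj2_sig s) (proj2_sig t)).

Definition tadd (t u : T3) : T3 :=
  (fst (fst t) * proj1_sig (snd u) + fst (fst u) * proj1_sig (snd t),
   snd (fst t) * proj1_sig (snd u) + snd (fst u) * proj1_sig (snd t),
   den_mul (snd t) (snd u)).

Definition tmul (t u : T3) : T3 :=
  (fst (fst t) * fst (fst u) + snd (fst t) * snd (fst u),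
   fst (fst t) * snd (fst u) + snd (fst t) * fst (fst u),
   den_mul (snd t) (snd u)).

Definition topp (t : T3) : T3 := (snd (fst t), fst (fst t), snd t).

Definition frac_add (x y : frac_carrier) : frac_carrier := frac_mk (tadd (frac_rep x) (frac_rep y)).
Definition frac_mul (x y : frac_carrier) : frac_carrier := frac_mk (tmul (frac_rep x) (frac_rep y)).
Definition frac_opp (x : frac_carrier) : frac_carrier := frac_mk (topp (frac_rep x)).

Lemma frac_addE t u : frac_add (frac_mk t) (frac_mk u) = frac_mk (tadd t u).
Proof.
  apply frac_mk_eq.
  assert (E1 : frac_eqv (frac_rep (frac_mk t)) t) by apply frac_mk_eq, frac_repK.
  assert (E2 : frac_eqv (frac_rep (frac_mk u)) u) by apply frac_mk_eq, frac_repK.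
  destruct (frac_rep (frac_mk t)) as [[a b] [s Hs]], (frac_rep (frac_mk u)) as [[c d] [r Hr]].
  destruct t as [[a' b'] [s' Hs']], u as [[c' d'] [r' Hr']].
  unfold frac_eqv in *; simpl in *.
  transitivity ((a * s' + b' * s) * (r * r') + (c * r' + d' * r) * (s * s')); [ring|].
  rewrite E1, E2; ring.
Qed.

Lemma frac_mulE t u : frac_mul (frac_mk t) (frac_mk u) = frac_mk (tmul t u).
Proof.
  apply frac_mk_eq.
  assert (E1 : frac_eqv (frac_rep (frac_mk t)) t) by apply frac_mk_eq, frac_repK.
  assert (E2 : frac_eqv (frac_rep (frac_mk u)) u) by apply frac_mk_eq, frac_repK.
  apply (frac_eqv_trans _ (tmul t (frac_rep (frac_mk u)))).
  - destruct (frac_rep (frac_mk t)) as [[a b] [s Hs]], (frac_rep (frac_mk u)) as [[c d] [r Hr]].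
    destruct t as [[a' b'] [s' Hs']]; unfold frac_eqv in *; simpl in *; clear E2.
    transitivity ((a * s' + b' * s) * (c * r) + (a' * s + b * s') * (d * r)); [ring|].
    rewrite E1; rewrite <- E1 at 2; ring.
  - destruct (frac_rep (frac_mk u)) as [[c d] [r Hr]].
    destruct t as [[a b] [s Hs]], u as [[c' d'] [r' Hr']]; unfold frac_eqv in *; simpl in *.
    transitivity ((c * r' + d' * r) * (a * s) + (c' * r + d * r') * (b * s)); [ring|].
    rewrite E2; rewrite <- E2 at 2; ring.
Qed.

Lemma frac_oppE t : frac_opp (frac_mk t) = frac_mk (topp t).
Proof.
  apply frac_mk_eq.
  assert (E1 : frac_eqv (frac_rep (frac_mk t)) t) by apply frac_mk_eq, frac_repK.
  destruct (frac_rep (frac_mk t)) as [[a b] [s Hs]], t as [[a' b'] [s' Hs']].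
  unfold frac_eqv in *; simpl in *.
  transitivity (a' * s + b * s'); [ring|]; rewrite <- E1; ring.
Qed.

Definition frac_of (a : A) : frac_carrier := frac_mk (a, o, exist _ i S1).

Ltac frac_ring :=
  repeat match goal with x : car frac_carrier |- _ => destruct (frac_mk_surj x) as [[[? ?] [? ?]] ->] end;
  rewrite ?frac_addE, ?frac_mulE, ?frac_oppE, ?frac_addE, ?frac_mulE; apply frac_mk_eq;
  unfold frac_eqv; simpl; ring.

Lemma frac_ring_theory :
  ring_theory (frac_of o) (frac_of i) frac_add frac_mul (fun x y => frac_add x (frac_opp y)) frac_opp eq.
Proof. unfold frac_of; split; intros; frac_ring. Qed.

Lemma frac_add_int : intf2 frac_add.
Proof.
  assert (Hmk := frac_mk_int).
  assert (Ht : intf2 tadd) by (unfold tadd, den_mul; int).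
  apply (intf_graph (prodI frac_carrier frac_carrier) frac_carrier (fun p z =>
    exists t u, fst p = frac_mk t /\ snd p = frac_mk u /\ z = frac_mk (tadd t u))); [|int].
  intros [x y] z; simpl; split.
  - intros ->; exists (frac_rep x), (frac_rep y); rewrite !frac_repK; auto.
  - intros (t & u & -> & -> & ->); symmetry; apply frac_addE.
Qed.

Lemma frac_mul_int : intf2 frac_mul.
Proof.
  assert (Hmk := frac_mk_int).
  assert (Ht : intf2 tmul) by (unfold tmul, den_mul; int).
  apply (intf_graph (prodI frac_carrier frac_carrier) frac_carrier (fun p z =>
    exists t u, fst p = frac_mk t /\ snd p = frac_mk u /\ z = frac_mk (tmul t u))); [|int].
  intros [x y] z; simpl; split.
  - intros ->; exists (frac_rep x), (frac_rep y); rewrite !frac_repK; auto.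
  - intros (t & u & -> & -> & ->); symmetry; apply frac_mulE.
Qed.

Lemma frac_opp_int : intf frac_opp.
Proof.
  assert (Hmk := frac_mk_int).
  assert (Ht : intf topp) by (unfold topp; int).
  apply (intf_graph frac_carrier frac_carrier (fun x z =>
    exists t, x = frac_mk t /\ z = frac_mk (topp t))); [|int].
  intros x z; split.
  - intros ->; exists (frac_rep x); rewrite !frac_repK; auto.
  - intros (t & -> & ->); symmetry; apply frac_oppE.
Qed.

Definition frac : ring M :=
  Ring _ _ frac_carrier (frac_of o) (frac_of i) frac_add frac_mul frac_opp
    frac_ring_theory frac_add_int frac_mul_int frac_opp_int.

Lemma frac_of_int : intf (U := frac) frac_of.
Proof. unfold frac_of; assert (H := frac_mk_int); int. Qed.

Lemma frac_of_add a b : frac_of (a + b) = radd frac (frac_of a) (frac_of b).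
Proof. unfold frac_of; simpl; frac_ring. Qed.

Lemma frac_of_mul a b : frac_of (a * b) = rmul frac (frac_of a) (frac_of b).
Proof. unfold frac_of; simpl; frac_ring. Qed.

Lemma frac_of_inj a b : frac_of a = frac_of b -> a = b.
Proof.
  unfold frac_of; intros E; apply frac_mk_eq in E; unfold frac_eqv in E; simpl in E.
  transitivity (a * i + o * i); [ring|rewrite E; ring].
Qed.

Lemma frac_of_unit s : S s -> exists v, rmul frac (frac_of s) v = r1 frac.
Proof.
  intros Hs; exists (frac_mk (i, o, exist _ s Hs)); unfold frac_of; simpl; frac_ring.
Qed.

(** That is, [x = (a - b) / s]. *)
Lemma frac_surj x : exists a b s, S s /\
  radd frac (rmul frac x (frac_of s)) (frac_of b) = frac_of a.
Proof.
  destruct (frac_mk_surj x) as [[[a b] [s Hs]] ->].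
  exists a, b, s; split; [exact Hs|]; unfold frac_of; simpl; frac_ring.
Qed.

End Fractions.

(** * Divisibility inside a subring *)

Section Divisibility.
Context {M : set_structure} {HM : ZF M} {R : ring M}.
Local Notation "0" := (r0 R).
Local Notation "1" := (r1 R).
Local Infix "+" := (radd R).
Local Infix "*" := (rmul R).
Local Notation "- x" := (ropp R x).
Local Notation "a - b" := (a + - b).
Add Ring R_ring : (rth R).

(** Everything is relative to a subring [D] of one ambient ring, so that polynomial rings in
    different sets of variables are compared without embeddings. *)
Definition divides (D : sub R) (a b : R) : Prop := exists c, D c /\ b = a * c.
Definition unit_in (D : sub R) (u : R) : Prop := D u /\ divides D u 1.
(** Units qualify, and so does [0] if [D] is integral. *)
Definition prime_or_unit (D : sub R) (p : R) : Prop :=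
  D p /\ forall a b, D a -> D b -> divides D p (a * b) -> divides D p a \/ divides D p b.
Definition irreducible (D : sub R) (p : R) : Prop :=
  D p /\ p <> 0 /\ ~ unit_in D p /\
  forall a b, D a -> D b -> p = a * b -> unit_in D a \/ unit_in D b.

(** The ascending chain condition on principal ideals, stated with minimal elements: obtaining these
    from a condition on sequences would take dependent choice. *)
Definition wf_division (D : sub R) : Prop :=
  forall Y : sub R, (exists a, Y a /\ D a /\ a <> 0) ->
    exists a, (Y a /\ D a /\ a <> 0) /\
      forall b c, Y b -> D b -> D c -> a = b * c -> unit_in D c.

Record subring (D : sub R) : Prop := {
  sub_0 : D 0;
  sub_1 : D 1;
  sub_add : forall a b, D a -> D b -> D (a + b);
  sub_mul : forall a b, D a -> D b -> D (a * b);
  sub_opp : forall a, D a -> D (- a)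
}.

Definition integral (D : sub R) : Prop :=
  forall a b, D a -> D b -> a * b = 0 -> a = 0 \/ b = 0.

Record factorial (D : sub R) : Prop := {
  fac_integral : integral D;
  fac_wf : wf_division D;
  fac_prime : forall p, irreducible D p -> prime_or_unit D p
}.

Lemma divides_int (D : sub R) : intp2 (divides D).
Proof. unfold divides; int. Qed.

Lemma unit_int (D : sub R) : intp (unit_in D).
Proof. unfold unit_in, divides; int. Qed.

Lemma eq_of_sub_zero (a b : R) : a - b = 0 -> a = b.
Proof. intros E; transitivity ((a - b) + b); [ring|rewrite E; ring]. Qed.

Context (D : sub R) (HD : subring D).

Lemma mul_cancel_l (c a b : R) :
  integral D -> D a -> D b -> D c -> c <> 0 -> c * a = c * b -> a = b.
Proof.
  intros Hi Ha Hb Hc Hc0 E; apply eq_of_sub_zero.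
  destruct (Hi c (a - b)) as [H|H]; auto.
  - apply sub_add; auto; apply sub_opp; auto.
  - transitivity (c * a - c * b); [ring|rewrite E; ring].
  - contradiction.
Qed.

Lemma divides_trans a b c : divides D a b -> divides D b c -> divides D a c.
Proof.
  intros (u & Hu & ->) (v & Hv & ->); exists (u * v); split; [apply sub_mul; auto|ring].
Qed.

Lemma divides_mulr a b c : D c -> divides D a b -> divides D a (b * c).
Proof. intros Hc (u & Hu & ->); exists (u * c); split; [apply sub_mul; auto|ring]. Qed.

Lemma divides_mull a b c : D c -> divides D a b -> divides D a (c * b).
Proof. intros Hc (u & Hu & ->); exists (u * c); split; [apply sub_mul; auto|ring]. Qed.

Lemma divides_refl a : divides D a a.
Proof. exists 1; split; [apply sub_1; auto|ring]. Qed.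

Lemma unit_dvd a b : unit_in D (a * b) -> D a -> D b -> unit_in D a.
Proof.
  intros [_ (v & Hv & E)] Ha Hb; split; auto.
  exists (b * v); split; [apply sub_mul; auto|rewrite E; ring].
Qed.

Lemma unit_mul a b : unit_in D a -> unit_in D b -> unit_in D (a * b).
Proof.
  intros [Ha (u & Hu & E)] [Hb (v & Hv & E')]; split; [apply sub_mul; auto|].
  exists (u * v); split; [apply sub_mul; auto|].
  transitivity (1 * 1); [ring|]; rewrite E at 1; rewrite E'; ring.
Qed.

Lemma prime_or_unit_mul_unit u p :
  unit_in D u -> prime_or_unit D p -> prime_or_unit D (p * u).
Proof.
  intros [Hu (v & Hv & E)] [Hp H]; split; [apply sub_mul; auto|].
  intros a b Ha Hb (c & Hc & Ec).
  assert (K : forall f, divides D p f -> divides D (p * u) f).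
  { intros f (w & Hw & ->); exists (v * w); split; [apply sub_mul; auto|].
    transitivity (p * w * 1); [ring|rewrite E; ring]. }
  destruct (H a b Ha Hb) as [Hd|Hd]; auto.
  exists (u * c); split; [apply sub_mul; auto|rewrite Ec; ring].
Qed.

Lemma wf_min (P : R -> Prop) : intp P -> wf_division D ->
  (exists a, P a /\ D a /\ a <> 0) ->
  exists a, (P a /\ D a /\ a <> 0) /\
    forall b c, P b -> D b -> D c -> a = b * c -> unit_in D c.
Proof. intros HP HW H; exact (HW (Sub P HP) H). Qed.

(** A minimal non-unit divisor of [a] is irreducible: a non-unit factor of it still divides [a], so
    by minimality the cofactor is a unit. *)
Lemma irreducible_divisor a : wf_division D -> D a -> a <> 0 -> ~ unit_in D a ->
  exists r c, irreducible D r /\ D c /\ a = r * c.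
Proof.
  intros HW Ha H0 Hu.
  destruct (wf_min (fun y => ~ unit_in D y /\ divides D y a)) as (r & ((Hr & Hd) & HDr & Hr0) & Hm).
  - unfold unit_in, divides; int.
  - exact HW.
  - exists a; repeat split; auto; apply divides_refl.
  - destruct Hd as (c & Hc & E); exists r, c; repeat split; auto.
    intros u v Hu' Hv E'; destruct (classic (unit_in D u)) as [|Hn]; [auto|right].
    apply (Hm u v); auto; split; [exact Hn|].
    exists (v * c); split; [apply sub_mul; auto|rewrite E, E'; ring].
Qed.

End Divisibility.
#[export] Hint Resolve divides_int unit_int : internal.

(** * Gauss's lemma *)

(** [B] is a factorial subring of [R], and [C] is the polynomial ring [B[x]] inside [R]:
    [E n] is the set of polynomials of degree less than [n], in Horner form. *)
Section Gauss.
Context {M : set_structure} {HM : ZF M} {R : ring M}.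
Local Notation "0" := (r0 R).
Local Notation "1" := (r1 R).
Local Infix "+" := (radd R).
Local Infix "*" := (rmul R).
Local Notation "- x" := (ropp R x).
Local Notation "a - b" := (a + - b).
Add Ring R_ring' : (rth R).

Context (B : sub R) (HB : subring B) (x : R).

Definition horner_step (S : sub R) : sub R :=
  Sub (fun f => exists b g, B b /\ S g /\ f = b + x * g) ltac:(int).

Lemma horner_step_int : intf2 (fun _ : natI => horner_step).
Proof. unfold horner_step; int. Qed.

Definition horner : natI -> sub R :=
  rec (subI R) (Sub (fun f => f = 0) ltac:(int)) _ horner_step_int.

Definition adjoin : sub R := Sub (fun f => exists n, horner n f) ltac:(unfold horner; int).

Lemma horner_int : intf horner.
Proof. unfold horner; int. Qed.

Hint Resolve horner_int : internal.

Local Notation E := horner.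
Local Notation C := adjoin.

Lemma horner_0 f : E zero f <-> f = 0.
Proof. unfold horner; rewrite rec_zero; reflexivity. Qed.

Lemma horner_S n f : E (suc n) f <-> exists b g, B b /\ E n g /\ f = b + x * g.
Proof. unfold horner; rewrite rec_suc; reflexivity. Qed.

Lemma horner_zero n : E n 0.
Proof.
  nat_ind n; [apply horner_0; reflexivity|].
  intros n IH; apply horner_S; exists 0, 0; repeat split; [apply sub_0; auto|exact IH|ring].
Qed.

Lemma horner_mono1 n f : E n f -> E (suc n) f.
Proof.
  revert f; nat_ind n; [intros f H; apply horner_0 in H as ->; apply horner_zero|].
  intros n IH f H; apply horner_S in H as (b & g & Hb & Hg & ->).
  apply horner_S; exists b, g; auto.
Qed.

Lemma horner_mono n k f : E n f -> E (add n k) f.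
Proof.
  intros H; nat_ind k; [rewrite add_zero; exact H|].
  intros k IH; rewrite add_suc; apply horner_mono1, IH.
Qed.

Lemma horner_add n f g : E n f -> E n g -> E n (f + g).
Proof.
  revert f g; nat_ind n.
  - intros f g Hf Hg; apply horner_0 in Hf as ->; apply horner_0 in Hg as ->; apply horner_0; ring.
  - intros n IH f g Hf Hg; apply horner_S in Hf as (b & f' & Hb & Hf & ->).
    apply horner_S in Hg as (c & g' & Hc & Hg & ->).
    apply horner_S; exists (b + c), (f' + g'); repeat split; [apply sub_add|apply IH|ring]; auto.
Qed.

Lemma horner_scale n c f : B c -> E n f -> E n (c * f).
Proof.
  intros Hc; revert f; nat_ind n.
  - intros f Hf; apply horner_0 in Hf as ->; apply horner_0; ring.
  - intros n IH f Hf; apply horner_S in Hf as (b & g & Hb & Hg & ->).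
    apply horner_S; exists (c * b), (c * g); repeat split; [apply sub_mul|apply IH|ring]; auto.
Qed.

Lemma horner_opp n f : E n f -> E n (- f).
Proof.
  intros H; replace (- f) with (- (1) * f) by ring.
  apply horner_scale; [apply sub_opp, sub_1; auto|exact H].
Qed.

Lemma horner_shift n f : E n f -> E (suc n) (x * f).
Proof. intros H; apply horner_S; exists 0, f; repeat split; [apply sub_0; auto|exact H|ring]. Qed.

Lemma horner_base b : B b <-> E (suc zero) b.
Proof.
  rewrite horner_S; split.
  - intros Hb; exists b, 0; repeat split; [exact Hb|apply horner_zero|ring].
  - intros (c & g & Hc & Hg & ->); apply horner_0 in Hg as ->.
    replace (c + x * 0) with c by ring; exact Hc.
Qed.

Lemma horner_mul n m f g : E n f -> E m g -> E (add n m) (f * g).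
Proof.
  intros Hf Hg; revert f Hf; nat_ind n.
  - intros f Hf; apply horner_0 in Hf as ->; replace (0 * g) with 0 by ring; apply horner_zero.
  - intros n IH f Hf; apply horner_S in Hf as (b & f' & Hb & Hf & ->).
    rewrite suc_add; replace ((b + x * f') * g) with (b * g + x * (f' * g)) by ring.
    apply horner_add; [|apply horner_shift, IH, Hf].
    rewrite <- suc_add, addC; apply horner_mono, horner_scale; auto.
Qed.

Lemma horner_adjoin n f : E n f -> C f.
Proof. intros H; exists n; exact H. Qed.

Lemma base_adjoin b : B b -> C b.
Proof. intros H; apply horner_base in H; exact (horner_adjoin _ _ H). Qed.

Lemma adjoin_subring : subring C.
Proof.
  split.
  - exact (horner_adjoin _ _ (horner_zero zero)).
  - apply base_adjoin, sub_1; auto.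
  - intros a b [n Ha] [m Hb]; apply (horner_adjoin (add n m)), horner_add;
      [|rewrite addC]; apply horner_mono; auto.
  - intros a b [n Ha] [m Hb]; exact (horner_adjoin _ _ (horner_mul _ _ _ _ Ha Hb)).
  - intros a [n Ha]; exact (horner_adjoin _ _ (horner_opp _ _ Ha)).
Qed.

Lemma adjoin_x : C x.
Proof.
  apply (horner_adjoin (suc (suc zero))); replace x with (x * 1) by ring.
  apply horner_shift, horner_base, sub_1; auto.
Qed.

Lemma adjoin_inv f : C f -> exists b g, B b /\ C g /\ f = b + x * g.
Proof.
  intros [n H]; apply horner_mono1, horner_S in H as (b & g & Hb & Hg & ->).
  exists b, g; repeat split; [exact Hb|exact (horner_adjoin _ _ Hg)].
Qed.

Lemma adjoin_least (D : sub R) : subring D -> (forall b, B b -> D b) -> D x -> forall f, C f -> D f.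
Proof.
  intros HD HBD Dx f [n Hf]; revert f Hf; nat_ind n.
  - intros f Hf; apply horner_0 in Hf as ->; apply sub_0; exact HD.
  - intros n IH f Hf; apply horner_S in Hf as (b & g & Hb & Hg & ->).
    apply sub_add; auto; apply sub_mul; auto.
Qed.

Let HC := adjoin_subring.
Let C_x := adjoin_x.

Ltac inC := repeat first
  [ assumption | apply (sub_add C HC) | apply (sub_mul C HC) | apply (sub_opp C HC)
  | apply (sub_0 C HC) | apply (sub_1 C HC) | apply base_adjoin ].
Ltac inB := repeat first
  [ assumption | apply (sub_add B HB) | apply (sub_mul B HB) | apply (sub_opp B HB)
  | apply (sub_0 B HB) | apply (sub_1 B HB) ].

(** Transcendence of [x] over [B], in the form that compares coefficients one Horner step at a
    time. *)
Context (tr : forall b f, B b -> C f -> b + x * f = 0 -> b = 0 /\ f = 0).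

Lemma horner_uniq b f b' f' : B b -> B b' -> C f -> C f' ->
  b + x * f = b' + x * f' -> b = b' /\ f = f'.
Proof.
  intros Hb Hb' Hf Hf' H; destruct (tr (b - b') (f - f')) as [H1 H2]; [inB|inC| |].
  - transitivity ((b + x * f) - (b' + x * f')); [ring|rewrite H; ring].
  - split; apply eq_of_sub_zero; assumption.
Qed.

Lemma divides_base_x p f : B p -> C f -> divides C p (x * f) -> divides C p f.
Proof.
  intros Hp Hf (c & Hc & H); destruct (adjoin_inv _ Hc) as (c0 & c1 & Hc0 & Hc1 & ->).
  destruct (horner_uniq 0 f (p * c0) (p * c1)) as [_ H']; [inB|inB|inC|inC| |].
  - transitivity (x * f); [ring|rewrite H; ring].
  - exists c1; split; assumption.
Qed.

(** Induction on the degree bounds of both factors. If [p] divides [g h], it divides the product of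
    the constant terms, say [p] divides [g0]. Then it divides [(g - g0) h = x g1 h], hence [g1 h],
    where the bound on the first factor is smaller. *)
Lemma prime_adjoin p : prime_or_unit B p -> prime_or_unit C p.
Proof.
  intros [Hp H]; split; [inC|].
  cut (forall n g, E n g -> forall m h, E m h -> divides C p (g * h) -> divides C p g \/ divides C p h).
  { intros K a b [n Ha] [m Hb]; eauto. }
  assert (D0 : divides C p 0) by (exists 0; split; [inC|ring]).
  intros n; nat_ind n; [intros g Hg; apply horner_0 in Hg as ->; auto|].
  intros n IHn g Hg m; nat_ind m; [intros h Hh; apply horner_0 in Hh as ->; auto|].
  intros m IHm h Hh (c & Hc & Ec).
  assert (HgC := horner_adjoin _ _ Hg); assert (HhC := horner_adjoin _ _ Hh).
  pose proof Hg as Hg'; pose proof Hh as Hh'.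
  apply horner_S in Hg' as (g0 & g1 & Hg0 & Hg1 & Eg).
  apply horner_S in Hh' as (h0 & h1 & Hh0 & Hh1 & Eh).
  destruct (adjoin_inv _ Hc) as (c0 & c1 & Hc0 & Hc1 & E').
  assert (Hg1C := horner_adjoin _ _ Hg1); assert (Hh1C := horner_adjoin _ _ Hh1).
  destruct (horner_uniq (g0 * h0) (g0 * h1 + g1 * h) (p * c0) (p * c1)) as [E0 _];
    [inB|inB|inC|inC| |].
  { transitivity (g * h); [rewrite Eg, Eh; ring|rewrite Ec, E'; ring]. }
  destruct (H g0 h0 Hg0 Hh0) as [(e & He & Ee)|(e & He & Ee)]; [exists c0; auto|..].
  - assert (Hd : divides C p (g1 * h)).
    { apply divides_base_x; [exact Hp|inC|].
      exists (c - e * h); split; [inC|].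
      transitivity (g * h - g0 * h); [rewrite Eg; ring|rewrite Ec, Ee; ring]. }
    destruct (IHn g1 Hg1 _ h Hh Hd) as [(f & Hf & Ef)|Hd']; [left|right; exact Hd'].
    exists (e + x * f); split; [inC|rewrite Eg, Ee, Ef; ring].
  - assert (Hd : divides C p (g * h1)).
    { apply divides_base_x; [exact Hp|inC|].
      exists (c - e * g); split; [inC|].
      transitivity (g * h - g * h0); [rewrite Eh; ring|rewrite Ec, Ee; ring]. }
    destruct (IHm h1 Hh1 Hd) as [Hd'|(f & Hf & Ef)]; [left; exact Hd'|right].
    exists (e + x * f); split; [inC|rewrite Eh, Ee, Ef; ring].
Qed.

(** This is [prime_adjoin] at [p = 0]; for its sake [prime_or_unit] does not exclude zero. *)
Lemma integral_adjoin : integral B -> integral C.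
Proof.
  intros HI; destruct (prime_adjoin 0) as [_ H].
  - split; [inB|]; intros a b Ha Hb (c & Hc & Hab).
    destruct (HI a b Ha Hb) as [-> | ->]; [rewrite Hab; ring| |];
      [left|right]; exists 0; (split; [inB|ring]).
  - intros a b Ha Hb Hab.
    destruct (H a b Ha Hb) as [(c & Hc & ->)|(c & Hc & ->)];
      [exists 0; split; [inC|rewrite Hab; ring]|left; ring|right; ring].
Qed.

Definition xpow : natI -> R := rec R 1 (fun _ y => y * x) ltac:(int).

Lemma xpow_int : intf xpow.
Proof. unfold xpow; int. Qed.

Hint Resolve xpow_int : internal.

Lemma xpow_0 : xpow zero = 1.
Proof. apply rec_zero. Qed.

Lemma xpow_S n : xpow (suc n) = xpow n * x.
Proof. unfold xpow; rewrite rec_suc; reflexivity. Qed.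

Lemma xpow_add n m : xpow (add n m) = xpow n * xpow m.
Proof.
  nat_ind m; [rewrite add_zero, xpow_0; ring|].
  intros m IH; rewrite add_suc, !xpow_S, IH; ring.
Qed.

Lemma horner_xpow n m f : E m f -> E (add n m) (xpow n * f).
Proof.
  intros H; nat_ind n; [rewrite zero_add, xpow_0; replace (1 * f) with f by ring; exact H|].
  intros n IH; rewrite suc_add, xpow_S; replace (xpow n * x * f) with (x * (xpow n * f)) by ring.
  apply horner_shift, IH.
Qed.

(** The number [n] is only a bound on the degree of [f], so the coefficient [a] of [x^n] may be
    zero; lemmas about the true degree assume [a <> 0]. *)
Definition lead (n : natI) (f a : R) : Prop := B a /\ exists e, E n e /\ f = e + a * xpow n.

Lemma lead_exists n f : E (suc n) f -> exists a, lead n f a.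
Proof.
  unfold lead; revert f; nat_ind n.
  - intros f H; exists f; split; [apply horner_base; exact H|].
    exists 0; split; [apply horner_zero|rewrite xpow_0; ring].
  - intros n IH f H; apply horner_S in H as (b & g & Hb & Hg & ->).
    destruct (IH g Hg) as (a & Ha & e & He & ->); exists a; split; [exact Ha|].
    exists (b + x * e); split; [apply horner_S; exists b, e; auto|rewrite xpow_S; ring].
Qed.

Lemma lead_horner n f a : lead n f a -> E (suc n) f.
Proof.
  intros (Ha & e & He & ->); apply horner_add; [apply horner_mono1, He|].
  replace (a * xpow n) with (xpow n * a) by ring.
  apply horner_base, (horner_xpow n) in Ha; rewrite add_suc, add_zero in Ha; exact Ha.
Qed.

Lemma lead_small n f a : lead n f a -> E n f -> a = 0.
Proof.
  intros (Ha & e & He & ->) H.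
  assert (K : E n (a * xpow n)).
  { replace (a * xpow n) with ((e + a * xpow n) + - e) by ring.
    apply horner_add; [exact H|apply horner_opp, He]. }
  clear e He H; revert K; nat_ind n.
  - intros K; apply horner_0 in K; rewrite xpow_0 in K; rewrite <- K; ring.
  - intros n IH K; apply horner_S in K as (b & g & Hb & Hg & Eg).
    apply IH; replace (a * xpow n) with g; [exact Hg|].
    apply (horner_uniq b g 0 (a * xpow n)); [inB|inB|exact (horner_adjoin _ _ Hg)| |].
    + assert (C (xpow n)); [|inC].
      apply (horner_adjoin (add n (suc zero))).
      replace (xpow n) with (xpow n * 1) by ring; apply horner_xpow, horner_base; inB.
    + rewrite <- Eg, xpow_S; ring.
Qed.

Lemma lead_unique n f a b : lead n f a -> lead n f b -> a = b.
Proof.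
  intros (Ha & e & He & Ef) (Hb & e' & He' & Ef'); apply eq_of_sub_zero, (lead_small n (e' - e)).
  - split; [inB|]; exists 0; split; [apply horner_zero|].
    transitivity ((e' + b * xpow n) - b * xpow n - e); [ring|rewrite <- Ef', Ef; ring].
  - apply horner_add; [|apply horner_opp]; assumption.
Qed.

Lemma lead_nonzero f : C f -> f <> 0 -> exists n a, lead n f a /\ a <> 0.
Proof.
  unfold lead; intros [m H] H0; revert H; nat_ind m; [intros H; apply horner_0 in H; contradiction|].
  intros m IH H; destruct (lead_exists _ _ H) as [a Ha].
  destruct (classic (a = 0)) as [-> |Hn]; [|eauto].
  apply IH; destruct Ha as (_ & e & He & ->).
  replace (e + 0 * xpow m) with e by ring; exact He.
Qed.

Lemma lead_degree n m f a b : lead n f a -> a <> 0 -> lead m f b -> b <> 0 -> n = m.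
Proof.
  intros H1 Ha H2 Hb.
  assert (K : forall n k f a b, lead n f a -> lead (add n (suc k)) f b -> b = 0).
  { clear -tr HB C_x HC; intros n k f a b H1 H2; apply (lead_small _ _ _ H2); rewrite add_suc, <- suc_add.
    apply lead_horner, (horner_mono _ k) in H1; exact H1. }
  destruct (le_or_lt n m) as [[k ->]|[k ->]]; [|destruct Ha; exact (K _ _ _ _ _ H2 H1)].
  destruct (zero_or_suc k) as [-> |[j ->]]; [symmetry; apply add_zero|].
  destruct Hb; exact (K _ _ _ _ _ H1 H2).
Qed.

Lemma lead_mul n m f g a b : lead n f a -> lead m g b -> lead (add n m) (f * g) (a * b).
Proof.
  intros (Ha & e & He & ->) (Hb & e' & He' & ->); split; [inB|].
  exists (e * e' + (xpow n * (a * e') + xpow m * (b * e))); split.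
  - repeat apply horner_add; [apply horner_mul; auto|apply horner_xpow, horner_scale; auto|].
    rewrite addC; apply horner_xpow, horner_scale; auto.
  - rewrite xpow_add; ring.
Qed.

Lemma lead_zero f a : lead zero f a -> f = a.
Proof.
  intros (Ha & e & He & ->); apply horner_0 in He as ->; rewrite xpow_0; ring.
Qed.

Lemma add_eq_zero n m : add n m = zero -> n = zero.
Proof.
  destruct (zero_or_suc n) as [-> |[k ->]]; [auto|].
  rewrite suc_add; intros H; destruct (suc_neq_zero _ H).
Qed.

Context (FB : factorial B) (one_neq_zero : 1 <> 0).
Let iB := fac_integral B FB.
Let iC : integral C := integral_adjoin iB.
Let wB := fac_wf B FB.

Lemma unit_adjoin u : unit_in C u -> unit_in B u.
Proof.
  intros [Hu (v & Hv & Euv)].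
  assert (Hu0 : u <> 0) by (intros ->; apply one_neq_zero; rewrite Euv; ring).
  assert (Hv0 : v <> 0) by (intros ->; apply one_neq_zero; rewrite Euv; ring).
  destruct (lead_nonzero u Hu Hu0) as (n & a & La & Ha).
  destruct (lead_nonzero v Hv Hv0) as (m & b & Lb & Hb).
  assert (L1 : lead zero 1 1).
  { split; [inB|]; exists 0; split; [apply horner_zero|rewrite xpow_0; ring]. }
  assert (Lab := lead_mul _ _ _ _ _ _ La Lb); rewrite <- Euv in Lab.
  assert (Hab : a * b <> 0).
  { intros H; destruct (iB a b) as [K|K]; auto; [apply La|apply Lb]. }
  assert (H0 := lead_degree _ _ _ _ _ Lab Hab L1 one_neq_zero).
  assert (Hn := add_eq_zero _ _ H0); rewrite addC in H0; assert (Hm := add_eq_zero _ _ H0).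
  subst n m; pose proof (proj1 La) as Ba; pose proof (proj1 Lb) as Bb.
  apply lead_zero in La, Lb; subst a b; split; [exact Ba|exists v; auto].
Qed.

Lemma unit_base u : unit_in B u -> unit_in C u.
Proof. intros [Hu (v & Hv & H)]; split; [inC|]; exists v; split; [inC|exact H]. Qed.

(** Among the nonzero elements of [Y], first the degree is minimized, then the leading coefficient
    with respect to division in [B]. In a factorization with first factor in [Y], the cofactor has
    degree zero by the first choice and is a unit by the second. *)
Lemma wf_adjoin : wf_division C.
Proof.
  intros Y (f0 & Yf0 & Cf0 & Hf0).
  destruct (lt_least (fun n => exists f a, Y f /\ C f /\ lead n f a /\ a <> 0)) as (n & Hn & Hmin).
  { unfold lead; int. }
  { destruct (lead_nonzero f0 Cf0 Hf0) as (n & a & La & Ha); exists n, f0, a; auto. }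
  destruct Hn as (f1 & a1 & Yf1 & Cf1 & La1 & Ha1).
  destruct (wf_min B (fun a => exists f, Y f /\ C f /\ lead n f a)) as (a & ((f & Yf & Cf & La) & Ba & Ha) & Hm).
  { unfold lead; int. }
  { exact wB. }
  { exists a1; split; [exists f1; auto|split; [apply La1|exact Ha1]]. }
  exists f; split.
  { repeat split; auto; intros ->; apply Ha, (lead_small n 0); [exact La|apply horner_zero]. }
  intros g c Yg Cg Cc Efgc.
  assert (Hf : f <> 0).
  { intros ->; apply Ha, (lead_small n 0); [exact La|apply horner_zero]. }
  assert (Hg0 : g <> 0) by (intros ->; apply Hf; rewrite Efgc; ring).
  assert (Hc0 : c <> 0) by (intros ->; apply Hf; rewrite Efgc; ring).
  destruct (lead_nonzero g Cg Hg0) as (k & b & Lb & Hb).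
  destruct (lead_nonzero c Cc Hc0) as (m & d & Ld & Hd).
  assert (Lbd := lead_mul _ _ _ _ _ _ Lb Ld); rewrite <- Efgc in Lbd.
  assert (Hbd : b * d <> 0).
  { intros H; destruct (iB b d) as [K|K]; auto; [apply Lb|apply Ld]. }
  assert (Hk := lead_degree _ _ _ _ _ Lbd Hbd La Ha).
  assert (Hm0 : m = zero).
  { destruct (zero_or_suc m) as [H|[j ->]]; [exact H|].
    destruct (Hmin k); [apply lt_add; exists j; auto|].
    exists g, b; auto. }
  subst m; rewrite add_zero in Hk; subst k; rewrite add_zero in Lbd.
  assert (Ea := lead_unique _ _ _ _ La Lbd).
  pose proof (proj1 Ld) as Bd; apply lead_zero in Ld; subst d.
  apply unit_base, (Hm b c); auto; [exists g; auto|apply Lb].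
Qed.

Lemma x_prime f g : C f -> C g -> divides C x (f * g) -> divides C x f \/ divides C x g.
Proof.
  intros Hf Hg (c & Hc & H).
  destruct (adjoin_inv _ Hf) as (f0 & f1 & Hf0 & Hf1 & ->).
  destruct (adjoin_inv _ Hg) as (g0 & g1 & Hg0 & Hg1 & ->).
  destruct (horner_uniq (f0 * g0) (f0 * g1 + f1 * (g0 + x * g1)) 0 c) as [E0 _]; [inB|inB|inC|inC| |].
  { transitivity ((f0 + x * f1) * (g0 + x * g1)); [ring|rewrite H; ring]. }
  destruct (iB f0 g0 Hf0 Hg0 E0) as [-> | ->]; [left; exists f1|right; exists g1];
    (split; [inC|ring]).
Qed.

Let cancelC c a b := mul_cancel_l C HC c a b iC.

(** * Irreducible polynomials of positive degree are prime *)

Section NonConstantIrreducible.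
Context (p : R) (Hp : irreducible C p) (p_nonconst : ~ B p).
Let Cp : C p := proj1 Hp.

(** A minimal bad [b] is not a unit, hence has an irreducible factor [r], which is prime in [C]. If
    [b f = p c], then [r] divides [p c] but not [p], since the irreducible [p] would then be
    constant. So [r] divides [c] and cancels, which makes [b] smaller. *)
Lemma base_cancel b f : B b -> b <> 0 -> C f -> divides C p (b * f) -> divides C p f.
Proof.
  intros Bb Hb0 Cf Hd; apply NNPP; intros Hn.
  destruct (wf_min B (fun b => exists f, C f /\ divides C p (b * f) /\ ~ divides C p f))
    as (b1 & ((f1 & Cf1 & (c & Cc & Ec) & Hn1) & Bb1 & Hb1) & Hm).
  { unfold divides; int. }
  { exact wB. }
  { exists b; split; [exists f; auto|auto]. }
  destruct (classic (unit_in B b1)) as [[_ (v & Bv & Ev)]|Hu].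
  { apply Hn1; exists (c * v); split; [inC|].
    transitivity (f1 * 1); [ring|rewrite Ev].
    transitivity ((b1 * f1) * v); [ring|rewrite Ec; ring]. }
  destruct (irreducible_divisor B HB b1 wB Bb1 Hb1 Hu) as (r & b2 & Hr & Bb2 & ->).
  assert (Br := proj1 Hr).
  assert (Hr0 : r <> 0) by apply Hr.
  assert (Pr := prime_adjoin r (fac_prime B FB r Hr)).
  destruct (proj2 Pr p c) as [(q & Cq & Eq)|(c' & Cc' & Ec')]; [inC..| | |].
  - exists (b2 * f1); split; [inC|rewrite <- Ec; ring].
  - pose proof Hp as (_ & _ & _ & Hi); destruct (Hi r q) as [U|U]; [inC|inC|exact Eq|..].
    + apply unit_adjoin in U; apply Hr in U; exact U.
    + apply p_nonconst; rewrite Eq; apply unit_adjoin in U; destruct U; inB.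
  - assert (Hd2 : divides C p (b2 * f1)).
    { exists c'; split; [exact Cc'|]; apply (cancelC r); [inC..|exact Hr0|].
      transitivity (r * b2 * f1); [ring|rewrite Ec, Ec'; ring]. }
    apply Hr, (Hm b2 r); [exists f1; auto|inB|inB|ring].
Qed.

Context (x_ndvd : ~ divides C x p).

Lemma x_cancel f : C f -> divides C p (x * f) -> divides C p f.
Proof.
  intros Cf (c & Cc & Ec).
  destruct (x_prime p c Cp Cc) as [H|(c' & Cc' & ->)]; [exists f; auto|contradiction|].
  exists c'; split; [exact Cc'|].
  apply eq_of_sub_zero.
  destruct (tr 0 (f - p * c')) as [_ H]; [inB|inC| |exact H].
  transitivity (x * f - p * (x * c')); [ring|rewrite Ec; ring].
Qed.

(** The irreducible factors of [b] are prime in [C], so each cancels against [g] or [q], until [b]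
    is a unit and irreducibility of [p] applies. What is taken out of [g] is constant, hence only
    multiplies the constant that [g] divides. *)
Lemma constant_or_multiple b g q : B b -> b <> 0 -> C g -> C q -> b * p = g * q ->
  (exists d, B d /\ d <> 0 /\ divides C g d) \/ divides C p g.
Proof.
  intros Bb Hb0 Cg Cq Eb; apply NNPP; intros Hn.
  destruct (wf_min B (fun b => exists g q, C g /\ C q /\ b * p = g * q /\
    ~ ((exists d, B d /\ d <> 0 /\ divides C g d) \/ divides C p g)))
    as (b1 & ((g1 & q1 & Cg1 & Cq1 & E1 & Hn1) & Bb1 & Hb1) & Hm).
  { unfold divides; int. }
  { exact wB. }
  { exists b; split; [exists g, q; auto|auto]. }
  clear b g q Bb Hb0 Cg Cq Eb Hn.
  destruct (classic (unit_in B b1)) as [[_ (v & Bv & Ev)]|Hu].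
  { assert (Ep : p = g1 * (q1 * v)).
    { transitivity (1 * p); [ring|rewrite Ev]; transitivity ((b1 * p) * v); [ring|rewrite E1; ring]. }
    apply Hn1; pose proof Hp as (_ & _ & _ & Hi); destruct (Hi g1 (q1 * v)) as [U|U]; [inC|inC|exact Ep|..].
    - left; exists 1; split; [inB|]; split; [exact one_neq_zero|apply U].
    - right; destruct U as [_ (w & Cw & Ew)]; exists w; split; [exact Cw|].
      transitivity (g1 * 1); [ring|rewrite Ew, Ep; ring]. }
  destruct (irreducible_divisor B HB b1 wB Bb1 Hb1 Hu) as (r & b2 & Hr & Bb2 & ->).
  assert (Br := proj1 Hr).
  assert (Hr0 : r <> 0) by apply Hr.
  assert (Pr := prime_adjoin r (fac_prime B FB r Hr)).
  assert (K : forall g' q', C g' -> C q' -> b2 * p = g' * q' ->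
    (exists d, B d /\ d <> 0 /\ divides C g' d) \/ divides C p g').
  { intros g' q' Cg' Cq' E'; apply NNPP; intros Hn'.
    apply Hr, (Hm b2 r); [exists g', q'; auto|inB|inB|ring]. }
  assert (X : b2 * p * r = g1 * q1) by (rewrite <- E1; ring).
  destruct (proj2 Pr g1 q1) as [(g' & Cg' & ->)|(q' & Cq' & ->)]; [inC..| | |].
  - exists (b2 * p); split; [inC|rewrite <- X; ring].
  - apply Hn1; destruct (K g' q1) as [(d & Bd & Hd & c & Cc & ->)|(c & Cc & ->)]; [inC..| | |].
    + apply (cancelC r); [inC..|exact Hr0|].
      transitivity (b2 * p * r); [ring|rewrite X; ring].
    + left; exists (r * (g' * c)); split; [inB|]; split.
      * intros H; destruct (iB r (g' * c) Br Bd H); contradiction.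
      * exists c; split; [exact Cc|ring].
    + right; exists (r * c); split; [inC|ring].
  - apply Hn1, (K g1 q'); [inC..|].
    apply (cancelC r); [inC..|exact Hr0|].
    transitivity (b2 * p * r); [ring|rewrite X; ring].
Qed.

(** If [p] divides [a h], an element [g] of least degree of the ideal [I] of all [f] such that
    [p] divides [f h] divides every element of [I] up to a factor in [B]: this is
    pseudo-division, eliminating constant terms instead of leading ones.  As it divides [p],
    [g] is constant or a multiple of [p]; accordingly [p] divides [h] or [a]. *)
Lemma nonconstant_prime : prime_or_unit C p.
Proof.
  split; [exact Cp|]; intros a h Ca Ch Hd; destruct (classic (divides C p h)) as [Hh|Hh]; [right; exact Hh|left].
  set (I := fun f => C f /\ divides C p (f * h)).
  assert (Ii : intp I) by (unfold I, divides; int).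
  assert (Ip : I p) by (split; [exact Cp|exists h; split; [exact Ch|ring]]).
  destruct (lt_least (fun n => exists g, I g /\ E n g /\ g <> 0)) as (n & (g & Ig & Eg & Hg) & Hmin).
  { clearbody I; int. }
  { destruct Cp as [n Hn]; exists n, p; split; [exact Ip|split; [exact Hn|apply Hp]]. }
  destruct (zero_or_suc n) as [-> |[k ->]]; [apply horner_0 in Eg; contradiction|].
  apply horner_S in Eg as (g0 & g1 & Bg0 & Eg1 & Eg).
  assert (Cg1 := horner_adjoin _ _ Eg1).
  assert (Ix : forall f, C f -> I (x * f) -> I f).
  { intros f Cf [_ Hf]; split; [exact Cf|]; apply x_cancel; [inC|].
    replace (x * (f * h)) with (x * f * h) by ring; exact Hf. }
  (* With constant term zero, [g] would be [x g1], and [g1] would be an element of [I] of smaller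
     degree. *)
  assert (Hg0 : g0 <> 0).
  { intros ->; apply (Hmin k (lt_suc_diag k)); exists g1; split; [|split; [exact Eg1|]].
    - apply Ix; [exact Cg1|]; replace (x * g1) with g; [exact Ig|rewrite Eg; ring].
    - intros ->; apply Hg; rewrite Eg; ring. }
  assert (Il : forall u v f f', C u -> C v -> I f -> I f' -> I (u * f - v * f')).
  { intros u v f f' Cu Cv [Cf (c & Cc & Ec)] [Cf' (c' & Cc' & Ec')]; split; [inC|].
    exists (u * c - v * c'); split; [inC|].
    transitivity (u * (f * h) - v * (f' * h)); [ring|rewrite Ec, Ec'; ring]. }
  assert (K : forall m f, E m f -> I f -> exists b, B b /\ b <> 0 /\ divides C g (b * f)).
  { clearbody I; intros m; nat_ind m.
    - intros f Hf _; apply horner_0 in Hf as ->; exists 1; split; [inB|]; split; [exact one_neq_zero|].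
      exists 0; split; [inC|ring].
    - intros m IH f Ef If; destruct (classic (f = 0)) as [-> |Hf0].
      { exists 1; split; [inB|]; split; [exact one_neq_zero|]; exists 0; split; [inC|ring]. }
      destruct (le_or_lt (suc k) (suc m)) as [[j Ej]|[j Ej]].
      2:{ destruct (Hmin (suc m)); [apply lt_add; eauto|exists f; auto]. }
      rewrite suc_add in Ej; apply suc_inj in Ej.
      apply horner_S in Ef as (f0 & f1 & Bf0 & Ef1 & Ef).
      (* The combination [g0 f - f0 g] lies in [I] and has no constant term: it is [x] times this
         element, which therefore lies in [I] by [Ix] and has a smaller degree bound. *)
      destruct (IH (g0 * f1 - f0 * g1)) as (b & Bb & Hb & c & Cc & Ec).
      + apply horner_add; [apply horner_scale; auto|apply horner_opp, horner_scale; auto].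
        rewrite Ej; apply horner_mono; exact Eg1.
      + assert (Cf1 := horner_adjoin _ _ Ef1); apply Ix; [inC|].
        replace (x * (g0 * f1 - f0 * g1)) with (g0 * f - f0 * g) by (rewrite Ef, Eg; ring).
        apply Il; auto; inC.
      + exists (b * g0); split; [inB|]; split.
        * intros H; destruct (iB b g0 Bb Bg0 H); contradiction.
        * exists (b * f0 + x * c); split; [inC|].
          transitivity (b * f0 * g + x * (b * (g0 * f1 - f0 * g1))); [rewrite Ef, Eg; ring|].
          rewrite Ec; ring. }
  assert (Cg := proj1 Ig).
  destruct Cp as [np Enp]; destruct (K np p Enp Ip) as (b & Bb & Hb & q & Cq & Eq).
  destruct (constant_or_multiple b g q Bb Hb Cg Cq Eq) as [(d & Bd & Hd0 & c & Cc & Ed)|Hpg].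
  - destruct Hh; apply (base_cancel d); auto; rewrite Ed.
    replace (g * c * h) with (g * h * c) by ring; apply divides_mulr; [exact HC|exact Cc|apply Ig].
  - destruct Ca as [na Ena]; destruct (K na a Ena) as (b' & Bb' & Hb' & Hgb).
    { split; [exact (horner_adjoin _ _ Ena)|exact Hd]. }
    apply (base_cancel b'); auto; [exact (horner_adjoin _ _ Ena)|].
    exact (divides_trans C HC _ _ _ Hpg Hgb).
Qed.

End NonConstantIrreducible.

Lemma irreducible_prime_adjoin p : irreducible C p -> prime_or_unit C p.
Proof.
  intros Hp; pose proof Hp as (Cp & Hp0 & Hpu & Hpi).
  destruct (classic (B p)) as [Bp|Bp].
  - apply prime_adjoin, (fac_prime B FB); repeat split; auto.
    + intros U; apply Hpu, unit_base, U.
    + intros a b Ba Bb Ep; destruct (Hpi a b) as [U|U]; [inC|inC|exact Ep|..];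
        apply unit_adjoin in U; auto.
  - destruct (classic (divides C x p)) as [(q & Cq & Ep)|Hx]; [|apply nonconstant_prime; auto].
    destruct (Hpi x q C_x Cq Ep) as [[_ (c & Cc & Ec)]|U].
    + destruct (tr (- (1)) c) as [H _]; [inB|exact Cc|rewrite <- Ec; ring|].
      destruct one_neq_zero; transitivity (- - (1)); [ring|rewrite H; ring].
    + rewrite Ep; apply prime_or_unit_mul_unit; [exact HC|exact U|].
      split; [exact C_x|]; intros f g; apply x_prime.
Qed.

Lemma factorial_adjoin : factorial C.
Proof. split; [exact iC|exact wf_adjoin|exact irreducible_prime_adjoin]. Qed.

End Gauss.
#[export] Hint Resolve horner_int : internal.

(** * Polynomial functions *)

Definition full {M : set_structure} {HM : ZF M} (R : ring M) : sub R := Sub (fun _ => True) ltac:(int).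

(** Every nonzero element is a product of units and primes, expressed without finite sequences. *)
Definition prime_generated {M : set_structure} {HM : ZF M} (R : ring M) : Prop :=
  forall Z : sub R, Z (r1 R) ->
    (forall u z, unit_in (full R) u -> Z z -> Z (rmul R u z)) ->
    (forall p z, prime_or_unit (full R) p -> p <> r0 R -> Z z -> Z (rmul R p z)) ->
    forall a, a <> r0 R -> Z a.

Section Polynomials.
Context {M : set_structure} {HM : ZF M} (K : ring M) (V : itype M).
Local Notation "0" := (r0 K).
Local Notation "1" := (r1 K).
Local Infix "+" := (radd K).
Local Infix "*" := (rmul K).
Local Notation "- x" := (ropp K x).
Local Notation "a - b" := (a + - b).
Add Ring K_ring : (rth K).

Local Notation Val := (fnI V K).
Local Notation FF := (fnI Val K).

Definition fcst (c : K) : FF := Fn (fun _ : Val => c) ltac:(int).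
Definition fvar (y : V) : FF := Fn (fun v : Val => v y) ltac:(int).
Definition fadd (f g : FF) : FF := Fn (fun v : Val => f v + g v) ltac:(int).
Definition fmul (f g : FF) : FF := Fn (fun v : Val => f v * g v) ltac:(int).

Lemma fcst_int : intf fcst. Proof. unfold fcst; int. Qed.
Lemma fvar_int : intf fvar. Proof. unfold fvar; int. Qed.
Lemma fadd_int : intf2 fadd. Proof. unfold fadd; int. Qed.
Lemma fmul_int : intf2 fmul. Proof. unfold fmul; int. Qed.
Hint Resolve fcst_int fvar_int fadd_int fmul_int : internal.

Definition poly_closed (G : sub FF) : Prop :=
  (forall c, G (fcst c)) /\ (forall y, G (fvar y)) /\
  (forall f g, G f -> G g -> G (fadd f g)) /\ (forall f g, G f -> G g -> G (fmul f g)).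

Definition polynomial (f : FF) : Prop := forall G : sub FF, poly_closed G -> G f.

Lemma polynomial_int : intp polynomial.
Proof. unfold polynomial, poly_closed; int. Qed.

Definition polyI : itype M := sigI FF polynomial polynomial_int.

Definition pev (f : polyI) (v : Val) : K := fapp _ _ (proj1_sig f) v.

Lemma pev_int : intf2 pev.
Proof. unfold pev; int. Qed.
Hint Resolve pev_int : internal.

Lemma poly_ext (f g : polyI) : (forall v, pev f v = pev g v) -> f = g.
Proof. intros H; apply sig_inj, fn_ext; exact H. Qed.

Lemma polynomial_cst c : polynomial (fcst c).
Proof. intros G HG; apply HG. Qed.

Lemma polynomial_var y : polynomial (fvar y).
Proof. intros G HG; apply HG. Qed.

Lemma polynomial_add f g : polynomial f -> polynomial g -> polynomial (fadd f g).
Proof. intros Hf Hg G HG; apply HG; auto. Qed.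

Lemma polynomial_mul f g : polynomial f -> polynomial g -> polynomial (fmul f g).
Proof. intros Hf Hg G HG; apply HG; auto. Qed.

Definition pcst (c : K) : polyI := exist polynomial (fcst c) (polynomial_cst c).
Definition pvar (y : V) : polyI := exist polynomial (fvar y) (polynomial_var y).
Definition padd (f g : polyI) : polyI :=
  exist polynomial (fadd (proj1_sig f) (proj1_sig g))
    (polynomial_add _ _ (proj2_sig f) (proj2_sig g)).
Definition pmul (f g : polyI) : polyI :=
  exist polynomial (fmul (proj1_sig f) (proj1_sig g))
    (polynomial_mul _ _ (proj2_sig f) (proj2_sig g)).
Definition popp (f : polyI) : polyI := pmul (pcst (- (1))) f.

Lemma pcst_int : intf pcst. Proof. unfold pcst; int. Qed.
Lemma pvar_int : intf pvar. Proof. unfold pvar; int. Qed.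
Lemma padd_int : intf2 padd. Proof. unfold padd; int. Qed.
Lemma pmul_int : intf2 pmul. Proof. unfold pmul; int. Qed.
Hint Resolve pcst_int pvar_int padd_int pmul_int : internal.
Lemma popp_int : intf popp. Proof. unfold popp; int. Qed.

Lemma pev_add f g v : pev (padd f g) v = pev f v + pev g v.
Proof. reflexivity. Qed.

Lemma pev_mul f g v : pev (pmul f g) v = pev f v * pev g v.
Proof. reflexivity. Qed.

Lemma pev_cst c v : pev (pcst c) v = c.
Proof. reflexivity. Qed.

Lemma pev_opp f v : pev (popp f) v = - pev f v.
Proof. unfold popp; rewrite pev_mul, pev_cst; ring. Qed.

Ltac poly_ring_tac :=
  apply poly_ext; intros; 
  rewrite ?pev_opp, ?pev_add, ?pev_mul, ?pev_cst, ?pev_opp, ?pev_add, ?pev_mul, ?pev_cst; ring.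

Lemma poly_ring_theory :
  ring_theory (pcst 0) (pcst 1) padd pmul (fun f g => padd f (popp g)) popp eq.
Proof. split; intros; poly_ring_tac. Qed.

Definition poly : ring M :=
  Ring _ _ polyI (pcst 0) (pcst 1) padd pmul popp poly_ring_theory padd_int pmul_int popp_int.

Add Ring poly_ring : (rth poly).

Lemma poly_ind (P : poly -> Prop) : intp P ->
  (forall c, P (pcst c)) -> (forall y, P (pvar y)) ->
  (forall f g, P f -> P g -> P (padd f g)) -> (forall f g, P f -> P g -> P (pmul f g)) ->
  forall f, P f.
Proof.
  intros HP Hc Hv Ha Hm f.
  assert (Hi : intp (fun f0 : FF => exists f : polyI, proj1_sig f = f0 /\ P f)) by int.
  destruct (proj2_sig f (Sub _ Hi)) as (g & E & Hg).
  - split; [intros c; exists (pcst c); auto|]; split; [intros y; exists (pvar y); auto|].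
    split; intros f1 f2 (g1 & <- & H1) (g2 & <- & H2); [exists (padd g1 g2)|exists (pmul g1 g2)]; auto.
  - apply sig_inj in E; subst g; exact Hg.
Qed.

Definition mix_fun (W : sub V) (c : K) (v : Val) (y : V) : K :=
  if excluded_middle_informative (W y) then v y else c.

Lemma mix_fun_int W c : intf2 (mix_fun W c).
Proof.
  apply (intf_graph (prodI Val V) K (fun p u =>
    W (snd p) /\ u = (fst p) (snd p) \/ ~ W (snd p) /\ u = c)); [|int].
  intros [v y] u; unfold mix_fun; simpl; destruct excluded_middle_informative; tauto.
Qed.

Lemma mix_fun_int1 W c v : intf (mix_fun W c v).
Proof. assert (H := mix_fun_int W c); int. Qed.

Definition mix (W : sub V) (c : K) (v : Val) : Val := Fn (mix_fun W c v) (mix_fun_int1 W c v).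

Lemma mix_int W c : intf (mix W c).
Proof. unfold mix; assert (H := mix_fun_int W c); int. Qed.
Hint Resolve mix_int : internal.

Lemma mix_in (W : sub V) c v y : W y -> mix W c v y = v y.
Proof. simpl; unfold mix_fun; destruct excluded_middle_informative; tauto. Qed.

Lemma mix_out (W : sub V) c v y : ~ W y -> mix W c v y = c.
Proof. simpl; unfold mix_fun; destruct excluded_middle_informative; tauto. Qed.

Lemma subst_exists W c (f : poly) : exists g : poly, forall v, pev g v = pev f (mix W c v).
Proof.
  revert f; apply poly_ind; [int|..].
  - intros a; exists (pcst a); reflexivity.
  - intros y; destruct (classic (W y)) as [H|H].
    + exists (pvar y); intros v; symmetry; exact (mix_in W c v y H).
    + exists (pcst c); intros v; symmetry; exact (mix_out W c v y H).
  - intros f g [f' Hf] [g' Hg]; exists (padd f' g'); intros v; cbn.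
    change (pev f' v + pev g' v = pev f (mix W c v) + pev g (mix W c v)); congruence.
  - intros f g [f' Hf] [g' Hg]; exists (pmul f' g'); intros v; cbn.
    change (pev f' v * pev g' v = pev f (mix W c v) * pev g (mix W c v)); congruence.
Qed.

(** With [c = 0] this is the retraction onto the polynomials in the variables of [W]; with [W] the
    set of all variables but one, it evaluates that variable at [c]. As a polynomial is determined
    by its values, the pick is unique. *)
Definition psubst (W : sub V) (c : K) (f : poly) : poly :=
  proj1_sig (constructive_indefinite_description _ (subst_exists W c f)).

Lemma pev_subst W c f v : pev (psubst W c f) v = pev f (mix W c v).
Proof. unfold psubst; destruct constructive_indefinite_description; auto. Qed.

Lemma psubst_int W c : intf (psubst W c).
Proof.
  apply (intf_graph poly poly (fun f g => forall v, pev g v = pev f (mix W c v))); [|int].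
  intros f g; split; [intros ->; apply pev_subst|].
  intros H; apply poly_ext; intros v; rewrite H, pev_subst; reflexivity.
Qed.
Hint Resolve psubst_int : internal.

Lemma psubst_add W c f g : psubst W c (padd f g) = padd (psubst W c f) (psubst W c g).
Proof.
  apply poly_ext; intros v; rewrite pev_subst.
  change (pev f (mix W c v) + pev g (mix W c v) = pev (psubst W c f) v + pev (psubst W c g) v).
  rewrite !pev_subst; reflexivity.
Qed.

Lemma psubst_mul W c f g : psubst W c (pmul f g) = pmul (psubst W c f) (psubst W c g).
Proof.
  apply poly_ext; intros v; rewrite pev_subst.
  change (pev f (mix W c v) * pev g (mix W c v) = pev (psubst W c f) v * pev (psubst W c g) v).
  rewrite !pev_subst; reflexivity.
Qed.

Lemma psubst_cst W c a : psubst W c (pcst a) = pcst a.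
Proof. apply poly_ext; intros v; rewrite pev_subst; reflexivity. Qed.

Lemma psubst_var_in (W : sub V) c y : W y -> psubst W c (pvar y) = pvar y.
Proof. intros H; apply poly_ext; intros v; rewrite pev_subst; exact (mix_in W c v y H). Qed.

Lemma psubst_var_out (W : sub V) c y : ~ W y -> psubst W c (pvar y) = pcst c.
Proof. intros H; apply poly_ext; intros v; rewrite pev_subst; exact (mix_out W c v y H). Qed.

(** The polynomials in the variables of [W]: those whose value depends only on these variables. *)
Definition poly_in (W : sub V) : sub poly :=
  Sub (fun f => forall v v' : Val, (forall y, W y -> v y = v' y) -> pev f v = pev f v') ltac:(int).

Lemma poly_in_int : intf poly_in.
Proof. unfold poly_in; int. Qed.
Hint Resolve poly_in_int : internal.

Lemma poly_in_subring W : subring (poly_in W).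
Proof.
  split; simpl; try reflexivity.
  - intros f g Hf Hg v v' H; change (pev f v + pev g v = pev f v' + pev g v').
    rewrite (Hf v v' H), (Hg v v' H); reflexivity.
  - intros f g Hf Hg v v' H; change (pev f v * pev g v = pev f v' * pev g v').
    rewrite (Hf v v' H), (Hg v v' H); reflexivity.
  - intros f Hf v v' H; change (- (1) * pev f v = - (1) * pev f v').
    rewrite (Hf v v' H); reflexivity.
Qed.

Lemma poly_in_mono (W W' : sub V) f : (forall y, W y -> W' y) -> poly_in W f -> poly_in W' f.
Proof. intros H Hf v v' E; apply Hf; auto. Qed.

Lemma poly_in_cst W c : poly_in W (pcst c).
Proof. intros v v' _; reflexivity. Qed.

Lemma poly_in_var (W : sub V) y : W y -> poly_in W (pvar y).
Proof. intros H v v' E; exact (E y H). Qed.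

Lemma psubst_in W f : poly_in W (psubst W 0 f).
Proof.
  intros v v' H; rewrite !pev_subst; f_equal; apply fn_ext; intros y.
  destruct (classic (W y)) as [Hy|Hy]; [rewrite !mix_in by exact Hy; auto|rewrite !mix_out; auto].
Qed.

Lemma psubst_id W c f : poly_in W f -> psubst W c f = f.
Proof.
  intros H; apply poly_ext; intros v; rewrite pev_subst; apply H.
  intros y Hy; apply mix_in, Hy.
Qed.

Lemma poly_finite_support f : exists W, finite W /\ poly_in W f.
Proof.
  revert f; apply poly_ind; [int|..].
  - intros c; exists (sempty V); split; [apply finite_empty|apply poly_in_cst].
  - intros y; exists (sadd (sempty V) y); split; [apply finite_add, finite_empty|].
    apply poly_in_var; simpl; auto.
  - intros f g (W & HW & Hf) (W' & HW' & Hg); exists (sunion W W'); split; [apply finite_union; auto|].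
    apply (sub_add _ (poly_in_subring _)); [apply (poly_in_mono W)|apply (poly_in_mono W')]; simpl; auto.
  - intros f g (W & HW & Hf) (W' & HW' & Hg); exists (sunion W W'); split; [apply finite_union; auto|].
    apply (sub_mul _ (poly_in_subring _)); [apply (poly_in_mono W)|apply (poly_in_mono W')]; simpl; auto.
Qed.

Context (K_field : forall a : K, a <> 0 -> exists b, a * b = 1) (K_one : 1 <> 0).
Context (K_infinite : forall S : sub K, finite S -> exists c, ~ S c).

Lemma K_integral a b : a * b = 0 -> a = 0 \/ b = 0.
Proof.
  intros H; destruct (classic (a = 0)) as [Ha|Ha]; [auto|right].
  destruct (K_field a Ha) as [a' Ea]; transitivity (a * a' * b); [rewrite Ea; ring|].
  transitivity (a' * (a * b)); [ring|rewrite H; ring].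
Qed.

(** * Adjoining one variable *)

Section AdjoinVariable.
Context (W : sub V) (x : V) (Hx : ~ W x).

Local Notation X := (pvar x).
Local Notation E := (horner (R := poly) (poly_in W) X).
Local Notation C := (adjoin (R := poly) (poly_in W) X).

Definition others : sub V := Sub (fun y => y <> x) ltac:(int).

Lemma mix_others_base b c v : poly_in W b -> pev b (mix others c v) = pev b v.
Proof.
  intros H; apply H; intros y Hy; apply mix_in; intros ->; contradiction.
Qed.

Lemma mix_others_x c v : mix others c v x = c.
Proof. apply mix_out; intros H; apply H; reflexivity. Qed.

Lemma remainder_theorem c n f : E (suc n) f ->
  exists g, E n g /\ f = radd poly (psubst others c f) (rmul poly (radd poly X (ropp poly (pcst c))) g).
Proof.
  assert (HB := poly_in_subring W).
  assert (Hb : forall b, poly_in W b -> psubst others c b = b).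
  { intros b H; apply psubst_id; apply (poly_in_mono W); [|exact H]; intros y Hy ->; contradiction. }
  revert f; nat_ind n.
  - intros f Hf; exists (pcst 0); split; [apply (horner_zero _ HB)|].
    apply (horner_base _ HB) in Hf; rewrite (Hb f Hf); change (pcst 0) with (r0 poly); ring.
  - intros n IH f Hf; apply horner_S in Hf as (b & g & Bb & Hg & ->).
    destruct (IH g Hg) as (g' & Hg' & Eg).
    (* From [f = b + x g] and [g = g(c) + (x - c) g'] one gets [f - f(c) = x g - c g(c) = (x - c) (g
       + c g')]. *)
    exists (radd poly g (rmul poly (pcst c) g')); split.
    + apply (horner_add _ HB); [exact Hg|]; apply (horner_mono1 _ HB), (horner_scale _ HB);
        [apply poly_in_cst|exact Hg'].
    + change (radd poly) with padd in *; change (rmul poly) with pmul in *.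
      rewrite psubst_add, psubst_mul, (Hb b Bb), psubst_var_out by (intros H; apply H; reflexivity).
      change padd with (radd poly) in *; change pmul with (rmul poly) in *.
      set (s := psubst others c g) in *; clearbody s; set (k := pcst c) in *; clearbody k.
      rewrite Eg; ring.
Qed.

(** The finite exceptional set [S] grows along the induction. As [K] is infinite, some [c] outside
    [S] is a root, so [f = (x - c) g], and [g] vanishes wherever [x] avoids [S] and [c]. *)
Lemma horner_roots n f : E n f -> forall S : sub K, finite S ->
  (forall v : Val, ~ S (v x) -> pev f v = 0) -> f = r0 poly.
Proof.
  revert f; nat_ind n; [intros f Hf _ _ _; apply horner_0 in Hf; exact Hf|].
  intros n IH f Hf S HS Hv.
  destruct (K_infinite S HS) as [c Hc].
  destruct (remainder_theorem c n f Hf) as (g & Hg & Eg).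
  assert (E0 : psubst others c f = r0 poly).
  { apply poly_ext; intros v; rewrite pev_subst; apply Hv; rewrite mix_others_x; exact Hc. }
  rewrite E0 in Eg.
  assert (Hg0 : g = r0 poly).
  { apply (IH g Hg (sadd S c)); [apply finite_add, HS|].
    intros v Hn.
    assert (H1 : pev f v = 0) by (apply Hv; intros H; apply Hn; left; exact H).
    rewrite Eg in H1; change (0 + (v x + - (1) * c) * pev g v = 0) in H1.
    destruct (K_integral (v x - c) (pev g v)) as [H|H]; [rewrite <- H1; ring| |exact H].
    destruct Hn; right; transitivity (v x - c + c); [ring|rewrite H; ring]. }
  rewrite Eg, Hg0; ring.
Qed.

(** Setting [x] to zero gives [b = 0], since [b] does not depend on [x]. Then [x f = 0], so [f]
    vanishes wherever [x] is nonzero, and [horner_roots] applies. *)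
Lemma variable_transcendental b f : poly_in W b -> C f ->
  radd poly b (rmul poly X f) = r0 poly -> b = r0 poly /\ f = r0 poly.
Proof.
  intros Hb [n Hf] H.
  assert (Hv : forall v : Val, pev b v + v x * pev f v = 0).
  { intros v; change (pev (radd poly b (rmul poly X f)) v = 0); rewrite H; reflexivity. }
  assert (Hb0 : forall v, pev b v = 0).
  { intros v; rewrite <- (mix_others_base b 0 v Hb).
    transitivity (pev b (mix others 0 v) + mix others 0 v x * pev f (mix others 0 v)); [|apply Hv].
    rewrite mix_others_x; ring. }
  split; [apply poly_ext; exact Hb0|].
  apply (horner_roots n f Hf (sadd (sempty K) 0)); [apply finite_add, finite_empty|].
  intros v Hn; destruct (K_integral (v x) (pev f v)) as [Hx0|Hf0]; [|destruct Hn; right; exact Hx0|exact Hf0].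
  transitivity (pev b v + v x * pev f v); [rewrite Hb0; ring|apply Hv].
Qed.

Lemma adjoin_variable : C = poly_in (sadd W x).
Proof.
  assert (HB := poly_in_subring W).
  assert (HC := adjoin_subring _ HB X).
  apply sub_ext; intros f; split.
  - apply adjoin_least; [apply poly_in_subring|intros b; apply poly_in_mono; simpl; auto|].
    apply poly_in_var; simpl; auto.
  (* The parts from which [f] is built may involve further variables. Replacing [f] by its
     substitution instance turns the claim into one about all polynomials, which is open to
     induction. *)
  - intros Hf; rewrite <- (psubst_id _ 0 f Hf); clear Hf; revert f; apply poly_ind; [int|..].
    + intros c; rewrite psubst_cst; apply (base_adjoin _ HB), poly_in_cst.
    + intros y; destruct (classic (sadd W x y)) as [Hy|Hy].
      * rewrite psubst_var_in by exact Hy; destruct Hy as [Hy| ->];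
          [apply (base_adjoin _ HB), poly_in_var, Hy|apply (adjoin_x _ HB)].
      * rewrite psubst_var_out by exact Hy; apply (base_adjoin _ HB), poly_in_cst.
    + intros f g Hf Hg; rewrite psubst_add; apply (sub_add _ HC); assumption.
    + intros f g Hf Hg; rewrite psubst_mul; apply (sub_mul _ HC); assumption.
Qed.

End AdjoinVariable.

Lemma poly_one_neq_zero : r1 poly <> r0 poly.
Proof.
  intros H; apply K_one; change (pev (r1 poly) (Fn (fun _ => 0) (intf_const V K 0)) = 0).
  rewrite H; reflexivity.
Qed.

Lemma sadd_in (W : sub V) x : W x -> sadd W x = W.
Proof. intros H; apply sub_ext; intros y; simpl; split; [intros [Hy| ->]; auto|auto]. Qed.

(** Induction on the finite set [W] requires this; the record is unfolded into a conjunction for the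
    sake of the tactics. *)
Lemma poly_in_factorial_int : intp (fun W => factorial (poly_in W)).
Proof.
  apply (intp_ext _ _ (fun W => integral (poly_in W) /\ wf_division (poly_in W) /\
    forall p, irreducible (poly_in W) p -> prime_or_unit (poly_in W) p)).
  - intros W; split; [intros [H1 H2 H3]; auto|intros (H1 & H2 & H3); split; auto].
  - unfold integral, wf_division, irreducible, prime_or_unit, unit_in, divides; int.
Qed.

Lemma poly_in_empty f : poly_in (sempty V) f -> exists c, f = pcst c.
Proof.
  intros H; set (v0 := Fn (fun _ => 0) (intf_const V K 0) : Val); exists (pev f v0).
  apply poly_ext; intros v; apply H; intros y [].
Qed.

Lemma factorial_poly_in W : finite W -> factorial (poly_in W).
Proof.
  revert W; apply (finite_ind V (fun W => factorial (poly_in W)) poly_in_factorial_int).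
  - assert (U : forall f, poly_in (sempty V) f -> f <> r0 poly -> unit_in (poly_in (sempty V)) f).
    { intros f Hf H0; split; [exact Hf|].
      destruct (poly_in_empty f Hf) as [c ->].
      destruct (K_field c) as [d Hd]; [intros ->; apply H0; reflexivity|].
      exists (pcst d); split; [apply poly_in_cst|].
      apply poly_ext; intros v; symmetry; exact Hd. }
    split.
    + intros f g Hf Hg H; destruct (poly_in_empty f Hf) as [a ->], (poly_in_empty g Hg) as [b ->].
      destruct (K_integral a b) as [-> | ->]; auto.
      change (pev (rmul poly (pcst a) (pcst b)) (Fn (fun _ => 0) (intf_const V K 0)) = 0).
      rewrite H; reflexivity.
    + intros Y (f & Yf & Hf & H0); exists f; split; [auto|].
      intros g h Yg Hg Hh Eq; apply U; [exact Hh|]; intros ->; apply H0; rewrite Eq.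
      apply poly_ext; intros v; change (pev g v * 0 = 0); ring.
    + intros p (Hp & H0 & Hu & _); destruct Hu; auto.
  - intros W x _ IH; destruct (classic (W x)) as [Hx|Hx]; [rewrite sadd_in; assumption|].
    rewrite <- adjoin_variable by exact Hx.
    apply factorial_adjoin; [apply poly_in_subring|apply variable_transcendental; exact Hx|exact IH|].
    exact poly_one_neq_zero.
Qed.

Lemma prime_poly_in_union W W' p : finite W -> finite W' ->
  prime_or_unit (poly_in W) p -> prime_or_unit (poly_in (sunion W W')) p.
Proof.
  intros HW HW' Hp; revert W' HW'.
  apply (finite_ind V (fun W' => prime_or_unit (poly_in (sunion W W')) p)).
  - unfold prime_or_unit, divides; int.
  - rewrite sunion_sempty; exact Hp.
  - intros W' x _ IH; rewrite sunion_sadd.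
    destruct (classic (sunion W W' x)) as [Hx|Hx]; [rewrite sadd_in; assumption|].
    rewrite <- adjoin_variable by exact Hx.
    apply prime_adjoin; [apply poly_in_subring|apply variable_transcendental; exact Hx|exact IH].
Qed.

(** The two factors involve finitely many variables, and adjoining these to [W] one at a time keeps
    [p] prime by [prime_adjoin]. *)
Lemma prime_poly W p : finite W -> prime_or_unit (poly_in W) p -> prime_or_unit (full poly) p.
Proof.
  intros HW Hp; split; [exact I|]; intros g h _ _ (c & _ & Eq).
  destruct (poly_finite_support g) as (U & HU & Hg), (poly_finite_support h) as (U' & HU' & Hh).
  set (Y := sunion W (sunion U U')).
  assert (HpY := prime_poly_in_union W (sunion U U') p HW (finite_union _ _ _ HU HU') Hp); fold Y in HpY.
  assert (HgY : poly_in Y g) by (revert Hg; apply poly_in_mono; simpl; auto).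
  assert (HhY : poly_in Y h) by (revert Hh; apply poly_in_mono; simpl; auto).
  destruct (proj2 HpY g h HgY HhY) as [(d & _ & Ed)|(d & _ & Ed)];
    [|left; exists d; split; [exact I|exact Ed]|right; exists d; split; [exact I|exact Ed]].
  (* The cofactor [c] may involve variables outside [Y]; setting them to zero leaves the other terms
     of the equation unchanged. *)
  exists (psubst Y 0 c); split; [apply psubst_in|].
  rewrite <- (psubst_id Y 0 (rmul poly g h)), Eq by (apply (sub_mul _ (poly_in_subring Y)); assumption).
  change (psubst Y 0 (pmul p c) = pmul p (psubst Y 0 c)); rewrite psubst_mul, (psubst_id Y 0 p); auto.
  apply HpY.
Qed.

Lemma poly_integral : integral (full poly).
Proof.
  intros f g _ _ H.
  destruct (poly_finite_support f) as (U & HU & Hf), (poly_finite_support g) as (U' & HU' & Hg).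
  apply (fac_integral _ (factorial_poly_in (sunion U U') (finite_union _ _ _ HU HU'))); [..|exact H];
    [revert Hf|revert Hg]; apply poly_in_mono; simpl; auto.
Qed.

(** A counterexample lies in some factorial [poly_in W] with [W] finite. A minimal one there has an
    irreducible factor, which is prime in the whole ring by [prime_poly], and the cofactor is no
    counterexample. *)
Lemma poly_prime_generated : prime_generated poly.
Proof.
  intros Z Z1 Zu Zp f Hf0; apply NNPP; intros Hn.
  destruct (poly_finite_support f) as (W & HW & Hf).
  assert (FW := factorial_poly_in W HW).
  destruct (wf_min (poly_in W) (fun f => ~ Z f)) as (a & (Za & Ha & Ha0) & Hm).
  { int. }
  { apply FW. }
  { exists f; auto. }
  destruct (classic (unit_in (poly_in W) a)) as [(_ & b & Hb & Eb)|Hu].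
  - apply Za; replace a with (rmul poly a (r1 poly)) by ring.
    apply Zu; [|exact Z1]; split; [exact I|exists b; split; [exact I|exact Eb]].
  - destruct (irreducible_divisor _ (poly_in_subring W) a (fac_wf _ FW) Ha Ha0 Hu)
      as (r & b & Hr & Hb & ->).
    apply Za, Zp.
    + apply (prime_poly W); [exact HW|apply (fac_prime _ FW), Hr].
    + apply Hr.
    + apply NNPP; intros Zb; apply Hr, (Hm b r Zb Hb); [apply Hr|].
      ring.
Qed.

End Polynomials.
#[export] Hint Resolve pcst_int pvar_int padd_int pmul_int pev_int poly_in_int : internal.

(** * Unique factorization *)

Section Factorization.
Context {M : set_structure} {HM : ZF M} (R : ring M).
Local Notation "0" := (r0 R).
Local Notation "1" := (r1 R).
Local Infix "+" := (radd R).
Local Infix "*" := (rmul R).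
Local Notation "- x" := (ropp R x).
Local Notation "a - b" := (a + - b).
Add Ring R_ring'' : (rth R).

Local Notation A := (full R).
Local Notation unit := (unit_in A).
Local Notation irr := (irreducible A).
Local Notation seq := (fnI natI R).

Lemma irreducible_int : intp irr.
Proof. unfold irreducible; int. Qed.

Lemma prime_or_unit_int : intp (prime_or_unit A).
Proof. unfold prime_or_unit; int. Qed.
Hint Resolve irreducible_int prime_or_unit_int : internal.

Lemma full_subring : subring A.
Proof. split; simpl; auto. Qed.

(** As for addition, the recursion yields a function of the sequence, so that [seq_prod] is internal
    in both arguments. *)
Definition seq_prod_step (n : natI) (F : fn seq R) : fn seq R :=
  Fn (fun y : seq => F y * y n) ltac:(int).

Lemma seq_prod_step_int : intf2 seq_prod_step.
Proof. unfold seq_prod_step; int. Qed.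

Definition seq_prod (n : natI) (y : seq) : R :=
  rec (fnI seq R) (Fn (fun _ => 1) (intf_const seq R 1)) _ seq_prod_step_int n y.

Lemma seq_prod_int : intf2 seq_prod.
Proof. unfold seq_prod; int. Qed.
Hint Resolve seq_prod_int : internal.

Lemma seq_prod_0 y : seq_prod zero y = 1.
Proof. unfold seq_prod; rewrite rec_zero; reflexivity. Qed.

Lemma seq_prod_S n y : seq_prod (suc n) y = seq_prod n y * y n.
Proof. unfold seq_prod; rewrite rec_suc; reflexivity. Qed.

Lemma seq_prod_congr n (y z : seq) :
  (forall i, lt i n -> y i = z i) -> seq_prod n y = seq_prod n z.
Proof.
  nat_ind n; [rewrite !seq_prod_0; reflexivity|].
  intros n IH H; rewrite !seq_prod_S, IH, H; [reflexivity|apply lt_suc_diag|].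
  intros i Hi; apply H, lt_suc; auto.
Qed.

Definition upd_fun {U : itype M} (y : fn natI U) (n : natI) (p : U) (i : natI) : U :=
  if excluded_middle_informative (i = n) then p else y i.

Lemma upd_int (U : itype M) (y : fn natI U) n p : intf (upd_fun y n p).
Proof.
  apply (intf_graph natI U (fun i u => i = n /\ u = p \/ i <> n /\ u = y i)); [|int].
  intros i u; unfold upd_fun; destruct excluded_middle_informative; tauto.
Qed.

Definition upd {U : itype M} (y : fn natI U) (n : natI) (p : U) : fn natI U :=
  Fn (upd_fun y n p) (upd_int U y n p).

Lemma upd_same (U : itype M) (y : fn natI U) n p : upd y n p n = p.
Proof. simpl; unfold upd_fun; destruct excluded_middle_informative; tauto. Qed.

Lemma upd_other (U : itype M) (y : fn natI U) n p i : i <> n -> upd y n p i = y i.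
Proof. simpl; unfold upd_fun; destruct excluded_middle_informative; tauto. Qed.

Lemma lt_neq (i n : natI) : lt i n -> i <> n.
Proof. intros H ->; exact (lt_irrefl _ H). Qed.

Definition swap (j k : natI) : fn natI natI := upd (upd (Fn (fun i => i) (intf_id natI)) j k) k j.

Lemma swap_r j k : swap j k k = j.
Proof. apply upd_same. Qed.

Lemma swap_l j k : swap j k j = k.
Proof.
  destruct (classic (j = k)) as [->|H]; [apply swap_r|].
  unfold swap; rewrite upd_other, upd_same; auto.
Qed.

Lemma swap_other j k i : i <> j -> i <> k -> swap j k i = i.
Proof. intros H H'; unfold swap; rewrite !upd_other; auto. Qed.

Lemma swapK j k i : swap j k (swap j k i) = i.
Proof.
  destruct (classic (i = j)) as [->|Hj]; [rewrite swap_l; apply swap_r|].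
  destruct (classic (i = k)) as [->|Hk]; [rewrite swap_r; apply swap_l|].
  rewrite (swap_other j k i), swap_other; auto.
Qed.

Lemma swap_lt j k i n : lt j n -> lt k n -> lt i n -> lt (swap j k i) n.
Proof.
  intros Lj Lk Li.
  destruct (classic (i = j)) as [->|Hj]; [rewrite swap_l; exact Lk|].
  destruct (classic (i = k)) as [->|Hk]; [rewrite swap_r; exact Lj|].
  rewrite swap_other; auto.
Qed.

Definition fcomp {T : itype M} (y : fn natI T) (s : fn natI natI) : fn natI T :=
  Fn (fun i => y (s i)) ltac:(int).

Lemma seq_prod_swap m (z : seq) j : lt j (suc m) ->
  seq_prod (suc m) z = seq_prod m (fcomp z (swap j m)) * z j.
Proof.
  intros Hj; rewrite seq_prod_S; apply lt_suc in Hj as [Hj| ->].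
  2:{ f_equal; apply seq_prod_congr; intros i Hi; simpl.
      change (z i = z (swap m m i)); rewrite swap_other; auto using lt_neq. }
  set (z' := fcomp z (swap j m)).
  assert (Hz : forall i, i <> j -> i <> m -> z' i = z i).
  { intros i H1 H2; change (z (swap j m i) = z i); rewrite swap_other; auto. }
  assert (Hzj : z' j = z m) by (change (z (swap j m j) = z m); rewrite swap_l; reflexivity).
  (* Once [i] has passed [j], the prefix of [z'] contains the factor [z m] in place of [z j]. *)
  cut (forall i, lt j i -> lt i (suc m) -> seq_prod i z' * z j = seq_prod i z * z m).
  { intros K; symmetry; apply K; [exact Hj|apply lt_suc_diag]. }
  clearbody z'; intros i; nat_ind i; [intros H; destruct (lt_zero _ H)|].
  intros i IH Hji Him; rewrite !seq_prod_S.
  assert (Li : lt i m).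
  { apply lt_suc in Him as [Him| Him]; [exact (lt_trans _ _ _ (lt_suc_diag i) Him)|].
    rewrite <- Him; apply lt_suc_diag. }
  apply lt_suc in Hji as [Hji|<-].
  - rewrite (Hz i); [|intros ->; exact (lt_irrefl _ Hji)|apply lt_neq, Li].
    transitivity (seq_prod i z' * z j * z i); [ring|rewrite IH; [ring|exact Hji|apply lt_suc; auto]].
  - rewrite Hzj, (seq_prod_congr j z' z); [ring|].
    intros k Hk; apply Hz; [apply lt_neq, Hk|apply lt_neq; exact (lt_trans _ _ _ Hk Hj)].
Qed.

Context (HI : integral A) (one_neq_zero : 1 <> 0) (HP : prime_generated R).

Lemma unit_1 : unit 1.
Proof. split; [exact I|exists 1; split; [exact I|ring]]. Qed.

(** Being a unit or divisible by a non-unit prime is preserved by the generating operations of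
    [prime_generated], hence holds for [p]. An irreducible element divisible by a non-unit prime is
    that prime times a unit. *)
Lemma irreducible_prime p : irr p -> prime_or_unit A p.
Proof.
  intros Hp.
  assert (Hi : intp (fun a => unit a \/ exists q, prime_or_unit A q /\ ~ unit q /\ divides A q a)) by int.
  destruct (HP (Sub _ Hi)) with (a := p) as [Hu|(q & Hq & Hqu & (b & _ & Eb))]; simpl.
  - left; exact unit_1.
  - intros u z Hu [Hz|(q & Hq & Hqu & Hd)].
    + left; apply unit_mul; auto; exact full_subring.
    + right; exists q; split; [|split]; auto; apply divides_mull; auto; [exact full_subring|exact I].
  - intros q z Hq _ [Hz|(q' & Hq' & Hqu & Hd)].
    + destruct (classic (unit q)) as [Hu|Hu]; [left; apply unit_mul; auto; exact full_subring|].
      right; exists q; split; [|split]; auto; exists z; split; [exact I|reflexivity].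
    + right; exists q'; split; [|split]; auto; apply divides_mull; auto; [exact full_subring|exact I].
  - apply Hp.
  - destruct Hp as (_ & _ & Hn & _); contradiction.
  - destruct Hp as (_ & _ & _ & Hpi); destruct (Hpi q b I I Eb) as [U|U]; [contradiction|].
    rewrite Eb; apply prime_or_unit_mul_unit; auto; exact full_subring.
Qed.

Lemma prime_irreducible p : prime_or_unit A p -> p <> 0 -> ~ unit p -> irr p.
Proof.
  intros [_ Hp] H0 Hu; split; [exact I|]; split; [exact H0|]; split; [exact Hu|].
  assert (K : forall a b, p = a * b -> divides A p a -> unit b).
  { intros a b E (c & _ & Ec); split; [exact I|]; exists c; split; [exact I|].
    apply (mul_cancel_l A full_subring p); try exact I; [exact HI|exact H0|].
    transitivity p; [ring|rewrite E at 1; rewrite Ec; ring]. }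
  intros a b _ _ E; destruct (Hp a b I I) as [H|H].
  - exists 1; split; [exact I|rewrite <- E; ring].
  - right; exact (K a b E H).
  - left; apply (K b a); [rewrite E; ring|exact H].
Qed.

Definition irr_seq (n : natI) (y : seq) : Prop := forall i, lt i n -> irr (y i).

Lemma irr_seq_int : intp2 irr_seq.
Proof. unfold irr_seq; int. Qed.
Hint Resolve irr_seq_int : internal.

Lemma irr_mul_unit u p : unit u -> irr p -> irr (u * p).
Proof.
  intros Hu Hp; apply prime_irreducible.
  - replace (u * p) with (p * u) by ring.
    apply prime_or_unit_mul_unit; [exact full_subring|exact Hu|apply irreducible_prime, Hp].
  - intros H; destruct (HI u p I I H) as [-> |E]; [|apply Hp in E; exact E].
    destruct Hu as (_ & v & _ & Ev); apply one_neq_zero; rewrite Ev; ring.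
  - intros U; apply Hp; apply (unit_dvd A full_subring p u); try exact I.
    replace (p * u) with (u * p) by ring; exact U.
Qed.

Lemma factorization_exists a : a <> 0 -> ~ unit a -> exists n y, irr_seq n y /\ seq_prod n y = a.
Proof.
  intros H0 Hu.
  assert (Hi : intp (fun a => unit a \/ exists n y, irr_seq n y /\ seq_prod n y = a)) by int.
  (* A unit is absorbed into the last irreducible factor. The empty product has none, but multiplied
     by a unit it is a unit. *)
  assert (Ku : forall u z, unit u -> (unit z \/ exists n y, irr_seq n y /\ seq_prod n y = z) ->
    unit (u * z) \/ exists n y, irr_seq n y /\ seq_prod n y = u * z).
  { intros u z Uu [Uz|(n & y & Hy & <-)]; [left; apply unit_mul; auto; exact full_subring|].
    destruct (zero_or_suc n) as [-> |[m ->]].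
    { left; rewrite seq_prod_0; apply unit_mul; [exact full_subring|exact Uu|exact unit_1]. }
    right; exists (suc m), (upd y m (u * y m)); split.
    - intros i Hi'; destruct (classic (i = m)) as [-> |Hn].
      + rewrite upd_same; apply irr_mul_unit; [exact Uu|apply Hy, Hi'].
      + rewrite upd_other by exact Hn; apply Hy, Hi'.
    - rewrite !seq_prod_S, upd_same, (seq_prod_congr m _ y); [ring|].
      intros i Li; apply upd_other, lt_neq, Li. }
  destruct (HP (Sub _ Hi)) with (a := a) as [U|H]; simpl; [left; exact unit_1|exact Ku| |exact H0|contradiction|exact H].
  intros p z Hp Hp0 Hz.
  destruct (classic (unit p)) as [Up|Up]; [apply Ku; assumption|right].
  assert (Ip := prime_irreducible p Hp Hp0 Up).
  destruct Hz as [Uz|(n & y & Hy & <-)].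
  - exists (suc zero), (Fn (fun _ => z * p) (intf_const natI R (z * p))); split.
    + intros i _; simpl; apply irr_mul_unit; assumption.
    + rewrite seq_prod_S, seq_prod_0; simpl; ring.
  - exists (suc n), (upd y n p); split.
    + intros i Li; destruct (classic (i = n)) as [-> |Hn]; [rewrite upd_same; exact Ip|].
      rewrite upd_other by exact Hn; apply Hy; apply lt_suc in Li as [Li|Li]; [exact Li|contradiction].
    + rewrite seq_prod_S, upd_same, (seq_prod_congr n _ y); [ring|].
      intros i Li; apply upd_other, lt_neq, Li.
Qed.

Lemma prime_divides_product p m (z : seq) : prime_or_unit A p -> ~ unit p ->
  divides A p (seq_prod m z) -> exists j, lt j m /\ divides A p (z j).
Proof.
  intros [_ Hp] Hu; nat_ind m.
  - rewrite seq_prod_0; intros H; destruct Hu; split; [exact I|exact H].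
  - intros m IH; rewrite seq_prod_S; intros H; destruct (Hp _ _ I I H) as [Hd|Hd].
    + destruct (IH Hd) as (j & Lj & Hj); exists j; split; [apply lt_suc; auto|exact Hj].
    + exists m; split; [apply lt_suc_diag|exact Hd].
Qed.

Definition assoc (a b : R) : Prop := exists u, unit u /\ b = u * a.

Lemma assoc_int : intp2 assoc.
Proof. unfold assoc; int. Qed.
Hint Resolve assoc_int : internal.

(** The inverse [t] is carried along, so that the inductive step composes explicit maps and never
    inverts one. *)
Definition matching (n m : natI) (y z : seq) (s t : fn natI natI) : Prop :=
  (forall i, lt i n -> lt (s i) m /\ t (s i) = i /\ assoc (y i) (z (s i))) /\
  (forall j, lt j m -> lt (t j) n /\ s (t j) = j).

(** The unit [u] makes the induction possible: the last factor [p] of [y] divides some [z j], and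
    after cancelling [p] the unit [w] with [z j = p w] remains and joins [u]. *)
Lemma factorization_unique n m (y z : seq) u : unit u -> irr_seq n y -> irr_seq m z ->
  seq_prod n y = u * seq_prod m z -> n = m /\ exists s t, matching n m y z s t.
Proof.
  unfold matching; revert m y z u; nat_ind n.
  - intros m y z u _ _ Hz E; destruct (zero_or_suc m) as [-> |[k ->]].
    + split; [reflexivity|]; exists (Fn (fun i => i) (intf_id natI)), (Fn (fun i => i) (intf_id natI)).
      split; intros i Hi; destruct (lt_zero _ Hi).
    + destruct (Hz k (lt_suc_diag k)) as (_ & _ & Hn & _); destruct Hn.
      split; [exact I|]; exists (u * seq_prod k z); split; [exact I|].
      rewrite <- (seq_prod_0 y), E, seq_prod_S; ring.
  - intros n IH m y z u Hu Hy Hz E.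
    set (p := y n) in *.
    assert (Ip : irr p) by (apply Hy, lt_suc_diag).
    assert (Pp := irreducible_prime p Ip).
    assert (Up : ~ unit p) by apply Ip.
    rewrite seq_prod_S in E; fold p in E.
    assert (Hd : divides A p (seq_prod m z)).
    { destruct (proj2 Pp u (seq_prod m z) I I) as [(c & _ & Ec)|H]; [..|exact H].
      - exists (seq_prod n y); split; [exact I|rewrite <- E; ring].
      - destruct Up; apply (unit_dvd A full_subring p c); try exact I; rewrite <- Ec; exact Hu. }
    destruct (prime_divides_product p m z Pp Up Hd) as (j & Lj & (w & _ & Ew)).
    destruct (zero_or_suc m) as [-> |[k ->]]; [destruct (lt_zero _ Lj)|].
    assert (Uw : unit w).
    { destruct (Hz j Lj) as (_ & _ & _ & H); destruct (H p w I I Ew) as [U|U]; [contradiction|exact U]. }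
    assert (Lk := lt_suc_diag k).
    rewrite (seq_prod_swap k z j Lj), Ew in E.
    set (th := swap j k) in *.
    destruct (IH k y (fcomp z th) (u * w)) as (-> & s & t & Hs & Ht).
    + apply unit_mul; auto; exact full_subring.
    + intros i Li; apply Hy, lt_suc; auto.
    + intros i Li; apply (Hz (th i)), swap_lt; auto; apply lt_suc; auto.
    + apply (mul_cancel_l A full_subring p); try exact I; [exact HI|apply Ip|].
      transitivity (seq_prod n y * p); [ring|rewrite E; ring].
    + split; [reflexivity|].
      (* The induction hypothesis matches [y] with [z] after exchanging the positions [j] and [k].
         So [s] is extended by sending [k] to [k], and the exchange [th] is applied afterwards. *)
      exists (Fn (fun i => th (upd s k k i)) ltac:(int)), (Fn (fun i => upd t k k (th i)) ltac:(int)).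
      cbn [fapp]; split.
      * intros i Li; change (lt (th (upd s k k i)) (suc k) /\ upd t k k (th (th (upd s k k i))) = i /\
          assoc (y i) (z (th (upd s k k i)))); unfold th at 2 3; rewrite swapK.
        apply lt_suc in Li as [Li| ->].
        -- destruct (Hs i Li) as (L1 & E1 & A1); rewrite !(upd_other _ s) by (apply lt_neq, Li).
           rewrite upd_other by (apply lt_neq, L1).
           split; [apply swap_lt; auto; apply lt_suc; auto|]; split; [exact E1|exact A1].
        -- rewrite (upd_same _ s), upd_same; unfold th; rewrite swap_r.
           split; [exact Lj|]; split; [reflexivity|].
           exists w; split; [exact Uw|]; rewrite Ew; unfold p; ring.
      * intros i Li; change (lt (upd t k k (th i)) (suc k) /\ th (upd s k k (upd t k k (th i))) = i).
        assert (Lth : lt (th i) (suc k)) by (apply swap_lt; auto).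
        apply lt_suc in Lth as [Lth|Eth].
        -- destruct (Ht _ Lth) as (L1 & E1).
           rewrite (upd_other _ t) by (apply lt_neq, Lth).
           rewrite upd_other by (apply lt_neq, L1); rewrite E1.
           split; [apply lt_suc; auto|apply swapK].
        -- rewrite Eth, (upd_same _ t), upd_same; split; [exact Lk|].
           rewrite <- Eth; apply swapK.
Qed.

End Factorization.

(** * Rings as objects of the model *)

Section Translation.
Context {M : set_structure} {HM : ZF M}.
Local Notation IT := (itype M).

Lemma maps_code (T U : IT) (S : sub (prodI T U)) x y :
  maps (code S) x y <-> exists t u, x = code t /\ y = code u /\ S (t, u).
Proof.
  unfold maps; split.
  - intros (p & Hp & Hin); apply is_opairE in Hp; subst p.
    apply sub_codeP in Hin as ([t u] & HS & E); apply opair_inj in E as [<- <-]; eauto.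
  - intros (t & u & -> & -> & HS); exists (opair (code t) (code u)); split; [apply is_opairE; reflexivity|].
    apply (sub_code_in _ S (t, u)), HS.
Qed.

Lemma maps_code_in (T U : IT) (S : sub (prodI T U)) (t : T) (u : U) :
  maps (code S) (code t) (code u) <-> S (t, u).
Proof.
  rewrite maps_code; split; [|eauto 6].
  intros (t' & u' & E & E' & HS); apply code_inj in E, E'; congruence.
Qed.

Lemma is_function_code (T U : IT) (S : sub (prodI T U)) (a b : M) :
  (forall t u, S (t, u) -> code t ∈ a /\ code u ∈ b) ->
  (forall x, x ∈ a -> exists t : T, code t = x /\ exists u, S (t, u) /\ forall u', S (t, u') -> u = u') ->
  is_function (code S) a b.
Proof.
  intros H1 H2; split.
  - intros p Hp; apply sub_codeP in Hp as ([t u] & HS & <-).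
    exists (code t), (code u); split; [apply (H1 _ _ HS)|split; [apply (H1 _ _ HS)|apply is_opairE; reflexivity]].
  - intros x Hx; destruct (H2 x Hx) as (t & <- & u & HS & Hu); exists (code u); split.
    + apply maps_code_in, HS.
    + intros y Hy; apply maps_code in Hy as (t' & u' & E & -> & HS'); apply code_inj in E; subst t'.
      rewrite (Hu u' HS'); reflexivity.
Qed.

Definition op_graph {T : IT} (F : T -> T -> T) (HF : intf2 F) : sub (prodI (prodI T T) T) :=
  Sub (fun p => snd p = F (fst (fst p)) (snd (fst p))) ltac:(int).

Lemma op_code (T : IT) (F : T -> T -> T) (HF : intf2 F) x y z :
  op (code (op_graph F HF)) x y z <-> exists a b : T, x = code a /\ y = code b /\ z = code (F a b).
Proof.
  unfold op; split.
  - intros (p & Hp & Hm); apply is_opairE in Hp; subst p.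
    apply maps_code in Hm as ([a b] & c & E & -> & HS).
    apply opair_inj in E as [-> ->]; simpl in HS; subst c; eauto.
  - intros (a & b & -> & -> & ->); exists (code (a, b)); split; [apply is_opairE; reflexivity|].
    apply maps_code_in; reflexivity.
Qed.

Lemma op_codeE (T : IT) (F : T -> T -> T) (HF : intf2 F) (a b : T) z :
  op (code (op_graph F HF)) (code a) (code b) z <-> z = code (F a b).
Proof.
  rewrite op_code; split; [|eauto].
  intros (a' & b' & E & E' & ->); apply code_inj in E, E'; congruence.
Qed.

Lemma is_product_code (T : IT) : is_product (cset (prodI T T)) (cset T) (cset T).
Proof.
  intros p; change (cset (prodI T T)) with (product (cset T) (cset T)); rewrite productP.
  split; intros (a & b & Ha & Hb & E); exists a, b; split; auto; split; auto; apply is_opairE; exact E.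
Qed.

Lemma op_binop (T : IT) (F : T -> T -> T) (HF : intf2 F) : is_binop (code (op_graph F HF)) (cset T).
Proof.
  exists (cset (prodI T T)); split; [apply is_product_code|].
  apply is_function_code.
  - intros t u _; split; apply code_in.
  - intros x Hx; apply csetP in Hx as [t <-]; exists t; split; [reflexivity|].
    exists (F (fst t) (snd t)); split; [reflexivity|]; intros u' ->; reflexivity.
Qed.

Lemma op_comm_monoid (T : IT) (F : T -> T -> T) (HF : intf2 F) (e : T) :
  (forall a b c, F a (F b c) = F (F a b) c) -> (forall a b, F a b = F b a) -> (forall a, F e a = a) ->
  is_comm_monoid (cset T) (code (op_graph F HF)) (code e).
Proof.
  intros HA HC H1; split; [apply op_binop|]; split; [apply code_in|]; split; [|split].
  - intros a b c ab bc d Ha Hb Hc.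
    apply csetP in Ha as [a' <-], Hb as [b' <-], Hc as [c' <-].
    rewrite !op_codeE; intros -> ->; rewrite !op_codeE, HA; auto.
  - intros a b c Ha Hb; apply csetP in Ha as [a' <-], Hb as [b' <-].
    rewrite !op_codeE, HC; auto.
  - intros a Ha; apply csetP in Ha as [a' <-]; rewrite op_codeE, H1; reflexivity.
Qed.

Context (R : ring M).
Local Notation "0" := (r0 R).
Local Notation "1" := (r1 R).
Local Infix "+" := (radd R).
Local Infix "*" := (rmul R).
Local Notation "- x" := (ropp R x).
Add Ring R_ring3 : (rth R).
Local Notation seq := (fnI natI R).

Definition ring_data : srdata M :=
  SRData (cset R) (code (op_graph _ (radd_int R))) (code (op_graph _ (rmul_int R))) (code 0) (code 1).

Ltac unfold_data := cbn [sr_set sr_add sr_mul sr_zero sr_one ring_data] in *.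

Lemma ring_data_comm_ring : 1 <> 0 -> is_comm_ring ring_data.
Proof.
  intros H10; split; [split|]; unfold_data.
  - apply op_comm_monoid; intros; ring.
  - apply op_comm_monoid; intros; ring.
  - intros a b c bc ab ac d Ha Hb Hc.
    apply csetP in Ha as [a' <-], Hb as [b' <-], Hc as [c' <-].
    rewrite !op_codeE; intros -> -> ->; rewrite !op_codeE; intros ->; f_equal; ring.
  - intros a Ha; apply csetP in Ha as [a' <-]; rewrite op_codeE; f_equal; ring.
  - intros E; apply code_inj in E; auto.
  - intros a Ha; apply csetP in Ha as [a' <-]; exists (code (- a')); split; [apply code_in|].
    rewrite op_codeE; f_equal; ring.
Qed.

Lemma is_unit_code (a : R) : is_unit ring_data (code a) <-> unit_in (full R) a.
Proof.
  split.
  - intros [_ (v & Hv & H)]; unfold_data; apply csetP in Hv as [b <-].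
    apply op_codeE, code_inj in H; split; [exact I|exists b; split; [exact I|exact H]].
  - intros [_ (b & _ & E)]; split; [apply code_in|]; exists (code b); split; [apply code_in|].
    apply op_codeE; unfold_data; congruence.
Qed.

Lemma is_irreducible_code (p : R) : is_irreducible ring_data (code p) <-> irreducible (full R) p.
Proof.
  split.
  - intros (_ & H0 & Hu & H); split; [exact I|]; split; [|split].
    + intros ->; apply H0; reflexivity.
    + rewrite <- is_unit_code; exact Hu.
    + intros a b _ _ E; rewrite <- !is_unit_code; apply H; [apply code_in..|].
      apply op_codeE; unfold_data; congruence.
  - intros (_ & H0 & Hu & H); split; [apply code_in|]; split; [|split].
    + intros E; apply code_inj in E; auto.
    + rewrite is_unit_code; exact Hu.
    + intros a b Ha Hb; unfold_data; apply csetP in Ha as [a' <-], Hb as [b' <-].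
      rewrite op_codeE; intros E; apply code_inj in E; rewrite !is_unit_code; apply H; auto; exact I.
Qed.

Lemma associated_code (a b : R) : associated ring_data (code a) (code b) <-> assoc R a b.
Proof.
  split.
  - intros (u & Hu & H); pose proof Hu as [Hu' _]; unfold_data; apply csetP in Hu' as [u' <-].
    apply op_codeE, code_inj in H; exists u'; split; [apply is_unit_code, Hu|exact H].
  - intros (u & Hu & ->); exists (code u); split; [apply is_unit_code, Hu|apply op_codeE; reflexivity].
Qed.

Lemma is_nat_code (n : natI) : is_nat (code n).
Proof. apply omegaP; exact (code_in natI n). Qed.

Lemma is_succ_code (s : M) (n : natI) : is_succ s (code n) <-> s = code (suc n).
Proof.
  split; [|intros ->; apply code_suc].
  intros H; exact (succ_unique _ _ _ H (code_suc n)).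
Qed.

Lemma is_empty_code (e : M) : is_empty e <-> e = code (zero (M := M)).
Proof.
  split; [|intros ->; apply code_zero].
  intros H; apply set_ext; intros x; split; intros Hx; [destruct (H x Hx)|destruct (code_zero x Hx)].
Qed.

Hint Resolve seq_prod_int : internal.

(** In [factorization] a sequence of length [n] is a function on the set [n]; here sequences are
    total functions, restricted by this graph. *)
Definition seq_graph (n : natI) (y : natI -> R) (Hy : intf y) : sub (prodI natI R) :=
  Sub (fun p => lt (fst p) n /\ snd p = y (fst p)) ltac:(int).

Lemma seq_graph_function n y Hy : is_function (code (seq_graph n y Hy)) (code n) (cset R).
Proof.
  apply is_function_code.
  - intros i r [H _]; split; [exact H|apply code_in].
  - intros x Hx; destruct (nat_elem n x Hx) as [i <-]; exists i; split; [reflexivity|].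
    exists (y i); split; [split; [exact Hx|reflexivity]|intros r [_ E]; symmetry; exact E].
Qed.

Lemma maps_seq_graph n y Hy (i : natI) z :
  lt i n -> (maps (code (seq_graph n y Hy)) (code i) z <-> z = code (y i)).
Proof.
  intros Hi; rewrite maps_code; split.
  - intros (j & r & E & -> & [_ Hr]); apply code_inj in E; subst j; simpl in Hr; congruence.
  - intros ->; exists i, (y i); split; [reflexivity|]; split; [reflexivity|]; split; [exact Hi|reflexivity].
Qed.

Lemma factorization_of_seq n y : irr_seq R n y ->
  exists x, factorization ring_data x (code n) (code (seq_prod R n y)).
Proof.
  intros Hy; exists (code (seq_graph n y (fapp_int _ _ y))); split; [apply is_nat_code|].
  split; [apply seq_graph_function|]; split.
  - intros i p Hi; destruct (nat_elem n i Hi) as [j <-]; rewrite maps_seq_graph by exact Hi.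
    intros ->; apply is_irreducible_code, Hy, Hi.
  - assert (Hq : intf (fun i => seq_prod R i y)) by int.
    exists (code (suc n)), (code (seq_graph (suc n) _ Hq)); split; [apply code_suc|].
    split; [apply seq_graph_function|]; split; [|split].
    + intros e He; apply is_empty_code in He; subst e; apply maps_seq_graph; [|rewrite seq_prod_0; reflexivity].
      clear; nat_ind n; [apply lt_suc_diag|intros n IH; apply lt_suc; auto].
    + intros i i' u v w Hi Hi'; destruct (nat_elem n i Hi) as [j <-].
      apply is_succ_code in Hi'; subst i'.
      assert (Lj : lt (suc j) (suc n)).
      { apply lt_add in Hi as [k ->]; apply lt_add; exists k; rewrite suc_add; reflexivity. }
      rewrite !maps_seq_graph by first [exact Hi|exact Lj|apply lt_suc; left; exact Hi].
      intros -> -> H; apply op_codeE in H; rewrite H, seq_prod_S; reflexivity.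
    + apply maps_seq_graph; [apply lt_suc_diag|reflexivity].
Qed.

Lemma maps_int (T U : IT) (x : M) : intp2 (fun (t : T) (u : U) => maps x (code t) (code u)).
Proof.
  apply (intp_dfn _ _ (fun e => exists a b p, is_opair (e 0%nat) a b /\ is_opair p a b /\ p ∈ e 1%nat)
    (fun _ => x)); [is_pair_dfn|].
  intros [i r]; simpl; unfold maps; split.
  - intros (p & Hp & Hin); exists (code i), (code r), p; split; [apply is_opairE; reflexivity|auto].
  - intros (b & c & p & E & Hp & Hin); apply is_opairE, opair_inj in E as [<- <-]; eauto.
Qed.

Lemma seq_of_factorization x n a : factorization ring_data x n a ->
  exists (k : natI) (y : seq), n = code k /\ irr_seq R k y /\ a = code (seq_prod R k y) /\
    forall i z, lt i k -> maps x (code i) z -> z = code (y i).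
Proof.
  intros (Hn & [Hx1 Hx2] & Hirr & (n' & q & Hn' & [Hq1 Hq2] & Hq0 & HqS & Hqn)).
  apply omegaP in Hn; apply (csetP natI) in Hn as [k <-].
  apply is_succ_code in Hn'; subst n'.
  assert (Hv : forall (i : natI) z, maps x (code i) z -> exists r : R, z = code r).
  { intros i z (p & Hp & Hin); destruct (Hx1 p Hin) as (i' & z' & _ & Hz & E).
    apply is_opairE in Hp, E; subst p; apply opair_inj in E as [_ <-].
    apply csetP in Hz as [r <-]; eauto. }
  (* Beyond its length the sequence is continued with the default value [1], to become a total
     function. *)
  assert (Hu : forall i : natI, exists! r : R, maps x (code i) (code r) /\ lt i k \/ ~ lt i k /\ r = 1).
  { intros i; destruct (classic (lt i k)) as [Hi|Hi].
    - destruct (Hx2 _ Hi) as (z & Hz & Hzu); destruct (Hv _ _ Hz) as [r ->]; exists r; split; [auto|].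
      intros r' [[H _]|[H _]]; [apply Hzu, code_inj in H; exact H|contradiction].
    - exists 1; split; [auto|]; intros r' [[_ H]|[_ H]]; [contradiction|auto]. }
  destruct (unique_choice natI R _ Hu) as [y Hy].
  assert (Hiy : intf y).
  { apply (intf_graph _ _ _ _ Hy).
    assert (Hm := maps_int natI R x).
    int. }
  assert (Hyx : forall (i : natI) z, lt i k -> maps x (code i) z -> z = code (y i)).
  { intros i z Hi Hz; destruct (Hv _ _ Hz) as [r ->]; f_equal; apply Hy; auto. }
  assert (Hyx' : forall i, lt i k -> maps x (code i) (code (y i))).
  { intros i Hi; destruct (proj1 (Hy i (y i)) eq_refl) as [[H _]|[H _]]; [exact H|contradiction]. }
  exists k, (Fn y Hiy); split; [reflexivity|]; split; [|split; [|exact Hyx]].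
  - intros i Hi; apply is_irreducible_code, (Hirr (code i)); [exact Hi|apply Hyx', Hi].
  - assert (K : forall i, lt i (suc k) -> maps q (code i) (code (seq_prod R i (Fn y Hiy)))).
    { assert (Hm := maps_int natI R q).
      refine (natI_ind _ _ _ _).
      - apply intp_imp; [int|].
        assert (Hs : intf (fun i => seq_prod R i (Fn y Hiy))) by int.
        exact (intp_comp2 _ _ _ _ _ _ Hm (intf_id natI) Hs).
      - intros _; rewrite seq_prod_0; apply Hq0, code_zero.
      - intros i IH Hi.
        assert (Li : lt i k).
        { apply lt_add in Hi as [j Hj]; rewrite suc_add in Hj; apply suc_inj in Hj; apply lt_add; eauto. }
        apply (HqS (code i) _ (code (seq_prod R i (Fn y Hiy))) (code (y i)));
          [exact Li|apply code_suc|apply IH, lt_suc; auto|apply Hyx', Li|].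
        apply op_codeE; rewrite seq_prod_S; reflexivity. }
    destruct (Hq2 (code k) (lt_suc_diag k)) as (z & _ & Hz).
    rewrite <- (Hz a Hqn); apply Hz, K, lt_suc_diag.
Qed.

Lemma ring_data_UFD : integral (full R) -> 1 <> 0 -> prime_generated R -> is_UFD ring_data.
Proof.
  intros HI H10 HP; split.
  - split; [apply ring_data_comm_ring, H10|].
    intros a b Ha Hb; unfold_data; apply csetP in Ha as [a' <-], Hb as [b' <-].
    rewrite op_codeE, !code_eq; intros E; apply HI; auto; exact I.
  - intros a Ha H0 Hu; unfold_data; apply csetP in Ha as [a' <-].
    rewrite code_eq in H0; rewrite is_unit_code in Hu.
    destruct (factorization_exists R HI H10 HP a' H0 Hu) as (n & y & Hy & <-).
    destruct (factorization_of_seq n y Hy) as [x Hx]; exists x, (code n); exact Hx.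
  - intros a x n y m _ _ _ Hx Hy.
    destruct (seq_of_factorization _ _ _ Hx) as (n' & x' & -> & Hx' & -> & Ex).
    destruct (seq_of_factorization _ _ _ Hy) as (m' & y' & -> & Hy' & Exy & Ey).
    apply code_inj in Exy.
    destruct (factorization_unique R HI HP n' m' x' y' 1) as (-> & s & t & Hs & Ht); auto.
    { apply unit_1. }
    { rewrite Exy; ring. }
    split; [reflexivity|].
    set (S := Sub (fun p : prodI natI natI => lt (fst p) m' /\ snd p = s (fst p)) ltac:(int)
      : sub (prodI natI natI)).
    exists (code S); split; [split|].
    + apply is_function_code.
      * intros i j [Hi Hj]; simpl in Hi, Hj; subst j; split; [exact Hi|apply Hs, Hi].
      * intros z Hz; destruct (nat_elem _ _ Hz) as [i <-]; exists i; split; [reflexivity|].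
        exists (s i); split; [split; [exact Hz|reflexivity]|intros j [_ E]; symmetry; exact E].
    + intros z Hz; destruct (nat_elem _ _ Hz) as [j <-]; destruct (Ht j Hz) as [Hj Ej].
      exists (code (t j)); split.
      * apply maps_code_in; split; [exact Hj|symmetry; exact Ej].
      * intros w Hw; apply maps_code in Hw as (i & j' & -> & E & [Hi Hj']); apply code_inj in E; subst j'.
        simpl in Hi, Hj'; f_equal; rewrite Hj'; apply Hs, Hi.
    + intros i j p q Hi Hij Hp Hq.
      apply maps_code in Hij as (i' & j' & -> & -> & [_ Ej]); simpl in Ej; subst j'.
      rewrite (Ex _ _ Hi Hp), (Ey (s i') q); [|apply Hs, Hi|exact Hq].
      apply associated_code, Hs, Hi.
Qed.

End Translation.

(** * Maximal ideals from choice *)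

Section Zorn.
Context {M : set_structure} {HM : ZF M}.
Local Notation IT := (itype M).

(** Choice is applied to the set of fibres [E i], and the resulting function is composed with the
    map from [i] to its fibre. *)
Lemma typed_choice (I U : IT) (E : I -> U -> Prop) :
  axiom_of_choice M -> intp2 E -> (forall i, exists u, E i u) -> exists f, intf f /\ forall i, E i (f i).
Proof.
  intros AC HE Hne.
  assert (Hi : forall i, intp (E i)) by int.
  set (fib := fun i => Sub (E i) (Hi i)).
  assert (Hfib : intf fib) by (unfold fib; int).
  set (X := Sub (fun Y : sub U => exists i, Y = fib i) ltac:(clearbody fib; int) : sub (subI U)).
  destruct (AC (code X)) as (V & f & _ & [Hf1 Hf2] & Hf3).
  { intros x Hx; apply sub_codeP in Hx as (Y & [i ->] & <-); destruct (Hne i) as [u Hu].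
    exists (code u); apply (sub_code_in U (fib i)); exact Hu. }
  assert (HX : forall i, code (fib i) ∈ code X).
  { intros i; apply (sub_code_in _ X (fib i)); exists i; reflexivity. }
  assert (HEm : forall i y, maps f (code (fib i)) y -> exists u, y = code u /\ E i u).
  { intros i y Hy; assert (H := Hf3 _ _ (HX i) Hy); apply sub_codeP in H as (u & Hu & <-); eauto. }
  destruct (unique_choice I U (fun i u => maps f (code (fib i)) (code u))) as [h Hh].
  - intros i; destruct (Hf2 _ (HX i)) as (y & Hy & Hyu); destruct (HEm _ _ Hy) as (u & -> & _).
    exists u; split; [exact Hy|]; intros u' Hu'; apply code_inj; auto.
  - exists h; split.
    + apply (intf_graph _ _ _ _ Hh); clearbody fib.
      assert (Hm := maps_int (subI U) U f).
      exact (intp_comp2 (prodI I U) (subI U) U _ (fun p => fib (fst p)) (fun p => snd p) Hm ltac:(int) ltac:(int)).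
    + intros i; destruct (HEm i (code (h i))) as (u & E' & Hu); [apply Hh; reflexivity|].
      apply code_inj in E'; congruence.
Qed.

Definition incl {T : IT} (S S' : sub T) : Prop := forall t, S t -> S' t.

Lemma incl_int (T : IT) : intp2 (incl (T := T)).
Proof. unfold incl; int. Qed.
Hint Resolve incl_int : internal.

Lemma incl_antisym (T : IT) (S S' : sub T) : incl S S' -> incl S' S -> S = S'.
Proof. intros H H'; apply sub_ext; intros t; split; auto. Qed.

Definition bigunion {T : IT} (L : sub (subI T)) : sub T := Sub (fun t => exists S, L S /\ S t) ltac:(int).

Definition chain {T : IT} (L : sub (subI T)) : Prop := forall S S', L S -> L S' -> incl S S' \/ incl S' S.

(** Bourbaki-Witt, with Zermelo's proof that the least family closed under [g] and unions of
    chains is itself a chain. *)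
Section FixedPoint.
Context (T : IT) (P : sub T -> Prop) (HP : intp P) (I0 : sub T) (P0 : P I0).
Context (g : sub T -> sub T) (Hg : intf g) (Pg : forall S, P S -> P (g S)) (g_incl : forall S, P S -> incl S (g S)).
Context (Punion : forall L : sub (subI T), (exists S, L S) -> (forall S, L S -> P S) -> chain L -> P (bigunion L)).

Definition tower_closed (F : sub (subI T)) : Prop :=
  F I0 /\ (forall S, F S -> F (g S)) /\
  forall L : sub (subI T), (exists S, L S) -> (forall S, L S -> F S) -> chain L -> F (bigunion L).

Definition tower : sub (subI T) := Sub (fun S => forall F, tower_closed F -> F S)
  ltac:(unfold tower_closed, chain, bigunion; int).

Lemma tower_is_closed : tower_closed tower.
Proof.
  split; [|split].
  - intros F HF; apply HF.
  - intros S HS F HF; apply HF, HS, HF.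
  - intros L Hne HL Hc F HF; apply HF; auto; intros S HS; apply (HL S HS F HF).
Qed.

Lemma tower_ind (Q : sub T -> Prop) : intp Q -> Q I0 -> (forall S, tower S -> Q S -> Q (g S)) ->
  (forall L : sub (subI T), (exists S, L S) -> (forall S, L S -> tower S /\ Q S) -> chain L -> Q (bigunion L)) ->
  forall S, tower S -> Q S.
Proof.
  intros HQ Q0 Qg Qu S HS.
  destruct tower_is_closed as (C0 & Cg & Cu).
  assert (Hi : intp (fun S : sub T => tower S /\ Q S)) by int.
  apply (HS (Sub _ Hi)); split; [|split]; simpl.
  - split; assumption.
  - intros S' [H1 H2]; split; [apply Cg|apply Qg]; assumption.
  - intros L Hne HL Hc; split; [apply Cu; auto; intros S' HS'; exact (proj1 (HL S' HS'))|apply Qu; auto].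
Qed.

Lemma tower_P S : tower S -> P S.
Proof.
  revert S; apply tower_ind; auto.
  intros L Hne HL Hc; apply Punion; auto; intros S HS; exact (proj2 (HL S HS)).
Qed.

Lemma tower_base S : tower S -> incl I0 S.
Proof.
  revert S; apply tower_ind; [int|intros t Ht; exact Ht|..].
  - intros S HS H t Ht; apply g_incl, H, Ht; apply tower_P, HS.
  - intros L [S HS] HL _ t Ht; exists S; split; [exact HS|apply HL; assumption].
Qed.

(** No step of [g] jumps from strictly below [c] to outside [c]. Such a [c] is comparable with the
    whole tower, and a second induction shows that all members of the tower are of this kind. *)
Definition extreme (c : sub T) : Prop := forall S, tower S -> incl S c -> S <> c -> incl (g S) c.

Lemma extreme_compare c : tower c -> extreme c -> forall S, tower S -> incl S c \/ incl (g c) S.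
Proof.
  intros Hc He; apply tower_ind; [int|left; apply tower_base, Hc|..].
  - intros S HS [H|H].
    + destruct (classic (S = c)) as [-> |Hn]; [right; intros t Ht; exact Ht|left; auto].
    + right; intros t Ht; apply g_incl; [apply tower_P, HS|auto].
  - intros L _ HL _; destruct (classic (exists S, L S /\ incl (g c) S)) as [(S & HS & H)|Hn].
    + right; intros t Ht; exists S; split; auto.
    + left; intros t (S & HS & Ht); destruct (HL S HS) as [_ [H|H]]; [auto|destruct Hn; eauto].
Qed.

Lemma tower_extreme c : tower c -> extreme c.
Proof.
  destruct tower_is_closed as (C0 & Cg & Cu).
  revert c; apply tower_ind.
  - unfold extreme; int.
  - intros S HS H Hn; destruct Hn; apply incl_antisym; [exact H|apply tower_base, HS].
  - intros c Hc He S HS H Hn; destruct (extreme_compare c Hc He S HS) as [H'|H'].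
    + destruct (classic (S = c)) as [-> |Hn']; [intros t Ht; exact Ht|].
      intros t Ht; apply g_incl; [apply tower_P, Hc|]; exact (He S HS H' Hn' t Ht).
    + destruct Hn; apply incl_antisym; assumption.
  - intros L Hne HL Hch S HS H Hn.
    destruct (classic (exists c, L c /\ incl S c)) as [(c & Lc & Hc)|Hno].
    + destruct (HL c Lc) as [Tc Ec].
      destruct (classic (S = c)) as [-> |Hn'].
      * destruct (extreme_compare c Tc Ec (bigunion L)) as [H'|H'].
        -- apply Cu; auto; intros S' HS'; exact (proj1 (HL S' HS')).
        -- destruct Hn; apply incl_antisym; assumption.
        -- exact H'.
      * intros t Ht; exists c; split; [exact Lc|exact (Ec S HS Hc Hn' t Ht)].
    + destruct Hn; apply incl_antisym; [exact H|].
      intros t (c & Lc & Ht); destruct (HL c Lc) as [Tc Ec].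
      destruct (extreme_compare c Tc Ec S HS) as [H'|H']; [destruct Hno; eauto|].
      apply H', g_incl; [apply tower_P, Tc|exact Ht].
Qed.

(** The tower is a chain, so its union belongs to it; being the largest member, it cannot be
    enlarged by [g]. *)
Lemma fixed_point : exists S, P S /\ g S = S.
Proof.
  destruct tower_is_closed as (C0 & Cg & Cu).
  assert (Hch : chain tower).
  { intros S S' HS HS'.
    destruct (extreme_compare S HS (tower_extreme S HS) S' HS') as [H|H]; [right; exact H|left].
    intros t Ht; apply H, g_incl; [apply tower_P, HS|exact Ht]. }
  assert (HU : tower (bigunion tower)) by (apply Cu; eauto).
  exists (bigunion tower); split; [apply tower_P, HU|].
  apply incl_antisym; [|apply g_incl, tower_P, HU].
  intros t Ht; exists (g (bigunion tower)); split; [apply Cg, HU|exact Ht].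
Qed.

End FixedPoint.

(** * Ideals of a semiring of the model *)

Section SemiringIdeals.
Context (S : srdata M) (HS : is_comm_semiring S).
Local Notation T := (elI (sr_set S)).

Let opa (a b c : T) : Prop := op (sr_add S) (code a) (code b) (code c).
Let opm (a b c : T) : Prop := op (sr_mul S) (code a) (code b) (code c).

Lemma op_opair (f : M) (a b c : T) : op f (code a) (code b) (code c) <-> code ((a, b), c) ∈ f.
Proof.
  split.
  - intros (p & Hp & q & Hq & Hin); apply is_opairE in Hp, Hq; subst; exact Hin.
  - intros H; exists (code (a, b)); split; [apply is_opairE; reflexivity|].
    exists (code ((a, b), c)); split; [apply is_opairE; reflexivity|exact H].
Qed.

Lemma op_int (f : M) : intp (fun p : prodI (prodI T T) T =>
  op f (code (fst (fst p))) (code (snd (fst p))) (code (snd p))).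
Proof. exists f; intros [[a b] c]; apply op_opair. Qed.

(** Quantifying over one triple [p] turns the graph of an operation into a unary predicate, since
    the internality tactics treat relations of at most two arguments. *)
Definition ideal (I : sub T) : Prop :=
  (exists a, I a) /\ (forall p : prodI (prodI T T) T, I (fst (fst p)) -> I (snd (fst p)) ->
    opa (fst (fst p)) (snd (fst p)) (snd p) -> I (snd p)) /\
  (forall p : prodI (prodI T T) T, I (snd (fst p)) ->
    opm (fst (fst p)) (snd (fst p)) (snd p) -> I (snd p)).

Lemma ideal_int : intp ideal.
Proof.
  assert (H1 := op_int (sr_add S)); assert (H2 := op_int (sr_mul S)).
  set (A := fun p : prodI (prodI T T) T => opa (fst (fst p)) (snd (fst p)) (snd p)).
  set (B := fun p : prodI (prodI T T) T => opm (fst (fst p)) (snd (fst p)) (snd p)).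
  change (intp A) in H1; change (intp B) in H2.
  change (intp (fun I : sub T => (exists a, I a) /\
    (forall p : prodI (prodI T T) T, I (fst (fst p)) -> I (snd (fst p)) -> A p -> I (snd p)) /\
    (forall p : prodI (prodI T T) T, I (snd (fst p)) -> B p -> I (snd p)))).
  clearbody A B; int.
Qed.

Lemma is_ideal_code (I : sub T) : is_ideal S (code I) <-> ideal I.
Proof.
  unfold is_ideal, ideal; split.
  - intros (_ & [x Hx] & Ha & Hm); split; [|split].
    + apply sub_codeP in Hx as (a & H & _); exists a; exact H.
    + intros [[a b] c] HIa HIb H; apply (sub_code_in T I).
      apply (Ha (code a) (code b)); [apply (sub_code_in T I); assumption..|exact H].
    + intros [[s a] c] HIa H; apply (sub_code_in T I).
      apply (Hm (code s) (code a)); [apply code_in|apply (sub_code_in T I); assumption|exact H].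
  - intros ([a HIa] & Ha & Hm); split; [|split; [|split]].
    + intros x Hx; apply sub_codeP in Hx as (b & _ & <-); exact (code_in T b).
    + exists (code a); apply (sub_code_in T I), HIa.
    + intros x y z Hx Hy Hop; apply sub_codeP in Hx as (b & Hb & <-), Hy as (c & Hc & <-).
      assert (Hz : z ∈ sr_set S).
      { destruct (proj1 (sr_add_monoid S HS)) as (Q & _ & [Hf _]); destruct Hop as (p & _ & q & Hq & Hin).
        destruct (Hf q Hin) as (u & v & _ & Hv & Hq'); apply is_opairE in Hq, Hq'.
        rewrite Hq in Hq'; apply opair_inj in Hq' as [_ ->]; exact Hv. }
      apply (csetP T) in Hz as [d <-]; apply (sub_code_in T I), (Ha ((b, c), d)); assumption.
    + intros x y z Hx Hy Hop; apply (csetP T) in Hx as [b <-]; apply sub_codeP in Hy as (c & Hc & <-).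
      assert (Hz : z ∈ sr_set S).
      { destruct (proj1 (sr_mul_monoid S HS)) as (Q & _ & [Hf _]); destruct Hop as (p & _ & q & Hq & Hin).
        destruct (Hf q Hin) as (u & v & _ & Hv & Hq'); apply is_opairE in Hq, Hq'.
        rewrite Hq in Hq'; apply opair_inj in Hq' as [_ ->]; exact Hv. }
      apply (csetP T) in Hz as [d <-]; apply (sub_code_in T I), (Hm ((b, c), d)); assumption.
Qed.

Lemma op_unique (f x y z z' : M) : is_binop f (sr_set S) -> x ∈ sr_set S -> y ∈ sr_set S ->
  op f x y z -> op f x y z' -> z = z'.
Proof.
  intros (Q & HQ & [_ Hf]) Hx Hy (p & Hp & Hm) (p' & Hp' & Hm').
  apply is_opairE in Hp, Hp'; subst p p'.
  destruct (Hf (opair x y)) as (w & _ & Hw).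
  - apply HQ; exists x, y; split; [exact Hx|]; split; [exact Hy|apply is_opairE; reflexivity].
  - rewrite <- (Hw z), <- (Hw z'); auto.
Qed.

(** Choice gives a map [g] sending a proper ideal to a strictly larger proper one whenever there is
    one; its fixed points are maximal. Properness is expressed as omitting [1], which passes to
    unions. *)
Lemma semiring_maximal_ideal : axiom_of_choice M -> has_maximal_ideal S.
Proof.
  intros AC.
  assert (H0 : exists o : T, code o = sr_zero S) by apply (csetP T), (sr_add_monoid S HS).
  assert (H1 : exists i : T, code i = sr_one S) by apply (csetP T), (sr_mul_monoid S HS).
  destruct H0 as [o Eo], H1 as [i Ei].
  assert (Hid := ideal_int).
  set (P := fun I : sub T => ideal I /\ ~ I i).
  assert (HP : intp P) by (unfold P; clearbody opa opm; int).
  set (I0 := Sub (fun a : T => a = o) ltac:(int) : sub T).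
  assert (P0 : P I0).
  { split; [split; [exists o; reflexivity|split]|].
    - intros [[a b] c]; simpl; intros -> ->; unfold opa; intros H; apply (@code_inj M T); symmetry.
      apply (op_unique (sr_add S) (code o) (code o)); [apply HS|apply (code_in T)..| |exact H].
      rewrite Eo; apply (sr_add_monoid S HS), HS.
    - intros [[s a] c]; simpl; intros ->; unfold opm; intros H; apply (@code_inj M T); symmetry.
      apply (op_unique (sr_mul S) (code s) (code o)); [apply HS|apply (code_in T)..| |exact H].
      rewrite Eo; apply (sr_mul_zero S HS), (code_in T).
    - intros E; apply (sr_nontrivial S HS); simpl in E; congruence. }
  set (larger := fun I J : sub T => P J /\ incl I J /\ I <> J).
  assert (HL : intp2 larger) by (unfold larger; clearbody P; int).
  destruct (typed_choice (subI T) (subI T)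
    (fun I J => larger I J \/ (forall J', ~ larger I J') /\ J = I) AC) as (g & Hg & Hgl).
  { clearbody larger; int. }
  { intros I; destruct (classic (exists J, larger I J)) as [[J HJ]|Hn]; [exists J; auto|].
    exists I; right; split; [|reflexivity]; intros J HJ; apply Hn; eauto. }
  destruct (fixed_point T P HP I0 P0 g Hg) as (m & Pm & Em).
  - intros I HI; destruct (Hgl I) as [[H _]|[_ ->]]; assumption.
  - intros I HI; destruct (Hgl I) as [(_ & H & _)|[_ ->]]; [exact H|intros t Ht; exact Ht].
  - intros L [I LI] HLP Hch; split; [split; [|split]|].
    + destruct (HLP I LI) as [[[a Ha] _] _]; exists a, I; auto.
    + intros p (J & LJ & Ha) (J' & LJ' & Hb) H.
      destruct (Hch J J' LJ LJ') as [Hi|Hi].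
      * exists J'; split; [exact LJ'|]; destruct (HLP J' LJ') as [[_ [K _]] _]; apply (K p); auto.
      * exists J; split; [exact LJ|]; destruct (HLP J LJ) as [[_ [K _]] _]; apply (K p); auto.
    + intros p (J & LJ & Ha) H; exists J; split; [exact LJ|]; destruct (HLP J LJ) as [[_ [_ K]] _]; exact (K p Ha H).
    + intros (J & LJ & Hi); apply (HLP J LJ); exact Hi.
  - exists (code m); split; [apply is_ideal_code, Pm|]; split.
    + intros E; apply Pm; apply (sub_code_in T m); change (code i ∈ code m); rewrite E; exact (code_in T i).
    + intros J HJ Hmj; pose proof HJ as (HJs & _).
      apply powersetP, (csetP (subI T)) in HJs as [J' <-]; apply is_ideal_code in HJ.
      destruct (classic (J' i)) as [Hi|Hi].
      * right; apply set_ext; intros x; split; [intros Hx; apply is_ideal_code in HJ; apply HJ, Hx|].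
        intros Hx; apply (csetP T) in Hx as [a <-]; apply (sub_code_in T J').
        apply (proj2 (proj2 HJ) ((a, i), a)); [exact Hi|].
        unfold opm; simpl fst; simpl snd; rewrite Ei.
        destruct (sr_mul_monoid S HS) as (_ & H1 & _ & Hc & Hone).
        exact (Hc _ _ _ H1 (code_in T a) (Hone _ (code_in T a))).
      * left; f_equal; apply NNPP; intros Hn.
        assert (HJ' : larger m J').
        { split; [split; assumption|]; split; [|auto].
          intros t Ht; apply (sub_code_in T J'), Hmj, (sub_code_in T m), Ht. }
        destruct (Hgl m) as [(_ & _ & H)|[H _]]; [apply H; symmetry; exact Em|exact (H _ HJ')].
Qed.

End SemiringIdeals.
End Zorn.

(** * Rationals and localizations *)

Section Rationals.
Context {M : set_structure} {HM : ZF M}.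

Add Ring nat_ring : (nat_semiring (M := M)).

Definition positive : sub (natI (M := M)) := Sub (fun n => n <> zero) ltac:(int).

Lemma positive_1 : positive (suc zero).
Proof. apply suc_neq_zero. Qed.

Lemma positive_mul m n : positive m -> positive n -> positive (mul m n).
Proof. intros Hm Hn H; destruct (nat_integral _ _ H); auto. Qed.

Definition rationals : ring M :=
  frac natI zero (suc zero) add mul nat_semiring add_int mul_int add_cancel positive positive_1
    positive_mul mul_cancel.

Definition rat_of : natI -> rationals :=
  frac_of natI zero (suc zero) add mul add_int mul_int positive positive_1.

Lemma rat_of_inj m n : rat_of m = rat_of n -> m = n.
Proof. exact (frac_of_inj _ _ _ _ _ nat_semiring _ _ add_cancel positive positive_1 mul_cancel m n). Qed.

Lemma rationals_one : r1 rationals <> r0 rationals.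
Proof. intros E; exact (suc_neq_zero _ (rat_of_inj _ _ E)). Qed.

Lemma rationals_field (a : rationals) : a <> r0 rationals -> exists b, rmul rationals a b = r1 rationals.
Proof.
  destruct (frac_mk_surj _ _ _ _ _ _ a) as [[[x y] [s Hs]] ->].
  assert (Hmk := frac_mk_eq natI _ _ _ _ nat_semiring add_int mul_int add_cancel positive mul_cancel).
  assert (Hmul := frac_mulE natI _ _ _ _ nat_semiring add_int mul_int add_cancel positive
    positive_mul mul_cancel).
  intros H0.
  assert (Hxy : x <> y).
  { intros ->; apply H0; apply Hmk; unfold frac_eqv; cbn [fst snd proj1_sig tmul den_mul]; ring. }
  destruct (le_or_lt y x) as [[k ->]|[k ->]].
  - assert (Hk : positive k) by (intros ->; apply Hxy, add_zero).
    exists (frac_mk natI add mul add_int mul_int positive (s, zero, exist _ k Hk)).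
    etransitivity; [apply Hmul|]; apply Hmk; unfold frac_eqv; cbn [fst snd proj1_sig tmul den_mul]; ring.
  - exists (frac_mk natI add mul add_int mul_int positive (zero, s, exist positive (suc k) (suc_neq_zero k))).
    etransitivity; [apply Hmul|]; apply Hmk; unfold frac_eqv; cbn [fst snd proj1_sig tmul den_mul]; ring.
Qed.

Lemma rationals_infinite (S : sub rationals) : finite S -> exists c, ~ S c.
Proof.
  intros HS; destruct (finite_avoid rationals rat_of S) as [n Hn]; eauto using rat_of_inj.
  apply (frac_of_int _ _ _ _ _ nat_semiring _ _ add_cancel positive positive_1 positive_mul mul_cancel).
Qed.

End Rationals.

(** * Localizations of a domain *)

Section Localization.
Context {M : set_structure} {HM : ZF M} (R : ring M).
Local Notation "0" := (r0 R).
Local Notation "1" := (r1 R).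
Local Infix "+" := (radd R).
Local Infix "*" := (rmul R).
Local Notation "- x" := (ropp R x).
Local Notation "a - b" := (a + - b).
Add Ring R_ring4 : (rth R).

Lemma ring_semiring : semi_ring_theory 0 1 (radd R) (rmul R) eq.
Proof. split; intros; ring. Qed.

Lemma ring_add_cancel a b c : a + c = b + c -> a = b.
Proof. intros E; transitivity (a + c - c); [ring|rewrite E; ring]. Qed.

Context (HI : integral (full R)) (one_neq_zero : 1 <> 0).
Context (S : sub R) (S1 : S 1) (SM : forall a b, S a -> S b -> S (a * b)) (S0 : ~ S 0).

Lemma localization_cancel s a b : S s -> s * a = s * b -> a = b.
Proof.
  intros Hs; apply (mul_cancel_l (full R) (full_subring R)); try exact I; [exact HI|].
  intros ->; contradiction.
Qed.

Definition localization : ring M :=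
  frac R 0 1 (radd R) (rmul R) ring_semiring (radd_int R) (rmul_int R) ring_add_cancel S S1 SM localization_cancel.

Definition loc : R -> localization :=
  frac_of R 0 1 (radd R) (rmul R) (radd_int R) (rmul_int R) S S1.

Local Notation L := localization.
Local Infix "×" := (rmul L) (at level 40, left associativity).
Add Ring L_ring : (rth L).

Lemma loc_int : intf loc.
Proof. apply (frac_of_int _ _ _ _ _ ring_semiring _ _ ring_add_cancel _ _ SM localization_cancel). Qed.
Hint Resolve loc_int : internal.

Lemma loc_add a b : loc (a + b) = radd L (loc a) (loc b).
Proof. apply (frac_of_add _ _ _ _ _ ring_semiring _ _ ring_add_cancel _ _ SM localization_cancel). Qed.

Lemma loc_mul a b : loc (a * b) = loc a × loc b.
Proof. apply (frac_of_mul _ _ _ _ _ ring_semiring _ _ ring_add_cancel _ _ SM localization_cancel). Qed.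

Lemma loc_inj a b : loc a = loc b -> a = b.
Proof. apply (frac_of_inj _ _ _ _ _ ring_semiring _ _ ring_add_cancel _ _ localization_cancel). Qed.

Lemma loc_unit s : S s -> unit_in (full L) (loc s).
Proof.
  intros Hs; destruct (frac_of_unit R 0 1 (radd R) (rmul R) ring_semiring (radd_int R) (rmul_int R)
    ring_add_cancel S S1 SM localization_cancel s Hs) as [v Hv].
  split; [exact I|exists v; split; [exact I|symmetry; exact Hv]].
Qed.

Lemma loc_surj x : exists a s, S s /\ x × loc s = loc a.
Proof.
  destruct (frac_surj R 0 1 (radd R) (rmul R) ring_semiring (radd_int R) (rmul_int R)
    ring_add_cancel S S1 SM localization_cancel x) as (a & b & s & Hs & E).
  (* As [R] has subtraction, the formal difference in the numerator is the image of an actual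
     one. *)
  exists (a - b), s; split; [exact Hs|].
  change (radd L (x × loc s) (loc b) = loc a) in E.
  assert (E' : radd L (loc (a - b)) (loc b) = loc a) by (rewrite <- loc_add; f_equal; ring).
  transitivity (radd L (radd L (x × loc s) (loc b)) (ropp L (loc b))); [ring|].
  rewrite E, <- E'; ring.
Qed.

Lemma loc_surj_unit x : exists a u, unit_in (full L) u /\ x = u × loc a.
Proof.
  destruct (loc_surj x) as (a & s & Hs & E); destruct (loc_unit s Hs) as [_ (v & _ & Ev)].
  exists a, v; split; [split; [exact I|exists (loc s); split; [exact I|rewrite Ev; ring]]|].
  transitivity (x × loc s × v); [|rewrite E; ring].
  transitivity (x × r1 L); [ring|rewrite Ev; ring].
Qed.

Lemma localization_one : r1 L <> r0 L.
Proof. intros E; apply (loc_inj 1 0) in E; auto. Qed.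

Lemma loc_divides a x : divides (full L) (loc a) x -> forall b u, unit_in (full L) u -> x = u × loc b ->
  exists s, S s /\ divides (full R) a (s * b).
Proof.
  intros (y & _ & Ey) b u [_ (v & _ & Ev)] Ex.
  assert (E : loc b = loc a × (y × v)).
  { transitivity (r1 L × loc b); [ring|rewrite Ev].
    transitivity (u × loc b × v); [ring|rewrite <- Ex, Ey; ring]. }
  destruct (loc_surj (y × v)) as (c & s & Hs & Ec).
  exists s; split; [exact Hs|]; exists c; split; [exact I|].
  apply loc_inj; rewrite !loc_mul, <- Ec, E; ring.
Qed.

Lemma localization_integral : integral (full L).
Proof.
  intros x y _ _ E.
  destruct (loc_surj x) as (a & s & Hs & Ea), (loc_surj y) as (b & t & Ht & Eb).
  assert (H : a * b = 0).
  { apply loc_inj; change (loc 0) with (r0 L); rewrite loc_mul, <- Ea, <- Eb.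
    transitivity (x × y × (loc s × loc t)); [ring|rewrite E; ring]. }
  assert (K : forall z c r, S r -> z × loc r = loc c -> c = 0 -> z = r0 L).
  { intros z c r Hr Ez ->; change (loc 0) with (r0 L) in Ez.
    destruct (loc_unit r Hr) as [_ (v & _ & Ev)].
    transitivity (z × r1 L); [ring|rewrite Ev]; transitivity (z × loc r × v); [ring|rewrite Ez; ring]. }
  destruct (HI a b I I H) as [Ha|Hb]; [left; exact (K x a s Hs Ea Ha)|right; exact (K y b t Ht Eb Hb)].
Qed.

(** Clearing denominators, [p] divides [s a b] with [s] in [S]. If it divides [s], then [loc p]
    becomes a unit and divides everything; this is where counting units among the primes is
    convenient. *)
Lemma loc_prime p : prime_or_unit (full R) p -> prime_or_unit (full L) (loc p).
Proof.
  intros [_ Hp]; split; [exact I|]; intros x y _ _ Hd.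
  destruct (loc_surj_unit x) as (a & u & Hu & ->), (loc_surj_unit y) as (b & v & Hv & ->).
  destruct (loc_divides p _ Hd (a * b) (u × v)) as (s & Hs & Hd').
  { apply unit_mul; auto; apply full_subring. }
  { rewrite loc_mul; ring. }
  assert (K : forall a w, divides (full R) p a -> divides (full L) (loc p) (w × loc a)).
  { intros c w (d & _ & ->); exists (w × loc d); split; [exact I|rewrite loc_mul; ring]. }
  destruct (Hp s (a * b) I I Hd') as [(c & _ & ->)|H].
  - left; destruct (loc_unit _ Hs) as [_ (w & _ & Ew)]; rewrite loc_mul in Ew.
    exists (loc c × w × (u × loc a)); split; [exact I|].
    transitivity (r1 L × (u × loc a)); [ring|rewrite Ew; ring].
  - destruct (Hp a b I I H); [left|right]; apply K; assumption.
Qed.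

Lemma localization_prime_generated : prime_generated R -> prime_generated L.
Proof.
  intros HP Z Z1 Zu Zp x Hx.
  destruct (loc_surj_unit x) as (a & u & Hu & ->); apply Zu; [exact Hu|].
  assert (Hi : intp (fun a => Z (loc a))) by int.
  apply (HP (Sub _ Hi)); simpl.
  - exact Z1.
  - intros w z [_ (v & _ & Ev)] Hz; rewrite loc_mul; apply Zu; [|exact Hz].
    split; [exact I|exists (loc v); split; [exact I|rewrite <- loc_mul, <- Ev; reflexivity]].
  - intros p z Hp Hp0 Hz; rewrite loc_mul; apply Zp; [apply loc_prime, Hp| |exact Hz].
    intros E; apply Hp0, loc_inj, E.
  - intros ->; apply Hx; change (loc 0) with (r0 L); ring.
Qed.

End Localization.

(** * Choice from maximal ideals *)

Section MaximalIdeal.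
Context {M : set_structure} {HM : ZF M} (R : ring M).
Local Notation "0" := (r0 R).
Local Notation "1" := (r1 R).
Local Infix "+" := (radd R).
Local Infix "*" := (rmul R).
Add Ring R_ring5 : (rth R).

Lemma maximal_ideal_typed (m : M) : is_maximal_ideal (ring_data R) m ->
  exists I : sub R, (forall a b, I a -> I b -> I (a + b)) /\ (forall r a, I a -> I (r * a)) /\
    ~ I 1 /\ forall f, ~ I f -> exists x r, I x /\ x + r * f = 1.
Proof.
  intros ((Hsub & [z Hz] & Hadd & Hmul) & Hne & Hmax).
  cbn [sr_set sr_add sr_mul ring_data] in *.
  set (J := Sub (fun a : R => code a ∈ m) (ex_intro _ m (fun t => iff_refl _)) : sub R).
  assert (Ja : forall a b, J a -> J b -> J (a + b)).
  { intros a b Ha Hb; apply (Hadd (code a) (code b)); auto; apply op_codeE; reflexivity. }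
  assert (Jm : forall r a, J a -> J (r * a)).
  { intros r a Ha; apply (Hmul (code r) (code a)); auto; [apply code_in|apply op_codeE; reflexivity]. }
  exists J; split; [exact Ja|]; split; [exact Jm|]; split.
  - intros H1; apply Hne, set_ext; intros x; split; [apply Hsub|].
    intros Hx; apply csetP in Hx as [r <-]; change (J r); replace r with (r * 1) by ring; apply Jm, H1.
  - intros f Hf.
    assert (J0 : J 0).
    { pose proof (Hsub z Hz) as H; apply csetP in H as [a <-].
      replace 0 with (0 * a) by ring; apply Jm, Hz. }
    set (K := Sub (fun y : R => exists x r, J x /\ y = x + r * f) ltac:(clearbody J; int) : sub R).
    destruct (Hmax (code K)) as [E|E].
    + split; [|split; [|split]].
      * intros x Hx; apply sub_codeP in Hx as (a & _ & <-); apply code_in.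
      * exists (code 0); apply (sub_code_in R K); exists 0, 0; split; [exact J0|ring].
      * intros a b c Ha Hb; apply sub_codeP in Ha as (a' & (x & r & Jx & ->) & <-).
        apply sub_codeP in Hb as (b' & (y & s & Jy & ->) & <-).
        intros H; apply op_codeE in H as ->; apply (sub_code_in R K).
        exists (x + y), (r + s); split; [apply Ja; assumption|ring].
      * intros s a c Hs Ha; apply csetP in Hs as [s' <-].
        apply sub_codeP in Ha as (a' & (x & r & Jx & ->) & <-).
        intros H; apply op_codeE in H as ->; apply (sub_code_in R K).
        exists (s' * x), (s' * r); split; [apply Jm, Jx|ring].
    + intros y Hy; pose proof (Hsub y Hy) as H; apply csetP in H as [a <-].
      apply (sub_code_in R K); exists a, 0; split; [exact Hy|ring].
    + destruct Hf; change (code f ∈ m); rewrite <- E; apply (sub_code_in R K).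
      exists 0, 1; split; [exact J0|ring].
    + assert (H1 : code 1 ∈ code K) by (rewrite E; apply code_in).
      apply (sub_code_in R K) in H1 as (x & r & Jx & E1); eauto.
Qed.

End MaximalIdeal.

(** * Disjoint sums of coded types *)

Section Sums.
Context {M : set_structure} {HM : ZF M} (T U : itype M).

(** The side on which the singleton stands serves as the tag, so no separate type of tags is
    needed. *)
Definition sum_emb (x : T + U) : prodI (subI T) (subI U) :=
  match x with
  | inl t => (sadd (sempty T) t, sempty U)
  | inr u => (sempty T, sadd (sempty U) u)
  end.

Lemma sadd_sempty_inj (X : itype M) (x y : X) : sadd (sempty X) x = sadd (sempty X) y -> x = y.
Proof.
  intros E; assert (H : sadd (sempty X) y x) by (rewrite <- E; simpl; auto).
  destruct H as [[]|H]; exact H.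
Qed.

Lemma sadd_not_sempty (X : itype M) (x : X) : sadd (sempty X) x <> sempty X.
Proof. intros E; assert (H : sempty X x) by (rewrite <- E; simpl; auto); exact H. Qed.

Lemma sum_emb_inj x y : sum_emb x = sum_emb y -> x = y.
Proof.
  destruct x as [t|u], y as [t'|u']; cbn [sum_emb]; intros E;
    pose proof (f_equal fst E) as E1; pose proof (f_equal snd E) as E2; cbn [fst snd] in E1, E2.
  - f_equal; apply sadd_sempty_inj, E1.
  - destruct (sadd_not_sempty T t E1).
  - destruct (sadd_not_sempty U u E2).
  - f_equal; apply sadd_sempty_inj, E2.
Qed.

Lemma sum_emb_int : intp (fun p => exists x, sum_emb x = p).
Proof.
  apply (intp_ext _ _ (fun p : prodI (subI T) (subI U) =>
    (exists t, (sadd (sempty T) t, sempty U) = p) \/ exists u, (sempty T, sadd (sempty U) u) = p)).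
  - intros p; split.
    + intros [[t|u] E]; [left|right]; eauto.
    + intros [[t E]|[u E]]; [exists (inl t)|exists (inr u)]; exact E.
  - int.
Qed.

Definition sumI : itype M := embI (T + U) (prodI (subI T) (subI U)) sum_emb sum_emb_inj sum_emb_int.

Definition inlI (t : T) : sumI := inl t.
Definition inrI (u : U) : sumI := inr u.

Lemma inlI_int : intf inlI.
Proof. apply intf_emb; unfold inlI; cbn [sum_emb]; int. Qed.

Lemma inrI_int : intf inrI.
Proof. apply intf_emb; unfold inrI; cbn [sum_emb]; int. Qed.

Lemma inlI_inj t t' : inlI t = inlI t' -> t = t'.
Proof. intros E; injection E; auto. Qed.

Lemma inrI_inj u u' : inrI u = inrI u' -> u = u'.
Proof. intros E; injection E; auto. Qed.

Lemma inlI_inrI t u : inlI t <> inrI u.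
Proof. discriminate. Qed.

End Sums.
#[export] Hint Resolve inlI_int inrI_int : internal.

(** * The ring attached to a family of sets, and the choice function read off from its maximal
    ideal *)

Section ChoiceFunction.
Context {M : set_structure} {HM : ZF M} (I U : itype M) (E : I -> U -> Prop) (HE : intp2 E).

Let K : ring M := rationals.
Let V : itype M := sumI (prodI I U) natI.
Let A : ring M := poly K V.
Local Notation Val := (fnI V K).
Local Notation "0" := (r0 A).
Local Notation "1" := (r1 A).
Local Infix "+" := (radd A).
Local Infix "*" := (rmul A).
Add Ring A_ring' : (rth A).
Add Ring K_ring' : (rth K).

Local Notation inlv := (inlI (prodI I U) natI).
Local Notation inrv := (inrI (prodI I U) natI).
Local Notation ev := (pev K V).
Local Notation X q := (pvar K V (inlv q)).

(** [f] lies in the ideal generated by the variables in [P]. *)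
Definition hit (P : sub (prodI I U)) (f : A) : Prop :=
  forall v : Val, (forall q, P q -> v (inlv q) = r0 K) -> ev f v = r0 K.

Definition partial_choice (P : sub (prodI I U)) : Prop :=
  (forall q, P q -> E (fst q) (snd q)) /\
  (forall q q', P q -> P q' -> fst q = fst q' -> snd q = snd q').

Lemma hit_int : intp2 hit.
Proof. unfold hit; subst A V; int. Qed.

Lemma partial_choice_int : intp partial_choice.
Proof. unfold partial_choice; int. Qed.
Hint Resolve hit_int partial_choice_int : internal.

Definition unhit : sub A := Sub (fun f => forall P, partial_choice P -> ~ hit P f) ltac:(int).

Definition outside (P : sub (prodI I U)) : sub V := Sub (fun w => ~ exists q, w = inlv q /\ P q)
  ltac:(int).

Lemma mix_outside (P : sub (prodI I U)) (v : Val) q : P q -> mix K V (outside P) (r0 K) v (inlv q) = r0 K.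
Proof. intros HP; apply mix_out; intros H; apply H; eauto. Qed.

(** This presents [(P)] as the kernel of an endomorphism of the domain [A], hence as a prime ideal;
    in [unhit_mul] it shows that [unhit] is multiplicative. *)
Lemma hit_subst P f : hit P f <-> psubst K V (outside P) (r0 K) f = 0.
Proof.
  split.
  - intros H; apply poly_ext; intros v; rewrite pev_subst; apply H; intros q Hq; apply mix_outside, Hq.
  - intros H v Hv.
    replace v with (mix K V (outside P) (r0 K) v).
    { rewrite <- pev_subst, H; reflexivity. }
    apply fn_ext; intros w; destruct (classic (outside P w)) as [Hw|Hw]; [apply mix_in, Hw|].
    rewrite mix_out by exact Hw; apply NNPP; intros Hn; apply Hw; intros (q & -> & Hq).
    apply Hn; symmetry; apply Hv, Hq.
Qed.

Lemma A_integral : integral (full A).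
Proof. apply poly_integral; [apply rationals_field|apply rationals_one|apply rationals_infinite]. Qed.

Lemma A_one : 1 <> 0.
Proof. apply poly_one_neq_zero, rationals_one. Qed.

Lemma unhit_1 : unhit 1.
Proof.
  intros P _ H; apply rationals_one; apply (H (Fn (fun _ => r0 K) (intf_const V K (r0 K)))); reflexivity.
Qed.

Lemma unhit_mul f g : unhit f -> unhit g -> unhit (f * g).
Proof.
  intros Hf Hg P HP H; apply hit_subst in H.
  assert (H' : psubst K V (outside P) (r0 K) f * psubst K V (outside P) (r0 K) g = 0).
  { rewrite <- H; symmetry; apply psubst_mul. }
  apply A_integral in H'; try exact Logic.I; destruct H' as [H'|H'];
    [apply (Hf P HP)|apply (Hg P HP)]; apply hit_subst, H'.
Qed.

Lemma unhit_0 : ~ unhit 0.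
Proof.
  intros H; apply (H (sempty _)); [split; [intros q []|intros q q' []]|].
  intros v _; reflexivity.
Qed.

Definition hodges_ring : ring M := localization A A_integral unhit unhit_1 unhit_mul unhit_0.

Lemma hodges_ring_UFD : is_UFD (ring_data hodges_ring).
Proof.
  apply ring_data_UFD.
  - apply localization_integral.
  - apply localization_one, A_one.
  - apply localization_prime_generated, poly_prime_generated;
      [apply rationals_field|apply rationals_one|apply rationals_infinite].
Qed.

Section FromMaximal.
Context (J : sub A)
  (J_add : forall f g, J f -> J g -> J (f + g))
  (J_mul : forall f g, J g -> J (f * g))
  (J_unhit : forall f, J f -> ~ unhit f)
  (J_max : forall f, ~ J f -> exists g h, J g /\ unhit (g + h * f)).

Lemma hitter f : J f -> exists P, partial_choice P /\ hit P f.
Proof.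
  intros Hf; apply NNPP; intros Hn; apply (J_unhit f Hf); intros P HP H; apply Hn; eauto.
Qed.

Lemma ev_add f g v : ev (f + g) v = radd K (ev f v) (ev g v).
Proof. reflexivity. Qed.

Lemma ev_mul f g v : ev (f * g) v = rmul K (ev f v) (ev g v).
Proof. reflexivity. Qed.

Definition set_var (w : V) (c : K) (v : Val) : Val :=
  mix K V (Sub (fun y => y <> w) ltac:(int)) c v.

Lemma set_var_same w c v : set_var w c v w = c.
Proof. apply mix_out; intros H; apply H; reflexivity. Qed.

Lemma set_var_other w c v y : y <> w -> set_var w c v y = v y.
Proof. intros H; exact (mix_in K V (Sub (fun y => y <> w) _) c v y H). Qed.

(** The witness is [f + t g] for a variable [t], outside the blocks, occurring in neither. *)
Lemma common_hitters f g : J f -> J g ->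
  exists h, J h /\ forall P, hit P h -> hit P f /\ hit P g.
Proof.
  intros Hf Hg.
  destruct (poly_finite_support K V f) as (W & HW & Df), (poly_finite_support K V g) as (W' & HW' & Dg).
  destruct (finite_avoid V inrv (sunion W W')) as [n Hn].
  { apply inrI_int. }
  { intros k l; apply inrI_inj. }
  { apply finite_union; assumption. }
  exists (f + pvar K V (inrv n) * g); split; [apply J_add, J_mul; assumption|].
  intros P H.
  assert (Ef : forall c v, ev f (set_var (inrv n) c v) = ev f v).
  { intros c v; apply Df; intros y Hy; apply set_var_other; intros ->; apply Hn; left; exact Hy. }
  assert (Eg : forall c v, ev g (set_var (inrv n) c v) = ev g v).
  { intros c v; apply Dg; intros y Hy; apply set_var_other; intros ->; apply Hn; right; exact Hy. }
  (* The fresh variable can take any value [c] without affecting [f] and [g], so [f + c g] vanishes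
     on the zeros of [P] for every [c]; then [c = 0] and [c = 1] separate the two. *)
  assert (Hc : forall c (v : Val), (forall q, P q -> v (inlv q) = r0 K) ->
    radd K (ev f v) (rmul K c (ev g v)) = r0 K).
  { intros c v Hv; set (v' := set_var (inrv n) c v).
    transitivity (ev (f + pvar K V (inrv n) * g) v').
    - rewrite ev_add, ev_mul; unfold v'; rewrite Ef, Eg.
      change (ev (pvar K V (inrv n)) (set_var (inrv n) c v)) with (set_var (inrv n) c v (inrv n)).
      rewrite set_var_same; reflexivity.
    - apply H; intros q Hq; unfold v'; rewrite set_var_other; [apply Hv, Hq|apply inlI_inrI]. }
  assert (Hf0 : hit P f).
  { intros v Hv; rewrite <- (Hc (r0 K) v Hv); ring. }
  split; [exact Hf0|]; intros v Hv; rewrite <- (Hc (r1 K) v Hv), (Hf0 v Hv); ring.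
Qed.

Definition indicator (q : prodI I U) : Val :=
  set_var (inlv q) (r1 K) (Fn (fun _ => r0 K) (intf_const V K (r0 K))).

(** If [q] is not in [P], the valuation that is [1] at [q] and zero elsewhere is a zero of [P] but
    not of the variable. *)
Lemma hit_variable (P : sub (prodI I U)) q : hit P (X q) -> P q.
Proof.
  intros H; apply NNPP; intros Hq; apply rationals_one; change (r1 K = r0 K).
  rewrite <- (set_var_same (inlv q) (r1 K) (Fn (fun _ => r0 K) (intf_const V K (r0 K)))).
  apply (H (indicator q)); intros q' Hq'; unfold indicator; rewrite set_var_other; [reflexivity|].
  intros Eq; apply inlI_inj in Eq; subst q'; contradiction.
Qed.

Definition chosen (i : I) (u : U) : Prop := J (X (i, u)).

Lemma chosen_int : intp2 chosen.
Proof. unfold chosen; int. Qed.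

Lemma chosen_E i u : chosen i u -> E i u.
Proof.
  intros H; destruct (hitter _ H) as (P & [HP _] & Hh); exact (HP _ (hit_variable _ _ Hh)).
Qed.

Lemma chosen_unique i u u' : chosen i u -> chosen i u' -> u = u'.
Proof.
  intros H H'; destruct (common_hitters _ _ H H') as (h & Jh & Hh).
  destruct (hitter h Jh) as (P & [_ HP] & HPh); destruct (Hh P HPh) as [H1 H2].
  exact (HP _ _ (hit_variable _ _ H1) (hit_variable _ _ H2) eq_refl).
Qed.

Lemma chosen_exists i u0 : E i u0 -> exists u, chosen i u.
Proof.
  intros Eu0; apply NNPP; intros Hno.
  (* By maximality some [g + h X(i,u)] is unhit. If [P] hit [g] and chose nothing but possibly [u]
     at [i], then [P] together with [(i,u)] would be a partial choice hitting this element. *)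
  assert (K1 : forall u, E i u -> exists g, J g /\ forall P, partial_choice P -> hit P g ->
    exists u', u' <> u /\ P (i, u')).
  { intros u Eu; destruct (J_max (X (i, u))) as (g & h & Jg & Hu); [intros H; apply Hno; exists u; exact H|].
    exists g; split; [exact Jg|]; intros P HP HPg; apply NNPP; intros Hn.
    assert (Hx : forall u', P (i, u') -> u' = u).
    { intros u' Hu'; apply NNPP; intros Hne; apply Hn; eauto. }
    assert (HP' : partial_choice (sadd P (i, u))).
    { split.
      - intros q [Hq| ->]; [apply HP, Hq|exact Eu].
      - intros [j w] [j' w'] Hq Hq' Ej; simpl in Ej; subst j'; simpl.
        destruct Hq as [Hq|Hq], Hq' as [Hq'|Hq'].
        + exact (proj2 HP _ _ Hq Hq' eq_refl).
        + injection Hq'; intros -> ->; apply Hx, Hq.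
        + injection Hq; intros -> ->; symmetry; apply Hx, Hq'.
        + congruence. }
    apply (Hu _ HP'); intros v Hv; rewrite ev_add, ev_mul.
    rewrite (HPg v) by (intros q Hq; apply Hv; left; exact Hq).
    change (ev (X (i, u)) v) with (v (inlv (i, u))); rewrite (Hv (i, u)) by (right; reflexivity); ring. }
  destruct (K1 u0 Eu0) as (g0 & Jg0 & Hg0).
  destruct (poly_finite_support K V g0) as (W & HW & Dg0).
  (* The finitely many variables of [g0] are treated one after the other, merging the elements
     supplied by [K1] by means of [common_hitters]. *)
  assert (K2 : exists g, J g /\ forall P, partial_choice P -> hit P g ->
    hit P g0 /\ forall u, W (inlv (i, u)) -> ~ P (i, u)).
  { clear Dg0; revert W HW; apply (finite_ind V (fun W => exists g, J g /\ forall P, partial_choice P ->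
      hit P g -> hit P g0 /\ forall u, W (inlv (i, u)) -> ~ P (i, u))).
    - int.
    - exists g0; split; [exact Jg0|]; intros P _ H; split; [exact H|intros u []].
    - intros W w _ (g & Jg & Hg).
      (* Other variables need no treatment: a pair outside [E] belongs to no partial choice. *)
      destruct (classic (exists u, w = inlv (i, u) /\ E i u)) as [(u & -> & Eu)|Hn].
      + destruct (K1 u Eu) as (g' & Jg' & Hg').
        destruct (common_hitters g g' Jg Jg') as (h & Jh & Hh).
        exists h; split; [exact Jh|]; intros P HP HPh; destruct (Hh P HPh) as [H1 H2].
        destruct (Hg P HP H1) as [H3 H4]; split; [exact H3|].
        intros u' [Hu'|Eu'] Hq; [exact (H4 u' Hu' Hq)|].
        apply inlI_inj in Eu'; injection Eu'; intros ->.
        destruct (Hg' P HP H2) as (u1 & Hne & Hq1); apply Hne; exact (proj2 HP _ _ Hq1 Hq eq_refl).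
      + exists g; split; [exact Jg|]; intros P HP HPg; destruct (Hg P HP HPg) as [H3 H4].
        split; [exact H3|]; intros u [Hu|Eu] Hq; [exact (H4 u Hu Hq)|].
        apply Hn; exists u; split; [symmetry; exact Eu|exact (proj1 HP _ Hq)]. }
  destruct K2 as (g & Jg & Hg), (hitter g Jg) as (P & HP & HPg), (Hg P HP HPg) as [HPg0 Hout].
  (* Only variables of [g0] matter for hitting [g0], so this restriction of [P] still hits it. But
     [P] avoids all variables of [g0] at [i], so [P'] chooses nothing at [i], against the property
     of [g0]. *)
  set (P' := Sub (fun q => P q /\ W (inlv q)) ltac:(int) : sub (prodI I U)).
  destruct (Hg0 P') as (u & _ & [Hq Hw]).
  - split; [intros q [Hq _]; apply HP, Hq|intros q q' [Hq _] [Hq' _]; apply HP; assumption].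
  - intros v Hv; rewrite <- (HPg0 (mix K V W (r0 K) v)).
    + apply Dg0; intros y Hy; symmetry; apply mix_in, Hy.
    + intros q Hq; destruct (classic (W (inlv q))) as [Hw|Hw]; [|apply mix_out, Hw].
      rewrite mix_in by exact Hw; apply Hv; split; assumption.
  - exact (Hout u Hw Hq).
Qed.

End FromMaximal.

Add Ring H_ring : (rth hodges_ring).

Lemma choice_from_UFD : (forall i, exists u, E i u) -> has_maximal_ideal (ring_data hodges_ring) ->
  exists f, intf f /\ forall i, E i (f i).
Proof.
  intros Hne [m Hm]; destruct (maximal_ideal_typed _ m Hm) as (N & Na & Nm & N1 & Nmax).
  set (lc := loc A A_integral unhit unhit_1 unhit_mul unhit_0 : A -> hodges_ring).
  assert (Hlc : intf lc) by exact (loc_int A A_integral unhit unhit_1 unhit_mul unhit_0).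
  set (J := Sub (fun f => N (lc f)) ltac:(clearbody lc; int) : sub A).
  assert (lc_add : forall f g, lc (f + g) = radd hodges_ring (lc f) (lc g))
    by exact (loc_add A A_integral unhit unhit_1 unhit_mul unhit_0).
  assert (lc_mul : forall f g, lc (f * g) = rmul hodges_ring (lc f) (lc g))
    by exact (loc_mul A A_integral unhit unhit_1 unhit_mul unhit_0).
  assert (lc_surj : forall x, exists a s, unhit s /\ rmul hodges_ring x (lc s) = lc a)
    by exact (loc_surj A A_integral unhit unhit_1 unhit_mul unhit_0).
  assert (J_add : forall f g, J f -> J g -> J (f + g)).
  { intros f g Hf Hg; change (N (lc (f + g))); rewrite lc_add; apply Na; assumption. }
  assert (J_mul : forall f g, J g -> J (f * g)).
  { intros f g Hg; change (N (lc (f * g))); rewrite lc_mul; apply Nm; assumption. }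
  assert (J_unhit : forall f, J f -> ~ unhit f).
  { intros f Hf Hu; destruct (loc_unit A A_integral unhit unhit_1 unhit_mul unhit_0 f Hu)
      as [_ (v & _ & Ev)].
    apply N1; fold hodges_ring in Ev; rewrite Ev; rewrite (Rmul_comm (rth hodges_ring)); apply Nm, Hf. }
  assert (J_max : forall f, ~ J f -> exists g h, J g /\ unhit (g + h * f)).
  { intros f Hf; destruct (Nmax (lc f) Hf) as (x & r & Nx & Exr).
    destruct (lc_surj x) as (a & s & Hs & Ea), (lc_surj r) as (b & t & Ht & Eb).
    (* With [x = a / s] and [r = b / t], the equation [x + r f = 1] multiplied by [s t] becomes
       [a t + b s f = s t], an element of [unhit]. *)
    exists (a * t), (b * s); split.
    - change (N (lc (a * t))); rewrite lc_mul, <- Ea.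
      replace (rmul hodges_ring (rmul hodges_ring x (lc s)) (lc t))
        with (rmul hodges_ring (rmul hodges_ring (lc s) (lc t)) x) by ring.
      apply Nm, Nx.
    - replace (a * t + b * s * f) with (s * t); [apply unhit_mul; assumption|].
      apply (loc_inj A A_integral unhit unhit_1 unhit_mul unhit_0).
      change (lc (s * t) = lc (a * t + b * s * f)).
      rewrite lc_add, !lc_mul, <- Ea, <- Eb.
      transitivity (rmul hodges_ring (r1 hodges_ring) (rmul hodges_ring (lc s) (lc t))); [ring|].
      rewrite <- Exr; ring. }
  destruct (unique_choice I U (chosen J)) as [f Hf].
  - intros i; destruct (Hne i) as [u0 Hu0].
    destruct (chosen_exists J J_add J_mul J_unhit J_max i u0 Hu0) as [u Hu].
    exists u; split; [exact Hu|]; intros u' Hu'; exact (chosen_unique J J_add J_mul J_unhit i u u' Hu Hu').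
  - exists f; split.
    + apply (intf_graph _ _ _ _ Hf), chosen_int.
    + intros i; apply (chosen_E J J_unhit), Hf; reflexivity.
Qed.

End ChoiceFunction.

Section AxiomOfChoice.
Context {M : set_structure} {HM : ZF M}.

Lemma choice_from_UFDs : (forall R : srdata M, is_UFD R -> has_maximal_ideal R) -> axiom_of_choice M.
Proof.
  intros H X Hne.
  destruct (zf_union M HM X) as [V HV].
  (* The family is indexed by its own members, so a choice function for membership is one for
     [X]. *)
  set (E := fun (i : elI X) (u : elI V) => code u ∈ code i).
  assert (HE : intp2 E).
  { assert (Hmem := intp2_mem (elI V) (elI X)).
    exact (intp_comp2 (prodI (elI X) (elI V)) (elI V) (elI X) _ (fun p => snd p) (fun p => fst p)
      Hmem ltac:(int) ltac:(int)). }
  destruct (choice_from_UFD (elI X) (elI V) E HE) as (f & Hf & Hfi).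
  - intros [x Hx]; destruct (Hne x Hx) as [y Hy].
    assert (Hyv : y ∈ V) by (apply HV; eauto).
    exists (exist _ y Hyv); exact Hy.
  - apply H, hodges_ring_UFD.
  - exists V, (code (fn_graph _ _ (Fn f Hf))); split; [exact HV|]; split.
    + apply is_function_code.
      * intros i u _; split; [exact (code_in (elI X) i)|exact (code_in (elI V) u)].
      * intros x Hx; exists (exist _ x Hx); split; [reflexivity|].
        exists (f (exist _ x Hx)); split; [reflexivity|intros u' E'; symmetry; exact E'].
    + intros x y _ Hm; apply maps_code in Hm as (i & u & -> & -> & Eu); simpl in Eu.
      rewrite Eu; exact (Hfi i).
Qed.

End AxiomOfChoice.

Theorem corollary3p9 (M : set_structure) (HM : ZF M) :
  (axiom_of_choice M <->
     (forall S : srdata M, is_comm_semiring S -> has_maximal_ideal S)) /\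
  (axiom_of_choice M <->
     (forall R : srdata M, is_comm_ring R -> has_maximal_ideal R)) /\
  (axiom_of_choice M <->
     (forall R : srdata M, is_UFD R -> has_maximal_ideal R)).
Proof.
  assert (H12 : axiom_of_choice M -> forall S : srdata M, is_comm_semiring S -> has_maximal_ideal S).
  { intros AC S HS; exact (semiring_maximal_ideal S HS AC). }
  assert (H41 := choice_from_UFDs (M := M)).
  split; [split; [exact H12|]|split; split].
  - intros H; apply H41; intros R HR; apply H, (ufd_domain R HR).
  - intros AC R HR; apply H12, HR; exact AC.
  - intros H; apply H41; intros R HR; apply H, (ufd_domain R HR).
  - intros AC R HR; apply (H12 AC), (ufd_domain R HR).
  - exact H41.
Qed.
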